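(* Let $\mathcal{H}$ be a separable complex Hilbert space, let $S_{j,n}$, $n\in\mathbb{N}$, and $S_j$, $j=1,2$, be self-adjoint operators in $\mathcal{H}$, and assume that $S_{j,n}$ converges in strong resolvent sense to $S_j$ as $n\to\infty$, for $j=1,2$, respectively. (i) Suppose that for some (and hence for all) $z_0\in\mathbb{C}\setminus\mathbb{R}$, $$\lim_{n\to\infty}\Big\|\big[(S_{2,n}-z_0I_{\mathcal{H}})^{-1}-(S_2-z_0I_{\mathcal{H}})^{-1}\big]-\big[(S_{1,n}-z_0I_{\mathcal{H}})^{-1}-(S_1-z_0I_{\mathcal{H}})^{-1}\big]\Big\|_{\mathcal{B}(\mathcal{H})}=0.$$ Then $$\lim_{n\to\infty}\big\|[f(S_{2,n})-f(S_{1,n})]-[f(S_2)-f(S_1)]\big\|_{\mathcal{B}(\mathcal{H})}=0,\quad f\in C_0^\infty(\mathbb{R}).$$ (ii) Let $p\in[1,\infty)$ and suppose that for some (and hence for all) $z_0\in\mathbb{C}\setminus\mathbb{R}$, $$\big[(S_{2,n}-z_0I_{\mathcal{H}})^{-1}-(S_{1,n}-z_0I_{\mathcal{H}})^{-1}\big],\ \big[(S_2-z_0I_{\mathcal{H}})^{-1}-(S_1-z_0I_{\mathcal{H}})^{-1}\big]\in\mathcal{B}_p(\mathcal{H}),\quad n\in\mathbb{N},$$ and $$\lim_{n\to\infty}\Big\|\big[(S_{2,n}-z_0I_{\mathcal{H}})^{-1}-(S_2-z_0I_{\mathcal{H}})^{-1}\big]-\big[(S_{1,n}-z_0I_{\mathcal{H}})^{-1}-(S_1-z_0I_{\mathcal{H}})^{-1}\big]\Big\|_{\mathcal{B}_p(\mathcal{H})}=0.$$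 Then $$\lim_{n\to\infty}\big\|[f(S_{2,n})-f(S_{1,n})]-[f(S_2)-f(S_1)]\big\|_{\mathcal{B}_p(\mathcal{H})}=0,\quad f\in C_0^\infty(\mathbb{R}).$$
   Context: $I_{\mathcal{H}}$ is the identity operator in $\mathcal{H}$. $\mathcal{B}(\mathcal{H})$ denotes the bounded linear operators on $\mathcal{H}$ with the operator norm, and $\mathcal{B}_p(\mathcal{H})$, $p\in[1,\infty)$, denotes the $\ell^p$-based trace ideal (Schatten--von Neumann class) with its norm $\|\cdot\|_{\mathcal{B}_p(\mathcal{H})}$. $C_0^\infty(\mathbb{R})$ is the space of $C^\infty$-functions of compact support on $\mathbb{R}$. For $S$ self-adjoint (possibly unbounded), $f(S)$ is defined by the functional calculus for self-adjoint operators. Convergence of $S_{j,n}$ to $S_j$ in strong resolvent sense means that $(S_{j,n}-zI_{\mathcal{H}})^{-1}\to(S_j-zI_{\mathcal{H}})^{-1}$ in the strong operator topology for $z\in\mathbb{C}\setminus\mathbb{R}$.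
   Formalization: In (i) the norm convergence of the resolvent differences is assumed for all non-real z_0, not just for some z_0: for the operator norm ''some'' does not imply ''all'', and (i) fails if only one z_0 is required. *)

(* Defs.v *)
From HB Require Import structures.
From mathcomp Require Import all_boot all_order all_algebra.
From mathcomp Require Import complex.
From mathcomp Require Import all_classical all_reals all_analysis.

Set Implicit Arguments.
Unset Strict Implicit.
Unset Printing Implicit Defensive.

Import Order.TTheory GRing.Theory Num.Theory.
Import numFieldNormedType.Exports.

Local Open Scope classical_set_scope.
Local Open Scope complex_scope.
Local Open Scope ring_scope.

HB.mixin Record isHilbert (R : realType) H & CompleteNormedModule R[i] H := {
  inner : H -> H -> R[i];
  inner_linear : forall (a : R[i]) (x y z : H),
    inner (a *: x + y) z = a * inner x z + inner y z;
  inner_conj : forall x y : H, inner y x = (inner x y)^*;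
  inner_norm : forall x : H, inner x x = `|x| ^+ 2
}.

#[short(type="hilbertType")]
HB.structure Definition Hilbert (R : realType) :=
  { H of isHilbert R H & CompleteNormedModule R[i] H }.

Definition separable (T : topologicalType) :=
  exists2 D : set T, countable D & dense D.

(* The norm of H takes its values in R[i]; [rnorm] is the same norm as an
   element of R. *)
Definition rnorm (R : realType) (V : normedModType R[i]) (x : V) : R :=
  complex.Re `|x|.

Section operators.
Context {R : realType} {H : hilbertType R}.
Implicit Types (x y w : H) (z : R[i]).

(* Possibly unbounded linear operators; the values of [op] outside [dom] carry
   no information. *)
Record linop := LinOp {
  dom : set H;
  op :> H -> H;
  dom_0 : dom 0;
  dom_lin : forall (a : R[i]) x y, dom x -> dom y -> dom (a *: x + y);
  op_lin : forall (a : R[i]) x y, dom x -> dom y ->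
    op (a *: x + y) = a *: op x + op y }.

(* [adjoint_graph S y w] says that y is in dom(S^* ) and that S^* y = w. *)
Definition adjoint_graph (S : linop) y w : Prop :=
  forall x, dom S x -> inner (S x) y = inner x w.

Definition selfadjoint (S : linop) : Prop :=
  dense (dom S) /\ forall y w, adjoint_graph S y w <-> dom S y /\ S y = w.

(* (S - z)^-1 y, the solution x in dom S of S x - z x = y (0 if there is none,
   which does not occur for S self-adjoint and z not real). *)
Definition resolvent (S : linop) z : H -> H := fun y =>
  xget 0 [set x | dom S x /\ S x - z *: x = y].

Definition strong_resolvent_cvg (Sn : nat -> linop) (S : linop) : Prop :=
  forall z, complex.Im z != 0 ->
  forall x, resolvent (Sn n) z x @[n --> \oo] --> resolvent S z x.

(* Norm of B(H); it is +oo if T is linear and unbounded. *)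
Definition op_norm (T : H -> H) : \bar R :=
  ereal_sup [set (rnorm (T x))%:E | x in [set x | rnorm x <= 1]].

(* s lists the nonzero singular values of T with multiplicity, i.e. the square
   roots of the nonzero eigenvalues of T^* T, padded with zeros: the e_k with
   s_k != 0 are orthonormal, T^* T e_k = s_k^2 e_k (written weakly), and T
   vanishes on the orthogonal complement of these vectors. *)
Definition singular_values (T : H -> H) (s : nat -> R) : Prop :=
  (forall k, 0 <= s k) /\
  exists e : nat -> H,
    [/\ forall j k, s j != 0 -> s k != 0 -> inner (e j) (e k) = (j == k)%:R,
        forall k x, s k != 0 ->
          inner (T (e k)) (T x) = (s k ^+ 2)%:C * inner (e k) x
      & forall x, (forall k, s k != 0 -> inner x (e k) = 0) -> T x = 0].

(* For bounded T, two sequences of singular values differ by a permutation and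
   by zeros, hence the infimum is over at most one value; it is +oo when T has
   no such sequence. A finite value forces s_k --> 0, i.e. T compact. *)
Definition schatten_norm (p : R) (T : H -> H) : \bar R :=
  ereal_inf [set ((\sum_(0 <= k <oo) (s k `^ p)%:E) `^ p^-1)%E
            | s in singular_values T].

Definition in_schatten (p : R) (T : H -> H) : Prop :=
  [/\ linear T, (op_norm T < +oo)%E & (schatten_norm p T < +oo)%E].

(* Projection-valued measures on the Borel sets of R. *)
Record pvm := PVM {
  pv :> set (measurableTypeR R) -> H -> H;
  pv_lin : forall A, measurable A -> linear (pv A);
  pv_sym : forall A, measurable A ->
    forall x y, inner (pv A x) y = inner x (pv A y);
  pv_setI : forall A B, measurable A -> measurable B ->
    forall x, pv (A `&` B) x = pv A (pv B x);
  pv_set0 : forall x, pv set0 x = 0;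
  pv_setT : forall x, pv setT x = x;
  pv_sigma : forall F : nat -> set (measurableTypeR R),
    (forall i, measurable (F i)) -> trivIset setT F ->
    forall x, (\sum_(0 <= i < n) pv (F i) x) @[n --> \oo]
                --> pv (\bigcup_i F i) x }.

(* The measure A |-> <E(A) x, x>; the squared norm is used because it is
   nonnegative also at the nonmeasurable A. *)
Definition spectral_measure (E : pvm) x (A : set (measurableTypeR R)) : \bar R :=
  ((rnorm (E A x)) ^+ 2)%:E.

End operators.
Arguments linop {R} H.
Arguments pvm {R} H.

Section spectral_measure_is_measure.
Context {R : realType} {H : hilbertType R}.
Variables (E : pvm H) (x : H).

Lemma sqr_rnormE (y : H) : ((rnorm y) ^+ 2)%:C = inner y y.
Proof.
rewrite inner_norm rmorphXn /=; congr (_ ^+ 2).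
by apply/RRe_real/normr_real.
Qed.

Lemma spectral_measureE (A : set (measurableTypeR R)) : measurable A ->
  spectral_measure E x A = (complex.Re (inner (E A x) x))%:E.
Proof.
move=> mA; rewrite /spectral_measure; congr (_%:E).
rewrite -[LHS]/(complex.Re ((rnorm (E A x)) ^+ 2)%:C) sqr_rnormE.
by rewrite -(pv_sym _ mA) -pv_setI// setIid.
Qed.

Lemma spectral_measure0 : spectral_measure E x set0 = 0%E.
Proof.
by rewrite /spectral_measure pv_set0 /rnorm normr0 /= expr0n.
Qed.

Lemma spectral_measure_ge0 A : (0 <= spectral_measure E x A)%E.
Proof. by rewrite lee_fin sqr_ge0. Qed.

Lemma inner0l (y : H) : inner (0 : H) y = 0.
Proof.
have := inner_linear 1 0 0 y.
by rewrite scale1r addr0 mul1r => /eqP; rewrite -subr_eq0 opprD addNKr oppr_eq0 => /eqP.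
Qed.

Lemma innerDl (y y' w : H) : inner (y + y') w = inner y w + inner y' w.
Proof. by rewrite -{1}(scale1r y) inner_linear mul1r. Qed.

Lemma cvg_rnorm (u : nat -> H) (l : H) :
  u n @[n --> \oo] --> l -> rnorm (u n) @[n --> \oo] --> rnorm l.
Proof.
move=> /cvgrPdist_lt ul; apply/cvgrPdist_lt => e e0.
have e0' : 0 < e%:C :> R[i] by rewrite ltcR.
near=> n.
have : `|l - u n| < e%:C by near: n; exact: ul.
rewrite -(RRe_real (normr_real (l - u n))) ltcR; apply: le_lt_trans.
rewrite -lecR (RRe_real (normr_real _)).
apply: le_trans (ler_dist_dist l (u n)).
rewrite -(RRe_real (normr_real l)) -(RRe_real (normr_real (u n))).
by rewrite -rmorphB normc_def /= expr0n addr0 sqrtr_sqr lexx.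
Unshelve. all: by end_near. Qed.

Lemma spectral_measure_sigma_additive :
  semi_sigma_additive (spectral_measure E x).
Proof.
move=> F mF tF mUF.
pose u n := \sum_(0 <= i < n) E (F i) x.
have orth n : rnorm (u n) ^+ 2 = \sum_(0 <= i < n) rnorm (E (F i) x) ^+ 2.
  have ort (i j : nat) : i != j -> inner (E (F i) x) (E (F j) x) = 0.
    move=> ij; rewrite pv_sym// -pv_setI//.
    have -> : F i `&` F j = set0 by move/trivIsetP: tF; apply.
    by rewrite pv_set0 inner_conj inner0l conjC0.
  have ortu m : (forall k y, (forall i, (i < k)%N -> inner (E (F i) x) y = 0) ->
      inner (u k) y = 0) -> inner (u m) (E (F m) x) = 0.
    by move=> h; apply: h => i im; apply: ort; rewrite ltn_eqF.
  have hu k y : (forall i, (i < k)%N -> inner (E (F i) x) y = 0) ->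
      inner (u k) y = 0.
    rewrite /u; elim: k => [|k IH] h; first by rewrite big_nil inner0l.
    rewrite big_nat_recr//= innerDl IH ?add0r; first exact: h.
    by move=> i ik; apply: h; rewrite (ltn_trans ik).
  elim: n => [|n IH]; first by rewrite /u !big_nil /rnorm normr0 /= expr0n.
  rewrite big_nat_recr//= -IH; apply/(@complexI R).
  rewrite rmorphD /= !sqr_rnormE.
  have -> : u n.+1 = u n + E (F n) x by rewrite /u big_nat_recr.
  have o := ortu n hu.
  have o' : inner (E (F n) x) (u n) = 0 by rewrite inner_conj o conjC0.
  rewrite innerDl (inner_conj _ (u n)) (inner_conj _ (E (F n) x)) !innerDl o o'.
  by rewrite addr0 add0r -!inner_conj.
have h : rnorm (u n) ^+ 2 @[n --> \oo] --> rnorm (E (\bigcup_i F i) x) ^+ 2.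
  have h1 := cvg_rnorm (@pv_sigma _ _ E _ mF tF x).
  exact: (cvgM h1 h1).
rewrite (_ : (fun n => _) = EFin \o (fun n => rnorm (u n) ^+ 2)).
  by apply: (cvg_comp _ _ h).
by apply/funext => n /=; rewrite orth sumEFin.
Qed.

HB.instance Definition _ := isMeasure.Build _ (measurableTypeR R) R
  (spectral_measure E x) spectral_measure0 spectral_measure_ge0
  spectral_measure_sigma_additive.

End spectral_measure_is_measure.

Section functional_calculus.
Context {R : realType} {H : hilbertType R}.

(* T is the integral of the Borel function f against E: its domain consists of
   the x such that |f|^2 is integrable for <E(.) x, x>, and <T x, x> is the
   integral of f for this measure. By polarization this determines T. *)
Definition is_spectral_integral (E : pvm H) (f : R -> R[i]) (T : linop H) : Prop :=
  dom T = [set x | (\int[spectral_measure E x]_t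
                      ((complex.Re `|f t|) ^+ 2)%:E < +oo)%E] /\
  forall x, dom T x -> inner (T x) x =
    (\int[spectral_measure E x]_t complex.Re (f t)) +i*
    (\int[spectral_measure E x]_t complex.Im (f t)).

(* A = f(S), i.e. A is the integral of f against the spectral measure of S. By
   the spectral theorem there is exactly one such A (as an operator) for every
   self-adjoint S and Borel function f; if f is bounded, its domain is H. *)
Definition is_functional_calculus (S : linop H) (f : R -> R[i]) (A : linop H) :
    Prop :=
  exists E : pvm H, is_spectral_integral E (fun t => t%:C) S /\
                    is_spectral_integral E f A.

End functional_calculus.

Section test_functions.
Context {R : realType}.

Definition smooth (g : R -> R) : Prop :=
  forall n t, derivable (derive1n n g) t 1.

(* The space C_0^oo(R) of complex-valued functions. *)
Definition test_function (f : R -> R[i]) : Prop :=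
  [/\ smooth (fun t => complex.Re (f t)), smooth (fun t => complex.Im (f t))
    & compact (closure [set t | f t != 0])].

End test_functions.

(* Main.v *)
(* Let u(t) = -(t + i)/(t - i) and let U_S = u(S) be the Cayley transform of a
   self-adjoint S, an affine function of the resolvent at i; its inverse is the
   same function of the resolvent at -i. Under t = tan s a test function f
   becomes a smooth function on the circle R / pi Z, and its discrete Fourier
   interpolation (three summations by parts) approximates f uniformly by sums
   over k < K of a_k u^-k + b_k u^k with |a_k|, |b_k| <= C / (k + 1)^3 and C
   independent of K. So f(S) is approximated in norm, uniformly in S, by the
   same combinations of powers of U_S.

   (i) By the resolvent identity a product of resolvents of S is a norm limit,
   uniformly in S, of linear combinations of resolvents. Hence the convergence
   of the double differences of resolvents at all z0 passes to the powers of
   the Cayley transforms, and then to f.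

   (ii) U_T^(k+1) - U_S^(k+1) = U_T (U_T^k - U_S^k) + (U_T - U_S) U_S^k shows that
   the Schatten norm of U_T^k - U_S^k is at most k times that of U_T - U_S, which
   the decay of a_k and b_k makes summable; so it suffices to treat each k. There,
   and for the change of z0, one uses that X_n T_n Y_n --> X T Y in the Schatten
   norm if T_n --> T in that norm and X_n, Y_n^* converge strongly. *)
Require Import Defs.
From mathcomp Require Import all_boot all_order all_algebra.
From mathcomp Require Import complex ring lra zify.
From mathcomp Require Import all_classical all_reals all_analysis.
From mathcomp Require Import measurable_realfun.
Import Order.TTheory GRing.Theory Num.Theory.
Import numFieldNormedType.Exports.
Set Implicit Arguments.
Unset Strict Implicit.
Unset Printing Implicit Defensive.
Local Open Scope classical_set_scope.
Local Open Scope complex_scope.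
Local Open Scope ring_scope.

(** * Hilbert spaces *)

(** The norms and the operators f(S) are given only indirectly, and this shapes the proof.
    [schatten_norm] is defined by singular values, from which neither the triangle inequality nor
    lower semicontinuity can be read off; estimates are therefore made with [schatten_le], and the
    price is paid once, when singular values are constructed from such a bound. f(S) is known only
    through its diagonal form, an integral against some [pvm]; so S is compared with scalars on the
    ranges of spectral projections of short cells, and even the commutation of S with these
    projections has to be deduced from the form.

    The approximation of f(S) holds in operator norm only, so a Schatten bound survives the limit
    only if it does not depend on the accuracy. The k-th power of a Cayley transform costs a factor
    k, and coefficients of size k^-3 leave the convergent series of k^-2; hence three summations by
    parts. Interpolation keeps all sums finite: it is exact at the nodes, and the same weighted sum
    bounds its slope between them. *)

Section complex_modulus.
Context {R : realType}.
Implicit Types a b : R[i].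

(** Real-valued, because the norm of R[i] takes its values in R[i], which is only partially
    ordered. *)
Definition nc a : R := complex.Re `|a|.

Lemma ncE a : (nc a)%:C = `|a|.
Proof. by rewrite /nc RRe_real// normr_real. Qed.

Lemma nc_ge0 a : 0 <= nc a.
Proof. by rewrite -ler0c ncE. Qed.

Lemma nc0 : nc 0 = 0.
Proof. by apply/complexI; rewrite ncE normr0. Qed.

Lemma nc1 : nc 1 = 1.
Proof. by apply/complexI; rewrite ncE normr1. Qed.

Lemma ncM a b : nc (a * b) = nc a * nc b.
Proof. by apply/complexI; rewrite rmorphM/= !ncE normrM. Qed.

Lemma ncX a n : nc (a ^+ n) = nc a ^+ n.
Proof. by apply/complexI; rewrite rmorphXn/= !ncE normrX. Qed.

Lemma ncD a b : nc (a + b) <= nc a + nc b.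
Proof. by rewrite -lecR rmorphD/= !ncE ler_normD. Qed.

Lemma ncN a : nc (- a) = nc a.
Proof. by apply/complexI; rewrite !ncE normrN. Qed.

Lemma ncB a b : nc (a - b) <= nc a + nc b.
Proof. by rewrite -(ncN b) ncD. Qed.

Lemma ncBC a b : nc (a - b) = nc (b - a).
Proof. by rewrite -ncN opprB. Qed.

Lemma ncV a : nc a^-1 = (nc a)^-1.
Proof. by apply/complexI; rewrite fmorphV/= !ncE normfV. Qed.

Lemma nc_eq0 a : (nc a == 0) = (a == 0).
Proof. by rewrite -(inj_eq (@complexI R)) ncE normr_eq0. Qed.

Lemma ncJ a : nc a^* = nc a.
Proof. by apply/complexI; rewrite !ncE norm_conjC. Qed.

Lemma ncR (r : R) : nc r%:C = `|r|.
Proof. by rewrite /nc normc_def/= expr0n addr0 sqrtr_sqr. Qed.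

Lemma nc_sqr a : nc a ^+ 2 = complex.Re a ^+ 2 + complex.Im a ^+ 2.
Proof. by rewrite /nc normc_def/= sqr_sqrtr// addr_ge0// sqr_ge0. Qed.

Lemma Re_le_nc a : `|complex.Re a| <= nc a.
Proof.
rewrite -ler_sqr ?nnegrE ?nc_ge0// nc_sqr real_normK ?num_real//.
by rewrite lerDl sqr_ge0.
Qed.

Lemma Im_le_nc a : `|complex.Im a| <= nc a.
Proof.
rewrite -ler_sqr ?nnegrE ?nc_ge0// nc_sqr real_normK ?num_real//.
by rewrite lerDr sqr_ge0.
Qed.

Lemma nc_le_ReIm a : nc a <= `|complex.Re a| + `|complex.Im a|.
Proof.
rewrite -ler_sqr ?nnegrE ?nc_ge0 ?addr_ge0// nc_sqr sqrrD !real_normK ?num_real//.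
by rewrite lerD2r lerDl mulrn_wge0// mulr_ge0.
Qed.

Lemma nci : nc 'i = 1.
Proof. by apply/complexI; rewrite ncE normc_def/= expr0n/= add0r expr1n sqrtr1. Qed.

Lemma nc_sum I (r : seq I) (P : pred I) (F : I -> R[i]) :
  nc (\sum_(i <- r | P i) F i) <= \sum_(i <- r | P i) nc (F i).
Proof.
elim/big_ind2 : _ => [|x a y b|//]; first by rewrite nc0.
by move=> h1 h2; apply: le_trans (ncD _ _) _; exact: lerD.
Qed.

Lemma conjcCE a : a^* = (a^*)%C.
Proof. by []. Qed.

Lemma ReM_conj a : complex.Re (a^* * a) = nc a ^+ 2.
Proof. by rewrite nc_sqr; case: a => x y /=; rewrite !expr2; ring. Qed.

Lemma nc_dist_tri (a b c : R[i]) : nc (a - c) <= nc (a - b) + nc (b - c).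
Proof. by have := ncD (a - b) (b - c); rewrite addrA subrK. Qed.

End complex_modulus.

Section hilbert.
Context {R : realType} {H : hilbertType R}.
Implicit Types (x y w : H) (a : R[i]).

Lemma innerZl a x y : inner (a *: x) y = a * inner x y.
Proof. by have := inner_linear a x 0 y; rewrite addr0 inner0l addr0. Qed.

Lemma innerNl x y : inner (- x) y = - inner x y.
Proof. by rewrite -scaleN1r innerZl mulN1r. Qed.

Lemma innerBl x y w : inner (x - y) w = inner x w - inner y w.
Proof. by rewrite innerDl innerNl. Qed.

Lemma inner0r x : inner x (0 : H) = 0.
Proof. by rewrite inner_conj inner0l conjC0. Qed.

Lemma innerDr x y w : inner w (x + y) = inner w x + inner w y.
Proof. by rewrite inner_conj innerDl rmorphD/= -!inner_conj. Qed.

Lemma innerZr a x y : inner x (a *: y) = a^* * inner x y.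
Proof. by rewrite inner_conj innerZl rmorphM/= -inner_conj. Qed.

Lemma innerNr x y : inner x (- y) = - inner x y.
Proof. by rewrite inner_conj innerNl rmorphN/= -inner_conj. Qed.

Lemma innerBr x y w : inner w (x - y) = inner w x - inner w y.
Proof. by rewrite innerDr innerNr. Qed.

Lemma inner_suml I (r : seq I) (P : pred I) (F : I -> H) y :
  inner (\sum_(i <- r | P i) F i) y = \sum_(i <- r | P i) inner (F i) y.
Proof.
elim/big_rec2 : _ => [|i a b _ <-]; first by rewrite inner0l.
by rewrite innerDl.
Qed.

Lemma inner_sumr I (r : seq I) (P : pred I) (F : I -> H) y :
  inner y (\sum_(i <- r | P i) F i) = \sum_(i <- r | P i) inner y (F i).
Proof.
elim/big_rec2 : _ => [|i a b _ <-]; first by rewrite inner0r.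
by rewrite innerDr.
Qed.

Lemma rnormE x : (rnorm x)%:C = `|x|.
Proof. by rewrite /rnorm RRe_real// normr_real. Qed.

Lemma rnorm_ge0 x : 0 <= rnorm x.
Proof. by rewrite -ler0c rnormE. Qed.

Lemma rnorm0 : rnorm (0 : H) = 0.
Proof. by apply/complexI; rewrite rnormE normr0. Qed.

Lemma rnorm_eq0 x : (rnorm x == 0) = (x == 0).
Proof. by rewrite -(inj_eq (@complexI R)) rnormE normr_eq0. Qed.

Lemma rnorm_gt0 x : (0 < rnorm x) = (x != 0).
Proof. by rewrite lt_def rnorm_eq0 rnorm_ge0 andbT. Qed.

Lemma rnormZ a x : rnorm (a *: x) = nc a * rnorm x.
Proof. by apply/complexI; rewrite rmorphM/= ncE !rnormE normrZ. Qed.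

Lemma rnormN x : rnorm (- x) = rnorm x.
Proof. by apply/complexI; rewrite !rnormE normrN. Qed.

Lemma rnormD x y : rnorm (x + y) <= rnorm x + rnorm y.
Proof. by rewrite -lecR rmorphD/= !rnormE ler_normD. Qed.

Lemma rnormB x y : rnorm (x - y) <= rnorm x + rnorm y.
Proof. by rewrite -(rnormN y) rnormD. Qed.

Lemma rnormBC x y : rnorm (x - y) = rnorm (y - x).
Proof. by rewrite -rnormN opprB. Qed.

Lemma rnorm_dist_tri x y w : rnorm (x - w) <= rnorm (x - y) + rnorm (y - w).
Proof. by have := rnormD (x - y) (y - w); rewrite addrA subrK. Qed.

Lemma rnorm_sum I (r : seq I) (P : pred I) (F : I -> H) :
  rnorm (\sum_(i <- r | P i) F i) <= \sum_(i <- r | P i) rnorm (F i).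
Proof.
elim/big_ind2 : _ => [|x a y b|//]; first by rewrite rnorm0.
by move=> h1 h2; apply: le_trans (rnormD _ _) _; exact: lerD.
Qed.

Lemma innerxx x : inner x x = (rnorm x ^+ 2)%:C.
Proof. by rewrite sqr_rnormE. Qed.

Lemma rnorm_sqr x : rnorm x ^+ 2 = complex.Re (inner x x).
Proof. by rewrite innerxx. Qed.

Lemma ReD (a b : R[i]) : complex.Re (a + b) = complex.Re a + complex.Re b.
Proof. by case: a b => [? ?] [? ?]. Qed.

Lemma ReN (a : R[i]) : complex.Re (- a) = - complex.Re a.
Proof. by case: a. Qed.

Lemma ReJ (a : R[i]) : complex.Re a^* = complex.Re a.
Proof. by case: a. Qed.

Lemma ReRM (r : R) (a : R[i]) : complex.Re (r%:C * a) = r * complex.Re a.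
Proof. by case: a => x y /=; rewrite mul0r subr0. Qed.

Lemma rnormD_sqr x y :
  rnorm (x + y) ^+ 2 = rnorm x ^+ 2 + 2 * complex.Re (inner x y) + rnorm y ^+ 2.
Proof.
rewrite !rnorm_sqr innerDl !innerDr !ReD (inner_conj x y) ReJ; ring.
Qed.

Lemma rnormB_sqr x y :
  rnorm (x - y) ^+ 2 = rnorm x ^+ 2 - 2 * complex.Re (inner x y) + rnorm y ^+ 2.
Proof. by rewrite rnormD_sqr rnormN innerNr ReN mulrN. Qed.

Lemma parallelogram x y :
  rnorm (x + y) ^+ 2 + rnorm (x - y) ^+ 2 = 2 * (rnorm x ^+ 2 + rnorm y ^+ 2).
Proof. rewrite rnormD_sqr rnormB_sqr; ring. Qed.

Lemma Re_inner_le x y : complex.Re (inner x y) <= rnorm x * rnorm y.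
Proof.
have [->|x0] := eqVneq x 0; first by rewrite inner0l rnorm0 mul0r.
have [->|y0] := eqVneq y 0; first by rewrite inner0r rnorm0 mulr0.
have px : 0 < rnorm x by rewrite rnorm_gt0.
have py : 0 < rnorm y by rewrite rnorm_gt0.
(* With p = |x|, q = |y| this square equals 2 p q (p q - Re <x, y>). *)
have := sqr_ge0 (rnorm ((rnorm y)%:C *: x - (rnorm x)%:C *: y)).
rewrite rnormB_sqr !rnormZ !ncR !ger0_norm ?rnorm_ge0// innerZl innerZr.
rewrite conjcCE conjc_real !ReRM -(pmulr_lge0 _ (mulr_gt0 px py)).
set p := rnorm x; set q := rnorm y; set t := complex.Re _.
have -> : ((q * p) ^+ 2 - 2 * (q * (p * t)) + (p * q) ^+ 2) =
  2 * (p * q - t) * (p * q) by ring.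
by rewrite pmulr_lge0 ?mulr_gt0// pmulr_lge0 ?mulr_gt0// pmulr_rge0// subr_ge0.
Qed.

Lemma cauchy_schwarz x y : nc (inner x y) <= rnorm x * rnorm y.
Proof.
have [->|s0] := eqVneq (inner x y) 0.
  by rewrite nc0 mulr_ge0// rnorm_ge0.
have ps : 0 < nc (inner x y) by rewrite lt_def nc_eq0 s0 nc_ge0.
(* Multiplying x by the conjugate of <x, y> makes the inner product real and equal to |<x, y>|^2;
   one factor then cancels. *)
have := Re_inner_le ((inner x y)^* *: x) y.
rewrite innerZl ReM_conj rnormZ ncJ expr2 -mulrA ler_pM2l//.
Qed.

Lemma inner_eq0 x : (forall y, inner x y = 0) -> x = 0.
Proof.
move=> h; apply/eqP; rewrite -rnorm_eq0 -sqrf_eq0.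
by rewrite rnorm_sqr h.
Qed.

Lemma inner_inj x y : (forall w, inner x w = inner y w) -> x = y.
Proof.
move=> h; apply/eqP; rewrite -subr_eq0; apply/eqP/inner_eq0 => w.
by rewrite innerBl h subrr.
Qed.

Lemma rnorm_le_sqr x (r : R) : 0 <= r -> rnorm x ^+ 2 <= r ^+ 2 -> rnorm x <= r.
Proof. by move=> r0; rewrite ler_sqr// nnegrE rnorm_ge0. Qed.

Lemma cvgP_rnorm (u : nat -> H) (l : H) :
  (u n @[n --> \oo] --> l) <->
  (forall e : R, 0 < e -> exists N, forall n, (N <= n)%N -> rnorm (u n - l) <= e).
Proof.
split=> [/cvgrPdist_le ul e e0|h].
  have e0' : 0 < e%:C :> R[i] by rewrite ltcR.
  have [N _ hN] := ul _ e0'; exists N => n /hN /=.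
  by rewrite -rnormE lecR rnormBC.
apply/cvgrPdist_le => e; rewrite ltcE => /andP[/eqP/= e1 e0].
have [N hN] := h _ e0.
exists N => // n /= /hN; rewrite rnormBC -lecR rnormE => /le_trans; apply.
by rewrite lecE /= e1 eqxx lexx.
Qed.

Lemma rnorm_complete (u : nat -> H) :
  (forall e : R, 0 < e -> exists N, forall m n, (N <= m)%N -> (N <= n)%N ->
     rnorm (u m - u n) <= e) ->
  exists l : H, u n @[n --> \oo] --> l.
Proof.
move=> h; suff /cauchy_cvgP/cvg_ex[l ul] : cauchy (u @ \oo) by exists l.
apply/cauchy_ballP => e; rewrite ltcE => /andP[/eqP/= e1 e0].
have e2 : 0 < complex.Re e / 2 by rewrite divr_gt0.
have [N hN] := h _ e2.
exists (u @` [set n | (N <= n)%N], u @` [set n | (N <= n)%N]) => /=.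
  by split; exists N => // n nN; exists n.
move=> [_ _] [/= [m mN <-] [n nN <-]].
rewrite -ball_normE/= -rnormE ltcE/= e1 eqxx/=.
by apply: le_lt_trans (hN _ _ mN nN) _; rewrite gtr_pMr// invf_lt1// ltr1n.
Qed.

End hilbert.

(* Identities in a Hilbert space are tested against all vectors, which turns
   them into ring identities in R[i]. *)
Ltac hring := apply: inner_inj => ?; rewrite ?(innerDl, innerNl, innerZl, inner0l); ring.

(** * Projections and resolvents *)

Section projection.
Context {R : realType} {H : hilbertType R}.
Implicit Types (x y w : H) (a : R[i]).

Lemma inner_lim_eq (a b : H) (u v : nat -> H) (l m : H) :
  u n @[n --> \oo] --> l -> v n @[n --> \oo] --> m ->
  (forall n, inner a (u n) = inner b (v n)) -> inner a l = inner b m.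
Proof.
move=> /cvgP_rnorm ul /cvgP_rnorm vm uv.
apply/eqP; rewrite -subr_eq0 -nc_eq0 eq_le nc_ge0 andbT.
apply/ler_addgt0Pl => e e0; rewrite addr0.
pose k := rnorm a + rnorm b + 1.
have k0 : 0 < k by rewrite ltr_wpDl// addr_ge0// rnorm_ge0.
have ek : 0 < e / k by rewrite divr_gt0.
have [N1 h1] := ul _ ek; have [N2 h2] := vm _ ek.
pose n := maxn N1 N2.
have -> : inner a l - inner b m = inner b (v n - m) - inner a (u n - l).
  by rewrite !innerBr uv; ring.
apply: le_trans (ncB _ _) _.
apply: (@le_trans _ _ (rnorm b * (e / k) + rnorm a * (e / k))).
  apply: lerD; apply: le_trans (cauchy_schwarz _ _) _; rewrite ler_wpM2l ?rnorm_ge0//.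
    by apply: h2; rewrite leq_maxr.
  by apply: h1; rewrite leq_maxl.
rewrite -mulrDl mulrCA ger_pMr// ler_pdivrMr// mul1r addrC /k.
by rewrite lerDl.
Qed.

(** The projection theorem in the only form needed: a minimizing sequence for the distance from x to
    V converges to some l in V, and x - l is orthogonal to V, hence 0. *)
Lemma dense_subspace_total (V : set H) :
  V 0 -> (forall a x y, V x -> V y -> V (a *: x + y)) ->
  (forall (u : nat -> H) l, (forall n, V (u n)) -> u n @[n --> \oo] --> l -> V l) ->
  (forall y, (forall x, V x -> inner x y = 0) -> y = 0) ->
  forall x, V x.
Proof.
move=> V0 Vlin Vcl Vorth x.
have VD y w : V y -> V w -> V (y + w) by move=> hy hw; rewrite -(scale1r y); exact: Vlin.
have VZ a y : V y -> V (a *: y) by move=> hy; rewrite -[_ *: _]addr0; exact: Vlin.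
pose D := [set rnorm (x - v) | v in V].
have Dinf : has_inf D.
  split; first by exists (rnorm (x - 0)); exists 0.
  by exists 0 => _ [v _ <-]; exact: rnorm_ge0.
pose d := inf D.
have d0 : 0 <= d.
  apply: lb_le_inf; first by case: Dinf.
  by move=> _ [v _ <-]; exact: rnorm_ge0.
have dle v : V v -> d <= rnorm (x - v).
  by move=> Vv; apply: ge_inf; [case: Dinf|exists v].
have ex_v (n : nat) : exists v, V v /\ rnorm (x - v) < d + n.+1%:R^-1.
  have n0 : 0 < n.+1%:R^-1 :> R by rewrite invr_gt0.
  by have [_ [v Vv <-] h] := inf_adherent n0 Dinf; exists v.
pose v n := projT1 (cid (ex_v n)).
have Vv n : V (v n) by rewrite /v; case: cid => ? [].
have vd n : rnorm (x - v n) < d + n.+1%:R^-1 by rewrite /v; case: cid => ? [].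
(* The midpoint of v m and v n lies in V, so the parallelogram law leaves at most 4 (d + e)^2 - 4
   d^2. *)
have est m n (e : R) : m.+1%:R^-1 <= e -> n.+1%:R^-1 <= e ->
    rnorm (v m - v n) ^+ 2 <= 4 * (2 * d * e + e ^+ 2).
  move=> me ne.
  have := parallelogram (x - v m) (x - v n).
  have -> : x - v m - (x - v n) = v n - v m by hring.
  rewrite (rnormBC (v n)).
  have h : 2 * d <= rnorm (x - v m + (x - v n)).
    have -> : x - v m + (x - v n) = 2%:C *: (x - 2^-1%:C *: (v m + v n)).
      rewrite scalerBr scalerA -rmorphM/= mulfV// scale1r.
      have -> : 2%:C = 1 + 1 :> R[i] by rewrite -(rmorphD (real_complex R)).
      hring.
    rewrite rnormZ ncR ger0_norm// ler_pM2l//; apply: dle.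
    by apply: VZ; apply: VD.
  have hm : rnorm (x - v m) < d + e by apply: lt_le_trans (vd m) _; rewrite lerD2l.
  have hn : rnorm (x - v n) < d + e by apply: lt_le_trans (vd n) _; rewrite lerD2l.
  have := rnorm_ge0 (x - v m); have := rnorm_ge0 (x - v n).
  set p := rnorm (x - v m) in hm *; set q := rnorm (x - v n) in hn *.
  set s := rnorm (_ + _) in h *; move=> q0 p0.
  have hp : p ^+ 2 <= (d + e) ^+ 2 by rewrite ler_sqr ?nnegrE//; lra.
  have hq : q ^+ 2 <= (d + e) ^+ 2 by rewrite ler_sqr ?nnegrE//; lra.
  have hs : (2 * d) ^+ 2 <= s ^+ 2 by rewrite ler_sqr ?nnegrE//; lra.
  move: hp hq hs; rewrite !expr2; nra.
have [l vl] : exists l : H, v n @[n --> \oo] --> l.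
  apply: rnorm_complete => e e0.
  (* For r <= 1 the estimate 4 (2 d r + r^2) is at most k r, so r <= e^2 / k suffices. *)
  pose k := 4 * (2 * d + 1).
  have k0 : 0 < k by rewrite /k; lra.
  pose r := Num.min 1 (e ^+ 2 / k).
  have r0 : 0 < r by rewrite lt_min ltr01 divr_gt0// exprn_gt0.
  have [N _ hN] := near_infty_natSinv_lt (PosNum r0).
  exists N => m n Nm Nn; apply: rnorm_le_sqr; first exact: ltW.
  apply: le_trans (est m n r _ _) _; [exact/ltW/hN|exact/ltW/hN|].
  have r1 : r <= 1 by rewrite ge_min lexx.
  have : r * k <= e ^+ 2 by rewrite -ler_pdivlMr// ge_min lexx orbT.
  rewrite /k; have : r ^+ 2 <= r by rewrite expr2 ger_pMr.
  nra.
have Vl := Vcl _ _ Vv vl.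
have xl : rnorm (x - l) <= d.
  apply/ler_addgt0Pl => e e0.
  have e2 : 0 < e / 2 by rewrite divr_gt0.
  have [N1 h1] := (cvgP_rnorm _ _).1 vl _ e2.
  have [N2 _ h2] := near_infty_natSinv_lt (PosNum e2).
  pose n := maxn N1 N2.
  apply: le_trans (rnorm_dist_tri _ (v n) _) _.
  have q1 := h1 n (leq_maxl _ _); have q3 := vd n.
  have q2 : n.+1%:R^-1 < e / 2 := h2 n (leq_maxr _ _).
  move: (n.+1%:R^-1) q2 q3 => r q2 q3; lra.
suff /eqP : x - l = 0 by rewrite subr_eq0 => /eqP ->.
apply: Vorth => u Vu.
pose c := inner (x - l) u.
suff c0 : c = 0 by rewrite inner_conj -/c c0 conjC0.
(* Minimality of l against the competitor l + t c u; after division by t, letting t tend to 0 gives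
   c = 0. *)
have h (t : R) : 0 < t -> 2 * nc c ^+ 2 <= t * (nc c ^+ 2 * rnorm u ^+ 2).
  move=> t0.
  have := dle (l + t%:C *: (c *: u)) (VD _ _ Vl (VZ _ _ (VZ _ _ Vu))).
  move=> /(le_trans xl); rewrite opprD addrA -ler_sqr ?nnegrE ?rnorm_ge0//.
  rewrite (rnormB_sqr (x - l)) !innerZr conjcCE conjc_real ReRM -/c ReM_conj !rnormZ ncR.
  rewrite gtr0_norm// !exprMn -subr_ge0.
  set A := rnorm _ ^+ 2; set B := nc c ^+ 2; set C := rnorm u ^+ 2.
  have -> : A - 2 * (t * B) + t ^+ 2 * (B * C) - A = t * (t * (B * C) - 2 * B) by ring.
  by rewrite pmulr_rge0// subr_ge0.
apply/eqP; rewrite -nc_eq0 -sqrf_eq0 eq_le sqr_ge0 andbT.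
apply/ler_addgt0Pl => e e0; rewrite addr0.
pose k := nc c ^+ 2 * rnorm u ^+ 2 + 1.
have k0 : 0 < k by rewrite ltr_wpDl// mulr_ge0// sqr_ge0.
have := h (e / k) (divr_gt0 e0 k0) .
have : e / k * (nc c ^+ 2 * rnorm u ^+ 2) <= e.
  by rewrite mulrAC ler_pdivrMr// ler_pM2l// /k lerDl.
have := sqr_ge0 (nc c); lra.
Qed.

End projection.

Section resolvent.
Context {R : realType} {H : hilbertType R}.
Implicit Types (x y w : H) (z : R[i]) (S : linop H).

Lemma selfadjoint_sym S x y : selfadjoint S -> dom S x -> dom S y ->
  inner (S x) y = inner x (S y).
Proof. by move=> [_ sS] dx dy; apply: ((sS y (S y)).2 (conj dy erefl)). Qed.

(** By symmetry <S x, x> is real, so the imaginary part of <(S - z) x, x> is - Im z |x|^2; then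
    apply Cauchy-Schwarz. *)
Lemma op_lower_bound S z x : selfadjoint S -> dom S x ->
  `|complex.Im z| * rnorm x <= rnorm (S x - z *: x).
Proof.
move=> sS dx.
have [->|x0] := eqVneq x 0; first by rewrite rnorm0 mulr0 rnorm_ge0.
have px : 0 < rnorm x by rewrite rnorm_gt0.
have := le_trans (Im_le_nc _) (cauchy_schwarz (S x - z *: x) x).
rewrite innerBl innerZl innerxx.
have : complex.Im (inner (S x) x) = 0.
  have : inner (S x) x = (inner (S x) x)^*.
    by rewrite -inner_conj selfadjoint_sym.
  by case: inner => a b [] /= h; lra.
case: (inner (S x) x) => a b /= ->; case: z => c d /=.
rewrite mulr0 !sub0r add0r normrN normrM (@ger0_norm _ (_ ^+ 2)) ?sqr_ge0//.
by rewrite expr2 mulrA ler_pM2r.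
Qed.

Lemma op_inj S z x : selfadjoint S -> complex.Im z != 0 -> dom S x ->
  S x - z *: x = 0 -> x = 0.
Proof.
move=> sS z0 dx h; have := op_lower_bound z sS dx.
rewrite h rnorm0 pmulr_rle0 ?normr_gt0// => h1; apply/eqP.
by rewrite -rnorm_eq0 eq_le h1 rnorm_ge0.
Qed.

Lemma ImJ z : complex.Im z^* = - complex.Im z.
Proof. by case: z. Qed.

Lemma domB S x y : dom S x -> dom S y -> dom S (x - y).
Proof. by move=> dx dy; rewrite addrC -scaleN1r; exact: dom_lin. Qed.

Lemma opB S x y : dom S x -> dom S y -> S (x - y) = S x - S y.
Proof.
by move=> dx dy; rewrite addrC -scaleN1r op_lin// scaleN1r addrC.
Qed.

Lemma domZ S a x : dom S x -> dom S (a *: x).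
Proof. by move=> dx; rewrite -[_ *: _]addr0; apply: dom_lin => //; exact: dom_0. Qed.

Lemma op0 S : S 0 = 0.
Proof. by have := opB (dom_0 S) (dom_0 S); rewrite !subrr. Qed.

(** The range of S - z is closed, by the lower bound and because S equals its adjoint; a vector
    orthogonal to it is an eigenvector of S for the conjugate of z, hence 0. *)
Lemma op_surj S z : selfadjoint S -> complex.Im z != 0 ->
  forall y, exists x, dom S x /\ S x - z *: x = y.
Proof.
move=> sS z0.
pose V : set H := [set y | exists x, dom S x /\ S x - z *: x = y].
apply: (@dense_subspace_total _ _ V).
- by exists 0; split; [exact: dom_0|rewrite op0 scaler0 subr0].
- move=> a _ _ [x [dx <-]] [y [dy <-]]; exists (a *: x + y); split; first exact: dom_lin.
  rewrite op_lin//; hring.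
- move=> u l uV ul.
  pose x n := projT1 (cid (uV n)).
  have dx n : dom S (x n) by rewrite /x; case: cid => ? [].
  have ux n : S (x n) - z *: x n = u n by rewrite /x; case: cid => ? [].
  have lb m n : `|complex.Im z| * rnorm (x m - x n) <= rnorm (u m - u n).
    apply: le_trans (op_lower_bound z sS (domB (dx m) (dx n))) _.
    have -> : u m - u n = S (x m - x n) - z *: (x m - x n) by rewrite opB// -!ux; hring.
    by [].
  have [y xy] : exists y : H, x n @[n --> \oo] --> y.
    apply: rnorm_complete => e e0.
    have e2 : 0 < `|complex.Im z| * e / 2 by rewrite divr_gt0// mulr_gt0// normr_gt0.
    have [N hN] := (cvgP_rnorm _ _).1 ul _ e2.
    exists N => m n Nm Nn; have iz : 0 < `|complex.Im z| by rewrite normr_gt0.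
    rewrite -(ler_pM2l iz); apply: le_trans (lb _ _) _.
    apply: le_trans (rnorm_dist_tri _ l _) _.
    rewrite (rnormBC l); have := hN _ Nm; have := hN _ Nn; lra.
  have Sxl : S (x n) @[n --> \oo] --> l + z *: y.
    rewrite (_ : (fun n => S (x n)) = (fun n => u n + z *: x n)).
      by apply: cvgD ul _; exact: cvgZr.
    by apply/funext => n; rewrite -ux subrK.
  have [dy Sy] : dom S y /\ S y = l + z *: y.
    apply/(sS.2 y) => w dw; apply: (inner_lim_eq xy Sxl) => n.
    exact: selfadjoint_sym.
  by exists y; rewrite Sy addrK.
- move=> y hy.
  have [dy Sy] : dom S y /\ S y = z^* *: y.
    apply/(sS.2 y) => w dw; rewrite innerZr conjCK.
    apply/eqP; rewrite -subr_eq0 -innerZl -innerBl; apply/eqP.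
    by apply: hy; exists w.
  apply: (@op_inj S z^*) => //; first by rewrite ImJ oppr_eq0.
  by rewrite Sy subrr.
Qed.

Lemma resolventP S z y : selfadjoint S -> complex.Im z != 0 ->
  dom S (resolvent S z y) /\
  S (resolvent S z y) - z *: resolvent S z y = y.
Proof.
move=> sS z0; have [x hx] := op_surj sS z0 y.
by apply: (@xgetPex H 0 [set x | dom S x /\ S x - z *: x = y]); exists x.
Qed.

Lemma resolvent_uniq S z x y : selfadjoint S -> complex.Im z != 0 ->
  dom S x -> S x - z *: x = y -> resolvent S z y = x.
Proof.
move=> sS z0 dx hx; have [dr hr] := resolventP y sS z0.
apply/eqP; rewrite -subr_eq0; apply/eqP; apply: (op_inj sS z0); first exact: domB.
rewrite opB//.
have -> : S (resolvent S z y) - S x - z *: (resolvent S z y - x) =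
  (S (resolvent S z y) - z *: resolvent S z y) - (S x - z *: x) by hring.
by rewrite hr hx subrr.
Qed.

Lemma resolventK S z x : selfadjoint S -> complex.Im z != 0 -> dom S x ->
  resolvent S z (S x - z *: x) = x.
Proof. by move=> sS z0 dx; exact: resolvent_uniq. Qed.

Lemma resolvent_linear S z : selfadjoint S -> complex.Im z != 0 ->
  linear (resolvent S z).
Proof.
move=> sS z0 a x y.
have [dx hx] := resolventP x sS z0; have [dy hy] := resolventP y sS z0.
apply: resolvent_uniq => //; first exact: dom_lin.
rewrite op_lin// -{3}hx -{3}hy; hring.
Qed.

Lemma rnorm_resolvent S z x : selfadjoint S -> complex.Im z != 0 ->
  rnorm (resolvent S z x) <= `|complex.Im z|^-1 * rnorm x.
Proof.
move=> sS z0; have [dx hx] := resolventP x sS z0.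
rewrite mulrC ler_pdivlMr ?normr_gt0// mulrC -{2}hx.
exact: op_lower_bound.
Qed.

Lemma resolvent_adj S z x y : selfadjoint S -> complex.Im z != 0 ->
  inner (resolvent S z x) y = inner x (resolvent S z^* y).
Proof.
move=> sS z0.
have z0' : complex.Im z^* != 0 by rewrite ImJ oppr_eq0.
have [dx hx] := resolventP x sS z0; have [dy hy] := resolventP y sS z0'.
rewrite -{1}hy -{2}hx innerBr innerBl innerZl innerZr conjCK.
by rewrite selfadjoint_sym.
Qed.

Lemma resolvent_identity S z (w : R[i]) x : selfadjoint S ->
  complex.Im z != 0 -> complex.Im w != 0 ->
  resolvent S z x - resolvent S w x = (z - w) *: resolvent S z (resolvent S w x).
Proof.
move=> sS z0 w0.
have [du hu] := resolventP x sS w0; set u := resolvent S w x in du hu *.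
have [dv hv] := resolventP u sS z0; set v := resolvent S z u in dv hv *.
suff -> : resolvent S z x = (z - w) *: v + u by rewrite addrK.
apply: resolvent_uniq => //; first exact: dom_lin.
rewrite op_lin// -hu.
have -> : S v = u + z *: v by rewrite -hv subrK.
hring.
Qed.

End resolvent.

(** * Jensen and Cauchy-Schwarz inequalities for finite sums *)

Section real_sums.
Context {R : realType}.

Lemma convex_powR2 (p t x y : R) : 1 <= p -> 0 <= t <= 1 -> 0 <= x -> 0 <= y ->
  (t * x + (1 - t) * y) `^ p <= t * x `^ p + (1 - t) * y `^ p.
Proof.
move=> p1 t01 x0 y0.
have /= := @convex_powR R p p1 (Itv01 (andP t01).1 (andP t01).2) x y.
rewrite !inE/= !in_itv/= !andbT => /(_ x0 y0).
by rewrite !convRE.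
Qed.

(** The weights need not sum to 1, hence the power p - 1 of their mass. In the induction the first n
    points are merged into their barycenter X / A, and two-point convexity is applied to X / A and
    the new point. *)
Lemma jensen_powR (p : R) (m s : nat -> R) n : 1 <= p ->
  (forall k, 0 <= m k) -> (forall k, 0 <= s k) ->
  (\sum_(k < n) m k * s k) `^ p <=
  (\sum_(k < n) m k) `^ (p - 1) * \sum_(k < n) m k * s k `^ p.
Proof.
move=> p1 m0 s0; have p0 : 0 < p by rewrite (lt_le_trans _ p1).
elim: n => [|n IH]; first by rewrite !big_ord0 mulr0 powR0 ?gt_eqF.
rewrite !big_ord_recr/=.
set A := \sum_(_ < _) m _ in IH *; set X := \sum_(_ < _) _ * s _ in IH *.
set Y := \sum_(_ < _) _ * _ `^ _ in IH *.
have A0 : 0 <= A by apply: sumr_ge0.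
have X0 : 0 <= X by apply: sumr_ge0 => i _; rewrite mulr_ge0.
have Y0 : 0 <= Y by apply: sumr_ge0 => i _; rewrite mulr_ge0// powR_ge0.
have := m0 n; have := s0 n; move: (m n) (s n) => b c c0 b0.
(* Without mass there is no barycenter; all earlier terms vanish. *)
have [AE|AN] := eqVneq A 0.
  have mk (k : 'I_n) : m k = 0.
    by move/eqP: AE; rewrite psumr_eq0// => /allP/(_ k (mem_index_enum _))/eqP.
  have -> : X = 0 by rewrite /X big1// => k _; rewrite mk mul0r.
  have -> : Y = 0 by rewrite /Y big1// => k _; rewrite mk mul0r.
  by rewrite AE !add0r powRM// mulrA [_ * b]mulrC mulr_powRB1.
have Ap : 0 < A by rewrite lt_def AN.
have Abp : 0 < A + b by rewrite ltr_wpDr.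
have Ab0 : 0 <= A + b by exact: ltW.
have XY : A * (X / A) `^ p <= Y.
  rewrite powRM ?invr_ge0// -powR_inv1// -powRrM mulN1r powRN.
  rewrite -(mulr_powRB1 A0 p0) invfM.
  have -> : A * (X `^ p * (A^-1 * (A `^ (p - 1))^-1)) = X `^ p / A `^ (p - 1) by field; rewrite gt_eqF ?powR_gt0// gt_eqF.
  by rewrite ler_pdivrMr ?powR_gt0// mulrC.
have -> : X + b * c = (A + b) * (A / (A + b) * (X / A) + (1 - A / (A + b)) * c).
  by field; rewrite !gt_eqF.
rewrite powRM//; last first.
  rewrite addr_ge0// mulr_ge0// ?divr_ge0//.
  by rewrite subr_ge0 ler_pdivrMr// mul1r lerDl.
rewrite -[X in X * _](mulr_powRB1 Ab0 p0) -mulrA mulrCA ler_wpM2l ?powR_ge0//.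
apply: (@le_trans _ _ ((A + b) * (A / (A + b) * (X / A) `^ p + (1 - A / (A + b)) * c `^ p))).
  rewrite ler_wpM2l//; apply: convex_powR2 => //; last exact: divr_ge0.
  by rewrite divr_ge0//= ler_pdivrMr// mul1r lerDl.
have -> : (A + b) * (A / (A + b) * (X / A) `^ p + (1 - A / (A + b)) * c `^ p) =
  A * (X / A) `^ p + b * c `^ p by field; rewrite !gt_eqF.
by rewrite lerD2r.
Qed.

Lemma sum_cauchy_schwarz (a b : nat -> R) n :
  (\sum_(i < n) a i * b i) ^+ 2 <=
  (\sum_(i < n) a i ^+ 2) * \sum_(i < n) b i ^+ 2.
Proof.
elim: n => [|n IH]; first by rewrite !big_ord0 expr0n mulr0.
rewrite !big_ord_recr/=; move: IH.
have P0 : 0 <= \sum_(i < n) a i ^+ 2 by apply: sumr_ge0 => i _; exact: sqr_ge0.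
have Q0 : 0 <= \sum_(i < n) b i ^+ 2 by apply: sumr_ge0 => i _; exact: sqr_ge0.
move: (\sum_(i < n) a i * b i) (\sum_(i < n) a i ^+ 2) (\sum_(i < n) b i ^+ 2) P0 Q0.
move: (a n) (b n) => x y S P Q P0 Q0 SPQ.
have h : 2 * (S * (x * y)) <= P * y ^+ 2 + Q * x ^+ 2.
  apply: le_trans (ler_norm _) _.
  have r0 : 0 <= P * y ^+ 2 + Q * x ^+ 2 by rewrite addr_ge0// mulr_ge0// sqr_ge0.
  rewrite -ler_sqr ?nnegrE// real_normK ?num_real//.
  have h1 : S ^+ 2 * (x * y) ^+ 2 <= P * Q * (x * y) ^+ 2 by rewrite ler_wpM2r ?sqr_ge0.
  have h2 := sqr_ge0 (P * y ^+ 2 - Q * x ^+ 2).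
  rewrite -subr_ge0.
  have -> : (P * y ^+ 2 + Q * x ^+ 2) ^+ 2 - (2 * (S * (x * y))) ^+ 2 =
    (P * y ^+ 2 - Q * x ^+ 2) ^+ 2 + 4 * (P * Q * (x * y) ^+ 2 - S ^+ 2 * (x * y) ^+ 2) by ring.
  by rewrite addr_ge0// mulr_ge0// subr_ge0.
rewrite sqrrD mulrDl !mulrDr exprMn; lra.
Qed.

Lemma sum_mul_le (a b : nat -> R) n (A B : R) : 0 <= A -> 0 <= B ->
  \sum_(i < n) a i ^+ 2 <= A ^+ 2 -> \sum_(i < n) b i ^+ 2 <= B ^+ 2 ->
  \sum_(i < n) a i * b i <= A * B.
Proof.
move=> A0 B0 hA hB; apply: le_trans (ler_norm _) _.
rewrite -ler_sqr ?nnegrE ?mulr_ge0// real_normK ?num_real//.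
apply: le_trans (sum_cauchy_schwarz _ _ _) _; rewrite exprMn.
by apply: ler_pM => //; apply: sumr_ge0 => i _; exact: sqr_ge0.
Qed.

Lemma sum_tail_small (a : nat -> R) (B : R) : (forall k, 0 <= a k) ->
  (forall n, \sum_(0 <= k < n) a k <= B) ->
  forall e, 0 < e -> exists N, forall n, \sum_(N <= k < n) a k <= e.
Proof.
move=> a0 aB e e0.
pose D := [set \sum_(0 <= k < n) a k | n in setT].
have Ds : has_sup D.
  split; first by exists (\sum_(0 <= k < 0) a k); exists 0%N.
  by exists B => _ [n _ <-].
have [_ [N _ <-] hN] := sup_adherent e0 Ds; exists N => n.
have [nN|Nn] := leqP n N; first by rewrite big_geq// ltW.
have : \sum_(0 <= k < n) a k <= sup D by apply: ub_le_sup; [case: Ds|exists n].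
by rewrite (big_cat_nat (n := N))//= ?(ltnW Nn)//; lra.
Qed.

(** At positive l the power is differentiable; at l = 0 it need not be, and the limit is checked
    directly with the threshold e^(1/p). *)
Lemma cvg_powR (p : R) (u : nat -> R) (l : R) : 0 < p -> (forall n, 0 <= u n) ->
  u n @[n --> \oo] --> l -> u n `^ p @[n --> \oo] --> l `^ p.
Proof.
move=> p0 u0 ul.
have l0 : 0 <= l.
  rewrite -(cvg_lim _ ul)//; apply: limr_ge; first by apply/cvg_ex; exists l.
  by near=> n; exact: u0.
have [l0E|lN] := eqVneq l 0; last first.
  have lp : 0 < l by rewrite lt_def lN.
  have /derivable1_diffP/differentiable_continuous h : derivable (@powR R ^~ p) l 1.
    by apply: derivable_powR; rewrite in_itv/= lp.
  exact: (cvg_comp u (@powR R ^~ p) ul h).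
move: ul; rewrite l0E powR0 ?gt_eqF// => /cvgrPdist_le ul.
apply/cvgrPdist_le => e e0.
have [N _ hN] := ul _ (powR_gt0 p^-1 e0).
exists N => // n /hN /=; rewrite !sub0r !normrN !ger0_norm ?powR_ge0// => h.
have : (u n) `^ p <= (e `^ p^-1) `^ p.
  by apply: ge0_ler_powR => //; rewrite ?nnegrE ?powR_ge0// ltW.
by rewrite -powRrM mulVf ?gt_eqF// powRr1// ltW.
Unshelve. all: by end_near. Qed.

End real_sums.

(** * Schatten norms *)

Section orthonormal.
Context {R : realType} {H : hilbertType R}.
Implicit Types (x y : H) (e : nat -> H).

(* Orthonormal up to shortening (or zeroing) some vectors, which spares case
   distinctions on vanishing singular values. *)
Definition suborth e : Prop :=
  (forall j k, j != k -> inner (e j) (e k) = 0) /\ forall k, rnorm (e k) <= 1.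

Lemma pythagoras e (c : nat -> R[i]) m n : suborth e ->
  rnorm (\sum_(m <= i < n) c i *: e i) ^+ 2 =
  \sum_(m <= i < n) (nc (c i) * rnorm (e i)) ^+ 2.
Proof.
move=> [oe _]; elim: n => [|n IH]; first by rewrite !big_geq// rnorm0 expr0n.
have [nm|mn] := ltnP n m; first by rewrite !big_geq// rnorm0 expr0n.
rewrite !big_nat_recr//= rnormD_sqr IH rnormZ.
suff -> : inner (\sum_(m <= i < n) c i *: e i) (c n *: e n) = 0.
  by rewrite /= mulr0 addr0.
rewrite inner_suml big_nat big1// => i /andP[_ ni].
by rewrite innerZl innerZr oe ?mulr0// ltn_eqF.
Qed.

Lemma bessel e x n : suborth e ->
  \sum_(i < n) nc (inner x (e i)) ^+ 2 <= rnorm x ^+ 2.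
Proof.
move=> oe; pose y := \sum_(0 <= i < n) inner x (e i) *: e i.
set B := \sum_(i < n) _.
have hy : rnorm y ^+ 2 <= B.
  rewrite pythagoras// big_mkord; apply: ler_sum => i _.
  rewrite exprMn ler_piMr ?sqr_ge0//.
  by rewrite expr_le1 ?rnorm_ge0// oe.2.
have xy : complex.Re (inner x y) = B.
  rewrite inner_sumr big_mkord -[RHS]/(complex.Re B%:C); congr complex.Re.
  rewrite rmorph_sum/=; apply: eq_bigr => i _.
  by rewrite innerZr rmorphXn/= ncE normCKC.
have := sqr_ge0 (rnorm (x - y)); rewrite rnormB_sqr xy; lra.
Qed.

Lemma suborth_conj e x j n : suborth e -> (j < n)%N ->
  inner (\sum_(0 <= i < n) inner x (e i) *: e i) (e j) =
  inner x (e j) * (rnorm (e j) ^+ 2)%:C.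
Proof.
move=> [oe _] jn; rewrite inner_suml big_mkord (bigD1 (Ordinal jn))//= innerZl innerxx.
by rewrite big1 ?addr0// => i ij; rewrite innerZl oe ?mulr0.
Qed.

Lemma suborth_expand_cvg e x : suborth e ->
  exists l : H, (\sum_(0 <= i < n) inner x (e i) *: e i) @[n --> \oo] --> l.
Proof.
move=> oe; apply: rnorm_complete => d d0.
have d2 : 0 < d ^+ 2 by rewrite exprn_gt0.
have [N hN] : exists N, forall n, \sum_(N <= k < n) nc (inner x (e k)) ^+ 2 <= d ^+ 2.
  apply: (@sum_tail_small R _ (rnorm x ^+ 2)) => // [k|n]; first exact: sqr_ge0.
  by rewrite big_mkord; exact: bessel.
have key m n : (N <= m)%N -> (m <= n)%N ->
    rnorm (\sum_(0 <= i < n) inner x (e i) *: e i -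
           \sum_(0 <= i < m) inner x (e i) *: e i) <= d.
  move=> Nm mn; rewrite (big_cat_nat (n := m))//= [X in rnorm X]addrC addKr.
  apply: rnorm_le_sqr; first exact: ltW.
  rewrite pythagoras//; apply: le_trans (hN n).
  rewrite (big_cat_nat Nm mn)/= -[X in X <= _]add0r; apply: lerD.
    by apply: sumr_ge0 => i _; exact: sqr_ge0.
  apply: ler_sum => i _; rewrite exprMn ler_piMr ?sqr_ge0//.
  by rewrite expr_le1 ?rnorm_ge0// oe.2.
exists N => m n Nm Nn; have [mn|/ltnW nm] := leqP m n; last exact: key.
by rewrite rnormBC; exact: key.
Qed.

End orthonormal.

Section ideal_bound.
Context {R : realType} {H : hilbertType R}.
Implicit Types (x y : H) (T A B : H -> H).

Lemma linear_fun0 T : linear T -> T 0 = 0.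
Proof. by move=> lT; have := lT (-1) 0 0; rewrite scaler0 addr0 scaleN1r addNr. Qed.

Lemma linear_funZ T a x : linear T -> T (a *: x) = a *: T x.
Proof. by move=> lT; have := lT a x 0; rewrite !addr0 linear_fun0// addr0. Qed.

Lemma linear_funD T x y : linear T -> T (x + y) = T x + T y.
Proof. by move=> lT; have := lT 1 x y; rewrite !scale1r. Qed.

Lemma linear_funB T x y : linear T -> T (x - y) = T x - T y.
Proof. by move=> lT; rewrite linear_funD// -scaleN1r linear_funZ// scaleN1r. Qed.

Lemma linear_fun_sum T n (c : nat -> R[i]) (e : nat -> H) : linear T ->
  T (\sum_(0 <= i < n) c i *: e i) = \sum_(0 <= i < n) c i *: T (e i).
Proof.
move=> lT; elim: n => [|n IH]; first by rewrite !big_geq// linear_fun0.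
by rewrite !big_nat_recr//= linear_funD// linear_funZ// IH.
Qed.

(** The Schmidt expansion, with g_k = T e_k / s_k. By the last clause of [singular_values], T kills
    the difference between x and its expansion in the e_k, and boundedness of T moves it inside the
    limit. Vectors with s_k = 0 are replaced by 0, which keeps both systems [suborth]. *)
Lemma singular_values_expand T s (c : R) : linear T ->
  (forall x, rnorm (T x) <= c * rnorm x) -> singular_values T s ->
  exists e g : nat -> H, [/\ suborth e, suborth g &
    forall x, (\sum_(0 <= k < n) ((s k)%:C * inner x (e k)) *: g k) @[n --> \oo] --> T x].
Proof.
move=> lT bT [s0 [e [on sq van]]].
pose e' k := if s k == 0 then 0 else e k.
pose g k := (s k)^-1%:C *: T (e' k).
have T0 := linear_fun0 lT.
have nn (k : nat) : s k != 0 -> rnorm (e k) = 1.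
  move=> sk; apply/eqP; rewrite -(@eqrXn2 _ 2)// ?rnorm_ge0// expr1n rnorm_sqr on// eqxx.
  by [].
have oe : suborth e'.
  split=> [j k jk|k]; rewrite /e'; last first.
    by case: eqVneq => [_|sk]; rewrite ?rnorm0// nn.
  case: eqVneq => [_|sj]; first by rewrite inner0l.
  case: eqVneq => [_|sk]; first by rewrite inner0r.
  by rewrite on// (negbTE jk).
have Te j k : inner (T (e' j)) (T (e' k)) = (s j ^+ 2)%:C * inner (e' j) (e' k).
  rewrite /e'; case: (eqVneq (s j) 0) => [_|sj]; first by rewrite T0 !inner0l mulr0.
  by rewrite sq.
have og : suborth g.
  split=> [j k jk|k]; rewrite /g.
    by rewrite innerZl innerZr Te oe.1// !mulr0.
  rewrite rnormZ ncR ger0_norm ?invr_ge0//.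
  have [sk|sk] := eqVneq (s k) 0; first by rewrite sk invr0 mul0r.
  have sp : 0 < s k by rewrite lt_def sk s0.
  rewrite mulrC ler_pdivrMr// mul1r; apply: rnorm_le_sqr; first exact: ltW.
  rewrite rnorm_sqr Te innerxx -rmorphM/= ger_pMr ?exprn_gt0//.
  by rewrite expr_le1 ?rnorm_ge0// oe.2.
exists e', g; split=> // x.
have [l xl] := suborth_expand_cvg x oe.
have Txl : T x = T l.
  apply/eqP; rewrite -subr_eq0 -linear_funB//; apply/eqP/van => k sk.
  have ek : e k = e' k by rewrite /e' (negbTE sk).
  apply/eqP; rewrite ek innerBl subr_eq0 (inner_conj _ x) (inner_conj _ l); apply/eqP.
  congr (_^*).
  have hc : (fun _ : nat => x) n @[n --> \oo] --> x by exact: cvg_cst.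
  (* The shift by k + 1 makes every partial sum contain the term e_k. *)
  move: (xl) => /(cvg_comp (addn k.+1) _ (cvg_addnl k.+1)) xl'.
  apply: (inner_lim_eq hc xl') => n /=.
  rewrite inner_conj [RHS]inner_conj suborth_conj//; last by rewrite addSn ltnS leq_addr.
  by rewrite -ek nn// expr1n mulr1.
rewrite Txl.
apply/cvgP_rnorm => d d0.
have c0 : 0 < `|c| + 1 by rewrite ltr_wpDl.
have [N hN] := (cvgP_rnorm _ _).1 xl _ (divr_gt0 d0 c0).
exists N => n Nn.
have -> : \sum_(0 <= k < n) ((s k)%:C * inner x (e' k)) *: g k =
    T (\sum_(0 <= i < n) inner x (e' i) *: e' i).
  rewrite linear_fun_sum//; apply: eq_bigr => k _.
  rewrite /g /e' scalerA mulrAC -rmorphM/=.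
  case: (eqVneq (s k) 0) => [_|sk]; first by rewrite T0 !scaler0.
  by rewrite mulfV// mul1r.
rewrite -linear_funB//; apply: le_trans (bT _) _.
apply: le_trans (ler_wpM2r (rnorm_ge0 _) (ler_norm c)) _.
have := hN n Nn; rewrite ler_pdivlMr// mulrC => /(le_trans _); apply.
by rewrite ler_wpM2r ?rnorm_ge0// lerDl.
Qed.

Definition adjoint_pair A A' : Prop := forall x y, inner (A x) y = inner x (A' y).

Lemma inner_cvg (u : nat -> H) (l y : H) : u n @[n --> \oo] --> l ->
  nc (inner (u n) y) @[n --> \oo] --> nc (inner l y).
Proof.
move=> /cvgP_rnorm ul; apply/cvgrPdist_le => e e0.
have y0 : 0 < rnorm y + 1 by rewrite ltr_wpDl// rnorm_ge0.
have [N hN] := ul _ (divr_gt0 e0 y0); exists N => // n /= Nn.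
apply: (@le_trans _ _ (nc (inner (u n - l) y))).
  rewrite innerBl; have := ncD (inner (u n) y - inner l y) (inner l y).
  have := ncD (inner l y - inner (u n) y) (inner (u n) y).
  rewrite !subrK (ncBC (inner l y)) ler_norml; lra.
apply: le_trans (cauchy_schwarz _ _) _.
have := hN n Nn; rewrite ler_pdivlMr// => /(le_trans _); apply.
by rewrite ler_wpM2l ?rnorm_ge0// lerDl.
Qed.

(* The matrix |<B phi_i, e_k>| |<A g_k, psi_i>| has row sums at most cA cB and
   column sums at most |B'e_k| |A g_k| by Bessel; then apply Jensen to each row. *)
Lemma sandwich_bound (p cA cB S : R) (s : nat -> R) T A A' B B' (e g : nat -> H) :
  1 <= p -> 0 <= cA -> 0 <= cB -> (forall k, 0 <= s k) ->
  suborth e -> suborth g ->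
  (forall x, (\sum_(0 <= k < n) ((s k)%:C * inner x (e k)) *: g k) @[n --> \oo] --> T x) ->
  adjoint_pair A A' -> adjoint_pair B B' ->
  (forall x, rnorm (A' x) <= cA * rnorm x) -> (forall x, rnorm (B x) <= cB * rnorm x) ->
  (forall N, \sum_(k < N) rnorm (B' (e k)) * rnorm (A (g k)) * s k `^ p <= S) ->
  forall phi psi, suborth phi -> suborth psi -> forall n,
  \sum_(i < n) nc (inner (A (T (B (phi i)))) (psi i)) `^ p <= (cA * cB) `^ (p - 1) * S.
Proof.
move=> p1 cA0 cB0 s0 oe og Tx AA' BB' bA bB hS phi psi ophi opsi n.
have p0 : 0 < p by rewrite (lt_le_trans _ p1).
pose TN N x := \sum_(0 <= k < N) ((s k)%:C * inner x (e k)) *: g k.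
pose a N i := nc (inner (TN N (B (phi i))) (A' (psi i))).
(* For fixed n the sum over i is finite, so it suffices to bound it for the expansion of T truncated
   at N. *)
have a_cvg : \sum_(i < n) a N i `^ p @[N --> \oo] -->
    \sum_(i < n) nc (inner (A (T (B (phi i)))) (psi i)) `^ p.
  apply: cvg_big => [|i _]; first by move=> ?; exact: add_continuous.
  rewrite AA'; apply: cvg_powR => // [N|]; first exact: nc_ge0.
  by apply: inner_cvg; exact: Tx.
suff h N : \sum_(i < n) a N i `^ p <= (cA * cB) `^ (p - 1) * S.
  rewrite -(cvg_lim _ a_cvg)//; apply: limr_le; first by apply/cvg_ex; eexists; exact: a_cvg.
  by near=> N.
pose m i k := nc (inner (B (phi i)) (e k)) * nc (inner (g k) (A' (psi i))).
have m0 i k : 0 <= m i k by rewrite mulr_ge0 ?nc_ge0.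
have aN i : a N i <= \sum_(k < N) m i k * s k.
  rewrite /a /TN inner_suml; apply: le_trans (nc_sum _ _ _) _.
  rewrite big_mkord; apply: ler_sum => k _.
  by rewrite innerZl !ncM ncR ger0_norm// -mulrA mulrC.
have row i : \sum_(k < N) m i k <= cA * cB.
  rewrite mulrC; apply: (@sum_mul_le R (fun k => nc (inner (B (phi i)) (e k)))
     (fun k => nc (inner (g k) (A' (psi i))))) => //.
    apply: le_trans (bessel _ _ oe) _; rewrite ler_sqr ?nnegrE ?rnorm_ge0//.
    by apply: le_trans (bB _) _; rewrite ler_piMr// ophi.2.
  under eq_bigr do rewrite inner_conj ncJ.
  apply: le_trans (bessel _ _ og) _; rewrite ler_sqr ?nnegrE ?rnorm_ge0//.
  by apply: le_trans (bA _) _; rewrite ler_piMr// opsi.2.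
have col k : \sum_(i < n) m i k <= rnorm (B' (e k)) * rnorm (A (g k)).
  apply: (@sum_mul_le R (fun i => nc (inner (B (phi i)) (e k)))
     (fun i => nc (inner (g k) (A' (psi i))))); rewrite ?rnorm_ge0//.
    under eq_bigr do rewrite BB' inner_conj ncJ.
    exact: bessel.
  under eq_bigr do rewrite -AA'.
  exact: bessel.
apply: (@le_trans _ _ (\sum_(i < n) (cA * cB) `^ (p - 1) * \sum_(k < N) m i k * s k `^ p)).
  apply: ler_sum => i _.
  apply: (@le_trans _ _ ((\sum_(k < N) m i k * s k) `^ p)).
    apply: ge0_ler_powR; rewrite ?nnegrE ?nc_ge0 ?(ltW p0)//.
    by apply: sumr_ge0 => k _; rewrite mulr_ge0.
  apply: le_trans (@jensen_powR R p (m i) s N p1 (m0 i) s0) _.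
  apply: ler_wpM2r; first by apply: sumr_ge0 => k _; rewrite mulr_ge0// powR_ge0.
  apply: ge0_ler_powR; rewrite ?nnegrE ?subr_ge0 ?mulr_ge0//.
  by apply: sumr_ge0.
rewrite -mulr_sumr ler_wpM2l ?powR_ge0// exchange_big/=.
apply: le_trans (hS N); apply: ler_sum => k _.
by rewrite -mulr_suml ler_wpM2r ?powR_ge0.
Unshelve. all: by end_near. Qed.

End ideal_bound.

Section schatten_bound.
Context {R : realType} {H : hilbertType R}.
Implicit Types (x y : H) (T : H -> H) (p C : R).

(* For p >= 1 the p-th Schatten norm of T is the supremum over all orthonormal
   systems of the l^p-norm of <T phi_i, psi_i>; in this form the triangle
   inequality and the lower semicontinuity are immediate. *)
Definition schatten_le p T C : Prop :=
  forall phi psi, suborth phi -> suborth psi -> forall n,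
  \sum_(i < n) nc (inner (T (phi i)) (psi i)) `^ p <= C `^ p.

Lemma schatten_le_mono p T C C' : 1 <= p -> 0 <= C -> C <= C' ->
  schatten_le p T C -> schatten_le p T C'.
Proof.
move=> p1 C0 CC' h phi psi op os n; apply: le_trans (h _ _ op os n) _.
have p0 : 0 <= p by rewrite (le_trans ler01).
by apply: ge0_ler_powR; rewrite ?nnegrE// (le_trans C0).
Qed.

Lemma schatten_le_ext p T T' C : T =1 T' -> schatten_le p T C -> schatten_le p T' C.
Proof.
move=> TT' h phi psi op os n; apply: le_trans (h _ _ op os n).
by under eq_bigr do rewrite -TT'.
Qed.

(** Minkowski's inequality: Jensen with weights b k is applied to the quotients by b k, and the sum
    over i contributes at most 1 for each k, which leaves W^(p-1) W. *)
Lemma schatten_le_sum p (T : nat -> H -> H) (b : nat -> R) m : 1 <= p ->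
  (forall k, 0 <= b k) -> (forall k, (k < m)%N -> schatten_le p (T k) (b k)) ->
  schatten_le p (fun x => \sum_(k < m) T k x) (\sum_(k < m) b k).
Proof.
move=> p1 b0 hT phi psi op os n.
have p0 : 0 < p by rewrite (lt_le_trans _ p1).
pose d k i := nc (inner (T k (phi i)) (psi i)).
set W := \sum_(k < m) b k.
have W0 : 0 <= W by apply: sumr_ge0.
(* When b k = 0 the bound forces every entry of T k to vanish, so the quotient by 0, which has the
   value 0, does no harm. *)
have bd (k : 'I_m) (i : 'I_n) : b k * (d k i / b k) = d k i.
  have [bk|bk] := eqVneq (b k) 0; last by rewrite mulrC divfK.
  rewrite bk mul0r; apply/esym/eqP.
  have := hT k (ltn_ord k) _ _ op os n; rewrite bk (powR0 (lt0r_neq0 p0)) => h.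
  have : d k i `^ p == 0.
    rewrite eq_le powR_ge0 andbT; apply: le_trans h => /=.
    rewrite (bigD1 i)//= lerDl.
    by apply: sumr_ge0 => j _; exact: powR_ge0.
  by rewrite powR_eq0 => /andP[].

apply: (@le_trans _ _ (\sum_(i < n) W `^ (p - 1) * \sum_(k < m) b k * (d k i / b k) `^ p)).
  apply: ler_sum => i _.
  have := @jensen_powR R p b (fun k => d k i / b k) m p1 b0
    (fun k => divr_ge0 (nc_ge0 _) (b0 k)).
  apply: le_trans; apply: ge0_ler_powR; rewrite ?nnegrE ?nc_ge0 ?(ltW p0)//.
    by apply: sumr_ge0 => k _; rewrite mulr_ge0// divr_ge0// nc_ge0.
  rewrite inner_suml; apply: le_trans (nc_sum _ _ _) _.
  by apply: ler_sum => k _; rewrite bd.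
rewrite -mulr_sumr exchange_big/= -(mulr_powRB1 W0 p0) mulrC ler_wpM2r ?powR_ge0//.
apply: ler_sum => k _; rewrite -mulr_sumr ler_piMr//.
have [bk|bk] := eqVneq (b k) 0.
  under eq_bigr do rewrite bk invr0 mulr0 powR0 ?gt_eqF//.
  by rewrite big1.
have bp : 0 < b k by rewrite lt_def bk b0.
under eq_bigr do rewrite powRM ?nc_ge0 ?invr_ge0//.
rewrite -mulr_suml -powR_inv1// -powRrM mulN1r powRN ler_pdivrMr ?powR_gt0// mul1r.
exact: hT.
Qed.

Lemma schatten_leD p T T' C C' : 1 <= p -> 0 <= C -> 0 <= C' ->
  schatten_le p T C -> schatten_le p T' C' ->
  schatten_le p (fun x => T x + T' x) (C + C').
Proof.
move=> p1 C0 C'0 h h'.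
pose F k := if k == 0%N then T else T'.
pose b k := if k == 0%N then C else C'.
have := @schatten_le_sum p F b 2 p1.
rewrite !big_ord_recr big_ord0 /= add0r => hs.
apply: (schatten_le_ext (T := fun x => \sum_(k < 2) F k x)).
  by move=> x; rewrite !big_ord_recr big_ord0 /= add0r.
by apply: hs => [[|k]|[|[|k]]].
Qed.

Lemma schatten_leZ p T C a : 1 <= p -> 0 <= C -> schatten_le p T C ->
  schatten_le p (fun x => a *: T x) (nc a * C).
Proof.
move=> p1 C0 h phi psi op os n.
under eq_bigr do rewrite innerZl ncM powRM ?nc_ge0//.
by rewrite powRM ?nc_ge0// -mulr_sumr ler_wpM2l ?powR_ge0//; exact: h.
Qed.

Lemma schatten_leB p T T' C C' : 1 <= p -> 0 <= C -> 0 <= C' ->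
  schatten_le p T C -> schatten_le p T' C' ->
  schatten_le p (fun x => T x - T' x) (C + C').
Proof.
move=> p1 C0 C'0 h h'.
apply: (schatten_le_ext (T := fun x => T x + (-1) *: T' x)).
  by move=> x; rewrite scaleN1r.
have := schatten_leZ (-1) p1 C'0 h'.
by rewrite ncN nc1 mul1r; exact: schatten_leD.
Qed.

Lemma suborth_isometry (U : H -> H) e :
  (forall x y, inner (U x) (U y) = inner x y) -> suborth e -> suborth (U \o e).
Proof.
move=> hU [oe ne]; split=> [j k jk|k] /=; first by rewrite hU oe.
by apply: rnorm_le_sqr => //; rewrite rnorm_sqr hU -rnorm_sqr ler_sqr ?nnegrE ?rnorm_ge0.
Qed.

Lemma schatten_le_isometryr p T C (U : H -> H) :
  (forall x y, inner (U x) (U y) = inner x y) ->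
  schatten_le p T C -> schatten_le p (T \o U) C.
Proof.
move=> hU h phi psi op os n.
exact: (h (U \o phi) psi (suborth_isometry hU op)).
Qed.

Lemma schatten_le_isometryl p T C (U U' : H -> H) : adjoint_pair U U' ->
  (forall x y, inner (U' x) (U' y) = inner x y) ->
  schatten_le p T C -> schatten_le p (U \o T) C.
Proof.
move=> UU' hU h phi psi op os n.
under eq_bigr do rewrite UU'.
exact: (h phi (U' \o psi) op (suborth_isometry hU os)).
Qed.

(** The defining sums involve finitely many matrix entries, so convergence of the forms on unit
    balls suffices. *)
Lemma schatten_le_lim p T C : 1 <= p ->
  (forall e, 0 < e -> exists T', schatten_le p T' C /\
     forall x y, rnorm x <= 1 -> rnorm y <= 1 -> nc (inner (T x - T' x) y) <= e) ->
  schatten_le p T C.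
Proof.
move=> p1 hT phi psi op os n.
have p0 : 0 < p by rewrite (lt_le_trans _ p1).
have e0 m : 0 < m.+1%:R^-1 :> R by rewrite invr_gt0.
pose T' m := projT1 (cid (hT _ (e0 m))).
have hT'1 m : schatten_le p (T' m) C by rewrite /T'; case: cid => ? [].
have hT'2 m : forall x y, rnorm x <= 1 -> rnorm y <= 1 ->
    nc (inner (T x - T' m x) y) <= m.+1%:R^-1 by rewrite /T'; case: cid => ? [].
have a_cvg : \sum_(i < n) nc (inner (T' m (phi i)) (psi i)) `^ p @[m --> \oo] -->
    \sum_(i < n) nc (inner (T (phi i)) (psi i)) `^ p.
  apply: cvg_big => [|i _]; first by move=> ?; exact: add_continuous.
  apply: cvg_powR => // [m|]; first exact: nc_ge0.
  apply/cvgrPdist_le => e ep.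
  have [N _ hN] := near_infty_natSinv_lt (PosNum ep).
  exists N => // m /= /hN /= hm; apply: le_trans (ltW hm).
  apply: le_trans (hT'2 m (phi i) (psi i) (op.2 i) (os.2 i)).
  rewrite innerBl; set a := inner _ _; set b := inner _ _.
  have := ncD (a - b) b; have := ncD (b - a) a.
  rewrite !subrK (ncBC b) ler_norml; lra.
rewrite -(cvg_lim _ a_cvg)//; apply: limr_le; first by apply/cvg_ex; eexists; exact: a_cvg.
by near=> m; exact: hT'1.
Unshelve. all: by end_near. Qed.

(** [sandwich_bound] with both outer operators the identity; its weights |e_k| |g_k| are then at
    most 1. *)
Lemma singular_values_schatten_le p T s c C : 1 <= p -> linear T ->
  (forall x, rnorm (T x) <= c * rnorm x) -> singular_values T s ->
  (forall n, \sum_(k < n) s k `^ p <= C `^ p) -> schatten_le p T C.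
Proof.
move=> p1 lT bT sv hC phi psi op os n.
have [e [g [oe og Tx]]] := singular_values_expand lT bT sv.
have b1 (x : H) : rnorm (id x) <= 1 * rnorm x by rewrite mul1r.
have := @sandwich_bound R H p 1 1 (C `^ p) s T id id id id e g p1 ler01 ler01
  sv.1 oe og Tx (fun x y => erefl) (fun x y => erefl) b1 b1 _ phi psi op os n.
rewrite mulr1 powR1 mul1r; apply=> N.
apply: le_trans (hC N); apply: ler_sum => k _.
rewrite ler_piMl ?powR_ge0// mulr_ile1 ?rnorm_ge0//; [exact: oe.2|exact: og.2].
Qed.

Lemma schatten_norm_lt_singular_values p T C : 1 <= p -> 0 <= C ->
  (schatten_norm p T < C%:E)%E ->
  exists s, singular_values T s /\ forall n, \sum_(k < n) s k `^ p <= C `^ p.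
Proof.
move=> p1 C0 /ereal_inf_lt[_ [s sv <-] hs]; exists s; split=> // n.
have p0 : 0 < p by rewrite (lt_le_trans _ p1).
have hS : ((\sum_(k < n) s k `^ p)%:E <= \sum_(0 <= k <oo) (s k `^ p)%:E)%E.
  rewrite -sumEFin -(big_mkord xpredT (fun k => (s k `^ p)%:E)).
  by apply: nneseries_lim_ge => k _ _; rewrite lee_fin powR_ge0.
set S := \sum_(k < n) _ in hS *.
have S0 : 0 <= S by apply: sumr_ge0 => k _; exact: powR_ge0.
have : (S%:E `^ p^-1 <= C%:E)%E.
  apply: le_trans (ltW hs); apply: gt0_ler_poweR => //.
  - by rewrite invr_ge0 ltW.
  - by rewrite in_itv/= leey andbT lee_fin.
  - rewrite in_itv/= leey andbT; apply: nneseries_ge0 => k _ _.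
    by rewrite lee_fin powR_ge0.
rewrite poweR_EFin lee_fin => h.
have : (S `^ p^-1) `^ p <= C `^ p.
  by apply: ge0_ler_powR; rewrite ?nnegrE ?powR_ge0 ?(ltW p0).
by rewrite -powRrM mulVf ?gt_eqF// powRr1.
Qed.

Lemma singular_values_schatten_norm p T s C : 1 <= p -> 0 <= C ->
  singular_values T s -> (forall n, \sum_(k < n) s k `^ p <= C `^ p) ->
  (schatten_norm p T <= C%:E)%E.
Proof.
move=> p1 C0 sv hs; have p0 : 0 < p by rewrite (lt_le_trans _ p1).
apply: le_trans.
  by apply: ereal_inf_lbound; exists s => //; reflexivity.
have hS : (\sum_(0 <= k <oo) (s k `^ p)%:E <= (C `^ p)%:E)%E.
  apply: lime_le; first by apply: is_cvg_nneseries => k _ _; rewrite lee_fin powR_ge0.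
  near=> n; rewrite sumEFin lee_fin big_mkord; exact: hs.
have -> : C%:E = ((C `^ p)%:E `^ p^-1)%E.
  by rewrite poweR_EFin -powRrM mulfV ?gt_eqF// powRr1.
apply: gt0_ler_poweR => //.
- by rewrite invr_ge0 ltW.
- rewrite in_itv/= leey andbT; apply: nneseries_ge0 => k _ _.
  by rewrite lee_fin powR_ge0.
- by rewrite in_itv/= leey andbT lee_fin powR_ge0.
Unshelve. all: by end_near. Qed.

End schatten_bound.

(** * Attainment of the norm on closed subspaces *)

Section maximizer.
Context {R : realType} {H : hilbertType R}.
Implicit Types (x y : H) (T : H -> H) (p C : R).

(* Otherwise one can choose inductively unit vectors phi_m orthogonal to the
   previous ones with T phi_m orthogonal to the previous T phi_j and
   |T phi_m| > e, and psi_m = T phi_m / |T phi_m| contradicts the bound. *)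
Lemma schatten_le_small_off_finite p T C (e : R) : 1 <= p -> linear T ->
  schatten_le p T C -> 0 < e ->
  exists l : seq (H * H), forall x,
    (forall q, q \in l -> inner x q.1 = 0 /\ inner (T x) q.2 = 0) ->
    rnorm (T x) <= e * rnorm x.
Proof.
move=> p1 lT hT e0; apply: contrapT => no.
have p0 : 0 < p by rewrite (lt_le_trans _ p1).
have ex_x (l : seq (H * H)) : exists x,
    [/\ forall q, q \in l -> inner x q.1 = 0 /\ inner (T x) q.2 = 0,
        rnorm x = 1 & e < rnorm (T x)].
  apply: contrapT => nox; apply: no; exists l => x hx.
  rewrite leNgt; apply/negP => hlt; apply: nox.
  have x0 : x != 0.
    by apply: contraTneq hlt => ->; rewrite linear_fun0// rnorm0 mulr0 ltxx.
  have px : 0 < rnorm x by rewrite rnorm_gt0.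
  exists ((rnorm x)^-1%:C *: x).
  have rx : rnorm ((rnorm x)^-1%:C *: x) = 1.
    by rewrite rnormZ ncR ger0_norm ?invr_ge0 ?rnorm_ge0// mulVf ?gt_eqF.
  split=> [q ql| //|]; last first.
    rewrite linear_funZ// rnormZ ncR ger0_norm ?invr_ge0 ?rnorm_ge0//.
    by rewrite mulrC ltr_pdivlMr.
  by rewrite linear_funZ// !innerZl (hx q ql).1 (hx q ql).2 !mulr0.
pose nx l := projT1 (cid (ex_x l)).
have nx1 l : forall q, q \in l -> inner (nx l) q.1 = 0 /\ inner (T (nx l)) q.2 = 0.
  by rewrite /nx; case: cid => ? [].
have nx2 l : rnorm (nx l) = 1 by rewrite /nx; case: cid => ? [].
have nx3 l : e < rnorm (T (nx l)) by rewrite /nx; case: cid => ? [].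
pose ps l := (rnorm (T (nx l)))^-1%:C *: T (nx l).
(* [L n] lists the n pairs chosen so far, and the next vector is chosen relative to the whole
   list. *)
pose L := fix L n := if n is n'.+1 then (nx (L n'), ps (L n')) :: L n' else [::].
pose phi n := nx (L n); pose psi n := ps (L n).
have inL j n : (j < n)%N -> (phi j, psi j) \in L n.
  elim: n => // n IH; rewrite ltnS leq_eqVlt inE => /orP[/eqP->|/IH->].
    by rewrite eqxx.
  by rewrite orbT.
have sym_orth (f : nat -> H) : (forall j n, (j < n)%N -> inner (f n) (f j) = 0) ->
    forall j k, j != k -> inner (f j) (f k) = 0.
  move=> h j k; rewrite neq_ltn => /orP[jk|kj]; last exact: h.
  by rewrite inner_conj h// conjC0.
have ophi : suborth phi.
  split=> [|k]; last by rewrite nx2.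
  by apply: sym_orth => j n jn; have [] := nx1 (L n) _ (inL _ _ jn).
have Tn0 l : 0 < rnorm (T (nx l)) by apply: lt_trans (nx3 l).
have opsi : suborth psi.
  split=> [|k]; last first.
    by rewrite rnormZ ncR ger0_norm ?invr_ge0 ?rnorm_ge0// mulVf ?gt_eqF.
  apply: sym_orth => j n jn; rewrite {1}/psi /ps innerZl.
  by have [_ /= ->] := nx1 (L n) _ (inL _ _ jn); rewrite mulr0.
have diag i : e `^ p <= nc (inner (T (phi i)) (psi i)) `^ p.
  apply: ge0_ler_powR; rewrite ?nnegrE ?nc_ge0 ?(ltW p0) ?(ltW e0)//.
  rewrite innerZr innerxx conjcCE conjc_real -rmorphM/= ncR expr2.
  by rewrite (mulKf (lt0r_neq0 (Tn0 _))) ger0_norm ?rnorm_ge0//; exact/ltW/nx3.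
have ep : 0 < e `^ p by rewrite powR_gt0.
have [n hn] : exists n : nat, C `^ p < n%:R * e `^ p.
  exists (Num.truncn (C `^ p / e `^ p)).+1; rewrite -ltr_pdivrMr//; exact: truncnS_gt.
have := hT phi psi ophi opsi n; rewrite leNgt => /negP; apply.
apply: lt_le_trans hn _; rewrite mulr_natl -[n in _ *+ n]card_ord -sumr_const.
by apply: ler_sum.
Qed.

Definition bounded_functional (f : H -> R[i]) : Prop :=
  (forall a x y, f (a *: x + y) = a * f x + f y) /\
  exists2 M : R, 0 <= M & forall x, nc (f x) <= M * rnorm x.

(** A correction z moves x into the common kernel of f 0, ..., f (m - 1), at a cost controlled by
    the values at x. In the induction step, if f m vanishes on the previous common kernel, the old
    correction works; otherwise one vector k1 of that kernel with f m k1 = 1 repairs the last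
    value. *)
Lemma functional_split (f : nat -> H -> R[i]) m :
  (forall i, bounded_functional (f i)) ->
  exists2 c : R, 0 <= c & forall x, exists z,
    (forall i, (i < m)%N -> f i (x - z) = 0) /\
    rnorm z <= c * \sum_(i < m) nc (f i x).
Proof.
move=> hf; elim: m => [|m [c c0 IH]].
  by exists 0 => // x; exists 0; split=> //; rewrite rnorm0 mul0r.
have fB i x y : f i (x - y) = f i x - f i y.
  by rewrite addrC -scaleN1r (hf i).1 mulN1r addrC.
have fZ i a x : f i (a *: x) = a * f i x.
  have f0 : f i 0 = 0 by have := fB i 0 0; rewrite !subrr.
  by have := (hf i).1 a x 0; rewrite addr0 f0 addr0.
have [[k [hk km]]|none] := pselect (exists k, (forall i, (i < m)%N -> f i k = 0) /\ f m k != 0); last first.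
  exists c => // x; have [z [hz zb]] := IH x; exists z; split.
    move=> i; rewrite ltnS leq_eqVlt => /orP[/eqP->|]; last exact: hz.
    by apply: contrapT => /eqP h; apply: none; exists (x - z).
  by apply: le_trans zb _; rewrite ler_wpM2l// big_ord_recr/= lerDl nc_ge0.
pose k1 := (f m k)^-1 *: k.
have k1m : f m k1 = 1 by rewrite fZ mulVf.
have k1i i : (i < m)%N -> f i k1 = 0 by move=> im; rewrite fZ (hk i im) mulr0.
have [M M0 hM] := (hf m).2.
have r0 := rnorm_ge0 k1.
exists (c + (1 + M * c) * rnorm k1); first by rewrite addr_ge0// mulr_ge0// addr_ge0// mulr_ge0.
move=> x; have [z [hz zb]] := IH x; exists (z + f m (x - z) *: k1); split.
  move=> i; rewrite ltnS leq_eqVlt opprD addrA => /orP[/eqP->|im].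
    by rewrite (fB _ (x - z)) fZ k1m mulr1 subrr.
  by rewrite (fB _ (x - z)) fZ k1i// mulr0 subr0 hz.
apply: le_trans (rnormD _ _) _; rewrite rnormZ big_ord_recr/=.
set s := \sum_(i < m) _ in zb *.
have s0 : 0 <= s by apply: sumr_ge0 => i _; exact: nc_ge0.
have h1 : nc (f m (x - z)) <= nc (f m x) + M * rnorm z.
  by rewrite fB; apply: le_trans (ncB _ _) _; rewrite lerD2l.
have h2 : M * rnorm z <= M * (c * s) by rewrite ler_wpM2l.
have h3 : nc (f m (x - z)) * rnorm k1 <= (nc (f m x) + M * (c * s)) * rnorm k1.
  by rewrite ler_wpM2r//; lra.
apply: le_trans (lerD zb h3) _.
have n0 := nc_ge0 (f m x).
rewrite -subr_ge0; set r := rnorm k1 in r0 *; set t := nc (f m x) in n0 *.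
have -> : (c + (1 + M * c) * r) * (s + t) - (c * s + (t + M * (c * s)) * r) =
  c * t + s * r + M * c * r * t by ring.
by rewrite !addr_ge0// !mulr_ge0.
Qed.

(** By compactness of [-M, M] the sequence converges along U. This replaces the extraction of
    subsequences. *)
Lemma ultra_bounded_cauchy (U : set_system nat) (u : nat -> R) (M : R) :
  UltraFilter U -> (forall n, `|u n| <= M) ->
  forall e, 0 < e -> exists A, U A /\ forall m n, A m -> A n -> `|u m - u n| <= e.
Proof.
move=> UU uM e e0.
have := @segment_compact R (- M) M; rewrite compact_ultra => /(_ (u @ U)).
have UF : UltraFilter (u @ U).
  split=> [|G PG UG]; first exact: fmap_proper_filter.
  apply/funext => A; apply/propext; split=> [GA|/UG//].
  have [//|UnA] := in_ultra_setVsetC (u @^-1` A) UU.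
  have GnA : G (~` A) by apply: UG.
  by have [y []] := filter_ex (filterI GA GnA).
case=> [|l [_ ul]].
  change (U (u @^-1` `[- M, M])).
  apply: filterS (@filterT _ U _) => n _ /=.
  by rewrite in_itv/= -ler_norml.
have e2 : 0 < e / 2 by rewrite divr_gt0.
have /= hA : U [set n | `|l - u n| <= e / 2] by have /cvgrPdist_le/(_ _ e2) := ul.
exists [set n | `|l - u n| <= e / 2]; split=> // m n /= hm hn.
have := ler_distD l (u m) (u n); rewrite (distrC (u m) l); lra.
Qed.

Lemma ultra_functionals_cauchy (U : set_system nat) (f : nat -> H -> R[i]) m (x : nat -> H) :
  UltraFilter U -> (forall i, bounded_functional (f i)) -> (forall n, rnorm (x n) <= 1) ->
  forall e, 0 < e -> exists A, U A /\ forall i j, A i -> A j ->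
    \sum_(k < m) nc (f k (x i - x j)) <= e.
Proof.
move=> UU hf x1; elim: m => [|m IH] e e0.
  by exists setT; split=> [|i j _ _]; [exact: filterT|rewrite big_ord0 ltW].
have e2 : 0 < e / 2 by rewrite divr_gt0.
have e4 : 0 < e / 2 / 2 by rewrite !divr_gt0.
have [A [UA hA]] := IH _ e2.
have [M M0 hM] := (hf m).2.
have bM n : nc (f m (x n)) <= M.
  by apply: le_trans (hM _) _; rewrite ler_piMr.
have bRe n : `|complex.Re (f m (x n))| <= M by apply: le_trans (bM n); exact: Re_le_nc.
have bIm n : `|complex.Im (f m (x n))| <= M by apply: le_trans (bM n); exact: Im_le_nc.
have [B [UB hB]] := ultra_bounded_cauchy UU bRe e4.
have [D [UD hD]] := ultra_bounded_cauchy UU bIm e4.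
exists (A `&` (B `&` D)); split; first by do 2 apply: filterI => //.
move=> i j [Ai [Bi Di]] [Aj [Bj Dj]]; rewrite big_ord_recr/=.
have -> : f m (x i - x j) = f m (x i) - f m (x j).
  by rewrite addrC -scaleN1r (hf m).1 mulN1r addrC.
have := hA i j Ai Aj; have := hB i j Bi Bj; have := hD i j Di Dj.
have := nc_le_ReIm (f m (x i) - f m (x j)).
case: (f m (x i)) => a b; case: (f m (x j)) => c d /=; lra.
Qed.

(** A strong limit of maximizing vectors is obtained in two stages: [schatten_le_small_off_finite]
    makes the images T (x n) Cauchy along an ultrafilter, and the parallelogram law then makes the x
    n themselves Cauchy. The alternative e = 0 covers the case where T vanishes on V. *)
Lemma norm_maximizer p T C c (V : set H) : 1 <= p -> linear T -> 0 <= c ->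
  (forall x, rnorm (T x) <= c * rnorm x) -> schatten_le p T C ->
  V 0 -> (forall a x y, V x -> V y -> V (a *: x + y)) ->
  (forall (u : nat -> H) l, (forall n, V (u n)) -> u n @[n --> \oo] --> l -> V l) ->
  exists e, [/\ V e, e = 0 \/ rnorm e = 1 &
    forall x, V x -> rnorm (T x) <= rnorm (T e) * rnorm x].
Proof.
move=> p1 lT c0 bT hT V0 Vlin Vcl.
have VZ a y : V y -> V (a *: y) by move=> hy; rewrite -[_ *: _]addr0; exact: Vlin.
pose D := [set rnorm (T x) | x in [set x | V x /\ rnorm x <= 1]].
have Ds : has_sup D.
  split; first by exists (rnorm (T 0)); exists 0 => //; rewrite /= rnorm0.
  by exists c => _ [x [_ x1] <-]; apply: le_trans (bT _) _; rewrite ler_piMr.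
pose s := sup D.
have sub x : V x -> rnorm x <= 1 -> rnorm (T x) <= s.
  by move=> Vx x1; apply: ub_le_sup; [case: Ds|exists x].
have s0 : 0 <= s by apply: le_trans (sub 0 V0 _); rewrite ?rnorm_ge0// rnorm0.
have sle x : V x -> rnorm (T x) <= s * rnorm x.
  move=> Vx; have [->|x0] := eqVneq x 0.
    by rewrite linear_fun0// rnorm0 mulr0.
  have px : 0 < rnorm x by rewrite rnorm_gt0.
  have := sub ((rnorm x)^-1%:C *: x) (VZ _ _ Vx).
  rewrite linear_funZ// !rnormZ ncR ger0_norm ?invr_ge0 ?rnorm_ge0// mulVf ?gt_eqF// lexx.
  by move=> /(_ isT); rewrite mulrC ler_pdivrMr.
have [sE|sN] := eqVneq s 0.
  exists 0; split=> //; first by left.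
  by move=> x Vx; rewrite linear_fun0// rnorm0 mul0r; have := sle x Vx; rewrite sE mul0r.
have sp : 0 < s by rewrite lt_def sN.
have ex_x (n : nat) : exists x, [/\ V x, rnorm x <= 1 & s - n.+1%:R^-1 < rnorm (T x)].
  have n0 : 0 < n.+1%:R^-1 :> R by rewrite invr_gt0.
  by have [_ [x [Vx x1] <-] h] := sup_adherent n0 Ds; exists x.
pose x n := projT1 (cid (ex_x n)).
have Vx n : V (x n) by rewrite /x; case: cid => ? [].
have x1 n : rnorm (x n) <= 1 by rewrite /x; case: cid => ? [].
have xs n : s - n.+1%:R^-1 < rnorm (T (x n)) by rewrite /x; case: cid => ? [].
(* One ultrafilter serves all accuracies at once, although the finite family of functionals changes
   with e. *)
have [U [UU ooU]] := @ultraFilterLemma nat \oo _.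
have Tx_cauchy e : 0 < e -> exists A, U A /\ forall m n, A m -> A n ->
    rnorm (T (x m - x n)) <= e.
  move=> e0; have e4 : 0 < e / 4 by rewrite divr_gt0.
  have [l hl] := schatten_le_small_off_finite p1 lT hT e4.
  (* The functionals attached to the pairs of l are interleaved: even indices for the first
     components, odd indices for the second ones applied to T. *)
  pose f (i : nat) : H -> R[i] := fun y => if odd i then inner (T y) (nth (0, 0) l i./2).2
    else inner y (nth (0, 0) l i./2).1.
  have hf i : bounded_functional (f i).
    rewrite /f; case: (odd i); split.
    - by move=> a y w; rewrite lT inner_linear.
    - exists (c * rnorm (nth (0, 0) l i./2).2); first by rewrite mulr_ge0 ?rnorm_ge0.
      move=> y; apply: le_trans (cauchy_schwarz _ _) _.
      by rewrite mulrAC ler_wpM2r ?rnorm_ge0.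
    - by move=> a y w; rewrite inner_linear.
    - exists (rnorm (nth (0, 0) l i./2).1); first exact: rnorm_ge0.
      by move=> y; rewrite mulrC; exact: cauchy_schwarz.
  have [k k0 hk] := functional_split (size l).*2 hf.
  (* The correction z enters with the factor e / 4 + c and |z| is at most k times the sum of the
     functionals; this makes its share at most e / 2. *)
  have K0 : 0 < (e / 4 + c) * k + 1.
    by rewrite ltr_wpDl// mulr_ge0// addr_ge0// ltW.
  have e2K : 0 < e / 2 / ((e / 4 + c) * k + 1) by rewrite divr_gt0// divr_gt0.
  have [A [UA hA]] := @ultra_functionals_cauchy U f (size l).*2 x UU hf x1 _ e2K.
  exists A; split=> // m n Am An.
  have [z [hz zb]] := hk (x m - x n).
  have h1 : rnorm (T (x m - x n - z)) <= e / 4 * rnorm (x m - x n - z).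
    apply: hl => q /(nthP (0, 0))[i il <-]; split.
      have := hz i.*2; rewrite /f odd_double doubleK; apply.
      by rewrite ltn_double.
    have := hz i.*2.+1; rewrite /f/= odd_double/= uphalf_double; apply.
    by rewrite -doubleS ltn_Sdouble.
  have h2 := bT z.
  have h3 : rnorm (x m - x n - z) <= 2 + rnorm z.
    apply: le_trans (rnormB _ _) _; rewrite lerD2r.
    by apply: le_trans (rnormB _ _) _; have := x1 m; have := x1 n; lra.
  have h4 : e / 4 * rnorm (x m - x n - z) <= e / 4 * (2 + rnorm z) by rewrite ler_wpM2l// ltW.
  have h5 : (e / 4 + c) * rnorm z <= e / 2.
    apply: (@le_trans _ _ ((e / 4 + c) * (k * (e / 2 / ((e / 4 + c) * k + 1))))).
      rewrite ler_wpM2l ?addr_ge0 ?(ltW e4)//; apply: le_trans zb _.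
      by rewrite ler_wpM2l//; exact: hA.
    rewrite mulrA mulrCA ger_pMr ?divr_gt0// ler_pdivrMr// mul1r lerDl//.
  have -> : x m - x n = (x m - x n - z) + z by rewrite subrK.
  rewrite linear_funD//; apply: le_trans (rnormD _ _) _.
  move: h1 h2 h4 h5; rewrite mulrDr mulrDl; lra.
have x_cauchy e : 0 < e -> exists A, U A /\ forall m n, A m -> A n ->
    rnorm (x m - x n) <= e.
  move=> e0.
  (* With r = d / s one gets |x m + x n| >= 2 - 3 r, which is nonnegative as r <= 1/2, and hence |x
     m - x n|^2 <= 4 - (2 - 3 r)^2 <= 12 r <= e^2. *)
  pose d := Num.min (s * (e ^+ 2 / 12)) (s / 2).
  have d0 : 0 < d by rewrite lt_min !mulr_gt0 ?exprn_gt0.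
  have [A [UA hA]] := Tx_cauchy _ d0.
  have [N _ hN] := near_infty_natSinv_lt (PosNum d0).
  exists (A `&` [set n | (N <= n)%N]); split.
    by apply: filterI => //; apply: ooU; exists N.
  move=> m n [Am /= Nm] [An /= Nn]; apply: rnorm_le_sqr; first exact: ltW.
  have hd := hA m n Am An.
  have hm : s - d < rnorm (T (x m)).
    by apply: lt_trans (xs m); rewrite ltrD2l ltrN2; exact: hN.
  have h1 : 2 * s - 3 * d <= rnorm (T (x m + x n)).
    have : rnorm (T (2%:C *: x m)) <= rnorm (T (x m + x n)) + rnorm (T (x m - x n)).
      apply: le_trans _ (rnormD _ _); rewrite -linear_funD//.
      rewrite (_ : 2%:C *: _ = x m + x n + (x m - x n))//.
      have -> : 2%:C = 1 + 1 :> R[i] by rewrite -(rmorphD (real_complex R)).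
      hring.
    rewrite linear_funZ// rnormZ ncR ger0_norm//; lra.
  have h2 := sle (x m + x n) _.
  have {}h2 : rnorm (T (x m + x n)) <= s * rnorm (x m + x n).
    by apply: h2; rewrite -(scale1r (x m)); exact: Vlin.
  have := parallelogram (x m) (x n).
  have := rnorm_ge0 (x m + x n); have := rnorm_ge0 (x m); have := rnorm_ge0 (x n).
  have := x1 m; have := x1 n.
  move: (rnorm (x m + x n)) h2 => t h2.
  move: (rnorm (x m)) (rnorm (x n)) (rnorm (x m - x n)) => a b w b1 a1 b0 a0 t0 hp.
  have ht : 2 - 3 * (d / s) <= t.
    rewrite -(ler_pM2l sp) mulrBr mulrCA [s * (d / s)]mulrC divfK//.
    apply: le_trans h2; apply: le_trans h1; lra.
  have ds1 : d / s <= 1 / 2.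
    by rewrite ler_pdivrMr// mul1r mulrC ge_min lexx orbT.
  have ds2 : d / s <= e ^+ 2 / 12.
    by rewrite ler_pdivrMr// mulrC ge_min lexx.
  have ds0 : 0 < d / s by rewrite divr_gt0.
  move: (d / s) ds0 ds1 ds2 ht => r r0 r1 r2 ht.
  move: (e ^+ 2) r2 => E r2.
  have : (2 - 3 * r) ^+ 2 <= t ^+ 2 by rewrite ler_sqr ?nnegrE//; lra.
  have : a ^+ 2 <= 1 by rewrite expr_le1.
  have : b ^+ 2 <= 1 by rewrite expr_le1.
  move: hp; rewrite !expr2; nra.
(* Choosing k j in the intersection of A 0, ..., A j turns the ultrafilter back into an ordinary
   Cauchy sequence. *)
pose A j := projT1 (cid (x_cauchy j.+1%:R^-1 ltac:(by rewrite invr_gt0))).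
have UA j : U (A j) by rewrite /A; case: cid => ? [].
have hA j : forall m n, A j m -> A j n -> rnorm (x m - x n) <= j.+1%:R^-1.
  by rewrite /A; case: cid => ? [].
have ex_n j : exists n, (j <= n)%N /\ forall i, (i <= j)%N -> A i n.
  have hU : U ([set n | (j <= n)%N] `&` [set n | forall i, (i <= j)%N -> A i n]).
    apply: filterI; first by apply: ooU; exists j.
    elim: j => [|j IH].
      by apply: filterS (UA 0%N) => n An i; rewrite leqn0 => /eqP ->.
    apply: filterS (filterI IH (UA j.+1)) => n [h1 h2] i.
    by rewrite leq_eqVlt => /orP[/eqP->//|]; rewrite ltnS; exact: h1.
  by have [n []] := filter_ex hU; exists n.
pose k j := projT1 (cid (ex_n j)).
have kj j : (j <= k j)%N by rewrite /k; case: cid => ? [].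
have Ak j : forall i, (i <= j)%N -> A i (k j) by rewrite /k; case: cid => ? [].
have [l xl] : exists l : H, x (k j) @[j --> \oo] --> l.
  apply: rnorm_complete => e e0.
  have [N _ hN] := near_infty_natSinv_lt (PosNum e0).
  exists N => m n Nm Nn; apply: le_trans _ (ltW (hN N (leqnn N))).
  by apply: hA; exact: Ak.
have Vl : V l by apply: Vcl xl => n.
have l1 : rnorm l <= 1.
  rewrite -(cvg_lim _ (cvg_rnorm xl))//; apply: limr_le.
    by apply/cvg_ex; eexists; exact: cvg_rnorm xl.
  by near=> n; exact: x1.
have Tl : s <= rnorm (T l).
  apply/ler_addgt0Pl => e e0; have e2 : 0 < e / 2 by rewrite divr_gt0.
  have c1 : 0 < c + 1 by rewrite ltr_wpDl.
  have [N1 _ hN1] := near_infty_natSinv_lt (PosNum e2).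
  have [N2 hN2] := (cvgP_rnorm _ _).1 xl _ (divr_gt0 e2 c1).
  pose n := maxn N1 N2.
  have h1 : (k n).+1%:R^-1 < e / 2.
    by apply: hN1 => /=; rewrite (leq_trans _ (kj n))// leq_maxl.
  have h2 := xs (k n).
  have h3 : rnorm (T (x (k n) - l)) <= e / 2.
    apply: le_trans (bT _) _.
    have := hN2 n (leq_maxr _ _); rewrite ler_pdivlMr// mulrC => /(le_trans _); apply.
    by rewrite ler_wpM2r ?rnorm_ge0// lerDl.
  have h4 : rnorm (T (x (k n))) <= rnorm (T (x (k n) - l)) + rnorm (T l).
    by apply: le_trans _ (rnormD _ _); rewrite -linear_funD// subrK.
  move: (_.+1%:R^-1) h1 h2 => r h1 h2; lra.
have Tl' : rnorm (T l) = s by apply/eqP; rewrite eq_le Tl sub.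
exists l; split=> //; last by move=> y Vy; rewrite Tl'; exact: sle.
(* From s <= |T l| <= s |l| and s > 0 one gets |l| >= 1. *)
right; apply/eqP; rewrite eq_le l1/= -(ler_pM2l sp) mulr1.
by apply: le_trans Tl _; exact: sle.
Unshelve. all: by end_near. Qed.

End maximizer.

(** * Existence of singular values *)

Section singular_value_decomposition.
Context {R : realType} {H : hilbertType R}.
Implicit Types (x y : H) (T : H -> H) (p C c : R).

(* The inequality says that the form s^2 <y, w> - <T y, T w> is positive on V;
   it vanishes at e, hence e lies in its kernel. *)
Lemma maximizer_eigenvector T (V : set H) (e : H) : linear T ->
  (forall a x y, V x -> V y -> V (a *: x + y)) ->
  V e -> e = 0 \/ rnorm e = 1 ->
  (forall x, V x -> rnorm (T x) <= rnorm (T e) * rnorm x) ->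
  forall x, V x -> inner (T e) (T x) = (rnorm (T e) ^+ 2)%:C * inner e x.
Proof.
move=> lT Vlin Ve e01 hT x Vx.
have [e0|e1] := e01; first by rewrite e0 linear_fun0// !inner0l mulr0.
set s := rnorm (T e) in hT *.
pose q := inner (T x) (T e) - (s ^+ 2)%:C * inner x e.
suff q0 : q = 0.
  rewrite inner_conj (inner_conj x e) -[(s ^+ 2)%:C]conjc_real -conjcCE -rmorphM/=.
  by congr (_^*); apply/eqP; rewrite -subr_eq0; apply/eqP.
pose K := s ^+ 2 * rnorm x ^+ 2 - rnorm (T x) ^+ 2.
(* The bound is tested at t q e + x. The terms in t^2 cancel because |T e| = s and |e| = 1, and the
   linear term is 2 t |q|^2. *)
have h (t : R) : 0 < t -> 2 * nc q ^+ 2 <= t^-1 * K.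
  move=> t0; have Vy : V ((t%:C * q) *: e + x) by exact: Vlin.
  have := hT _ Vy; rewrite -ler_sqr ?nnegrE ?mulr_ge0 ?rnorm_ge0//.
  rewrite lT exprMn !(addrC (_ *: _)) !rnormD_sqr !rnormZ e1 mulr1 -/s !innerZr !rmorphM/=.
  have -> : (t%:C)^* = t%:C :> R[i] by rewrite conjcCE conjc_real.
  rewrite -!mulrA !ReRM !exprMn ncM.
  set u := rnorm (T x) ^+ 2; set v := rnorm x ^+ 2.
  set a := complex.Re _; set b := complex.Re _ => hh.
  have hq : a - s ^+ 2 * b = nc q ^+ 2.
    rewrite -ReM_conj.
    transitivity (complex.Re (q^* * (inner (T x) (T e) - (s ^+ 2)%:C * inner x e))) => //.
    by rewrite mulrBr ReD ReN (mulrCA q^*) ReRM.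
  rewrite [_^-1 * _]mulrC ler_pdivlMr// /K -/u -/v -hq; move: hh; lra.
apply/eqP; rewrite -nc_eq0 -sqrf_eq0 eq_le sqr_ge0 andbT.
apply/ler_addgt0Pl => d d0; rewrite addr0.
have K0 : 0 <= K.
  by rewrite subr_ge0 -exprMn ler_sqr ?nnegrE ?mulr_ge0 ?rnorm_ge0//; exact: hT.
(* This t makes K / t at most d. *)
have := h ((K + 1) / d) _; rewrite invf_div => /(_ _)/le_trans hh.
have : 2 * nc q ^+ 2 <= d.
  apply: hh; first by rewrite divr_gt0// ltr_wpDl.
  by rewrite mulrAC ler_pdivrMr ?ltr_wpDl// ler_pM2l// lerDl.
have := sqr_ge0 (nc q); lra.
Qed.

(** Each e_k maximizes |T x| on the orthogonal complement of the previous ones, and s_k = |T e_k|.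
    Testing [schatten_le] on e_k and T e_k / s_k bounds the sum of the s_k^p. If T x were nonzero
    for some x orthogonal to all e_k, then all s_k would be at least |T x| / |x|, against this
    bound. *)
Lemma schatten_le_singular_values p T C c : 1 <= p -> linear T -> 0 <= c -> 0 <= C ->
  (forall x, rnorm (T x) <= c * rnorm x) -> schatten_le p T C ->
  exists s, singular_values T s /\ forall n, \sum_(k < n) s k `^ p <= C `^ p.
Proof.
move=> p1 lT c0 C0 bT hT; have p0 : 0 < p by rewrite (lt_le_trans _ p1).
pose V (l : seq H) : set H := [set x | forall v, v \in l -> inner x v = 0].
have Vlin l a x y : V l x -> V l y -> V l (a *: x + y).
  by move=> hx hy v vl; rewrite inner_linear hx// hy// mulr0 addr0.
(* A maximizer with T e = 0 is replaced by e = 0, so that orthogonality to the e_k with s_k != 0 is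
   orthogonality to all e_k. *)
have ex_e l : exists e, [/\ V l e, e = 0 \/ rnorm e = 1, T e = 0 -> e = 0 &
    forall x, V l x -> rnorm (T x) <= rnorm (T e) * rnorm x].
  have V0 : V l 0 by move=> v _; rewrite inner0l.
  suff [e [Ve e01 he]] : exists e, [/\ V l e, e = 0 \/ rnorm e = 1 &
      forall x, V l x -> rnorm (T x) <= rnorm (T e) * rnorm x].
    have [Te|Te] := eqVneq (T e) 0; last first.
      by exists e; split=> // Te0; rewrite Te0 eqxx in Te.
    exists 0; split=> //; first by left.
    by move=> x Vx; rewrite linear_fun0// -Te; exact: he.
  apply: (norm_maximizer p1 lT c0 bT hT) => //.
  - exact: Vlin.
  - move=> u y uV uy v vl; rewrite inner_conj.
    have h0 : (fun _ : nat => 0 : H) n @[n --> \oo] --> (0 : H) by exact: cvg_cst.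
    rewrite (@inner_lim_eq _ _ v 0 u _ _ 0 uy h0) ?inner0l ?conjC0// => n.
    by rewrite ?inner0l inner_conj uV// conjC0.
pose nx l := projT1 (cid (ex_e l)).
have nx1 l : V l (nx l) by rewrite /nx; case: cid => ? [].
have nx2 l : nx l = 0 \/ rnorm (nx l) = 1 by rewrite /nx; case: cid => ? [].
have nx3 l x : V l x -> rnorm (T x) <= rnorm (T (nx l)) * rnorm x.
  by rewrite /nx; case: cid => ? [? ? ? h]; exact: h.
have nx4 l : T (nx l) = 0 -> nx l = 0 by rewrite /nx; case: cid => ? [].
pose L := fix L n := if n is n'.+1 then nx (L n') :: L n' else [::].
pose e n := nx (L n); pose s n := rnorm (T (e n)).
have inL j n : (j < n)%N -> e j \in L n.
  elim: n => // n IH; rewrite ltnS leq_eqVlt inE => /orP[/eqP->|/IH->].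
    by rewrite eqxx.
  by rewrite orbT.
have LP v n : v \in L n -> exists2 j, (j < n)%N & v = e j.
  elim: n => //= n IH; rewrite inE => /orP[/eqP->|/IH[j jn ->]]; first by exists n.
  by exists j => //; rewrite ltnW.
have orth j k : j != k -> inner (e j) (e k) = 0.
  rewrite neq_ltn => /orP[jk|kj]; last exact: (nx1 (L j) _ (inL _ _ kj)).
  by rewrite inner_conj (nx1 (L k) _ (inL _ _ jk)) conjC0.
have oe : suborth e.
  split=> // k; have [h|h] := nx2 (L k); last by rewrite h.
  by rewrite /e h rnorm0 ler01.
have eig0 k x : V (L k) x -> inner (T (e k)) (T x) = (s k ^+ 2)%:C * inner (e k) x.
  exact: (maximizer_eigenvector lT (@Vlin (L k)) (nx1 _) (nx2 _) (@nx3 (L k))).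
have Torth j k : j != k -> inner (T (e j)) (T (e k)) = 0.
  wlog jk : j k / (j < k)%N => [h|jNk].
    rewrite neq_ltn => /orP[jk|kj]; first by apply: h; rewrite ?ltn_eqF.
    by rewrite inner_conj h ?conjC0// ltn_eqF.
  rewrite eig0 ?orth ?mulr0// => v /LP[i ij ->]; rewrite orth//.
  by rewrite gtn_eqF// (ltn_trans ij).
(* Maximality gives the relation on the complement of the earlier vectors; it extends to all x since
   e_k and T e_k are orthogonal to these vectors and to their images. *)
have eig k x : inner (T (e k)) (T x) = (s k ^+ 2)%:C * inner (e k) x.
  pose y := \sum_(0 <= i < k) inner x (e i) *: e i.
  have V1 : V (L k) (x - y).
    move=> v /LP[j jk ->]; rewrite innerBl suborth_conj//.
    have [h|h] := nx2 (L j); last by rewrite /e h expr1n mulr1 subrr.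
    by rewrite /e h !inner0r mul0r subrr.
  have Ty : inner (T (e k)) (T y) = 0.
    rewrite linear_fun_sum// inner_sumr big_mkord big1// => i _.
    by rewrite innerZr Torth ?mulr0// gtn_eqF.
  have ey : inner (e k) y = 0.
    rewrite inner_sumr big_mkord big1// => i _.
    by rewrite innerZr orth ?mulr0// gtn_eqF.
  have := eig0 k _ V1; rewrite linear_funB// !innerBr Ty ey !subr0.
  by [].
have sp n : \sum_(k < n) s k `^ p <= C `^ p.
  pose g k := (s k)^-1%:C *: T (e k).
  have og : suborth g.
    split=> [j k jk|k]; first by rewrite innerZl innerZr Torth// !mulr0.
    rewrite rnormZ ncR ger0_norm ?invr_ge0 ?rnorm_ge0//.
    have [sk|sk] := eqVneq (s k) 0; first by rewrite sk invr0 mul0r.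
    by rewrite mulVf.
  apply: le_trans (hT e g oe og n); apply: ler_sum => k _.
  apply: ge0_ler_powR; rewrite ?nnegrE ?nc_ge0 ?rnorm_ge0 ?(ltW p0)//.
  rewrite innerZr innerxx conjcCE conjc_real -rmorphM/= ncR expr2 -/(s k).
  have [->|sk] := eqVneq (s k) 0; first by rewrite normr_ge0.
  by rewrite mulKf// ler_norm.
exists s; split=> //; split=> [k|]; first exact: rnorm_ge0.
have s0e k : s k != 0 -> rnorm (e k) = 1.
  by have [h|//] := nx2 (L k); rewrite /s /e h linear_fun0// rnorm0 eqxx.
exists e; split=> [j k sj sk|k x _|x hx].
- have [->|jk] := eqVneq j k; last exact: orth.
  by rewrite innerxx s0e// expr1n.
- exact: eig.
- apply/eqP; rewrite -rnorm_eq0.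
  have [//|Tx0] := eqVneq (rnorm (T x)) 0.
  have px : 0 < rnorm x.
    rewrite lt_def rnorm_ge0 rnorm_eq0 andbT; apply: contra_neq Tx0 => ->.
    by rewrite (linear_fun0 lT) rnorm0.
  have pT : 0 < rnorm (T x) by rewrite lt_def Tx0 rnorm_ge0.
  pose d := rnorm (T x) / rnorm x.
  have d0 : 0 < d by rewrite divr_gt0.
  have ds k : d <= s k.
    rewrite ler_pdivrMr//; apply: nx3 => v /LP[j _ ->].
    have [sj|sj] := eqVneq (s j) 0; last exact: hx.
    by rewrite [e j]nx4 ?inner0r//; apply/eqP; rewrite -rnorm_eq0 -/(s j) sj.
  have dp : 0 < d `^ p by rewrite powR_gt0.
  have [n hn] : exists n : nat, C `^ p < n%:R * d `^ p.
    exists (Num.truncn (C `^ p / d `^ p)).+1; rewrite -ltr_pdivrMr//; exact: truncnS_gt.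
  exfalso; have := sp n; rewrite leNgt => /negP; apply.
  apply: lt_le_trans hn _; rewrite mulr_natl -[n in _ *+ n]card_ord -sumr_const.
  apply: ler_sum => k _.
  by apply: ge0_ler_powR; rewrite ?nnegrE ?rnorm_ge0 ?(ltW p0) ?(ltW d0).
Qed.

End singular_value_decomposition.

(** * The ideal property and strongly convergent factors *)

Section ideal.
Context {R : realType} {H : hilbertType R}.
Implicit Types (x y : H) (T A B : H -> H) (p C c : R).

(** The adjoint is passed explicitly since it is always at hand: resolvents at the conjugate point,
    Cayley transforms at the opposite one. *)
Definition adjointable c A A' : Prop :=
  [/\ adjoint_pair A A', forall x, rnorm (A x) <= c * rnorm x
    & forall x, rnorm (A' x) <= c * rnorm x].

Lemma adjoint_linear A A' : adjoint_pair A A' -> linear A.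
Proof.
move=> h a x y; apply: inner_inj => w.
by rewrite h inner_linear inner_linear !h.
Qed.

Lemma adjointableB c d A A' B B' : adjointable c A A' -> adjointable d B B' ->
  adjointable (c + d) (fun x => A x - B x) (fun x => A' x - B' x).
Proof.
move=> [AA' bA bA'] [BB' bB bB']; split=> x.
- by move=> y; rewrite innerBl innerBr AA' BB'.
- by apply: le_trans (rnormB _ _) _; rewrite mulrDl lerD.
- by apply: le_trans (rnormB _ _) _; rewrite mulrDl lerD.
Qed.

Lemma adjointable_id : adjointable 1 id (@id H).
Proof. by split=> // x; rewrite mul1r. Qed.

(* Dominated convergence for the series of [sandwich_bound]. *)
Lemma schatten_le_sandwich_cvg p T C cT c (A A' B B' : nat -> H -> H) :
  1 <= p -> linear T -> 0 <= cT -> 0 <= C -> 0 <= c ->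
  (forall x, rnorm (T x) <= cT * rnorm x) -> schatten_le p T C ->
  (forall n, adjointable c (A n) (A' n)) -> (forall n, adjointable c (B n) (B' n)) ->
  (forall x y e, 0 < e -> \forall n \near \oo, rnorm (B' n x) * rnorm (A n y) <= e) ->
  forall e, 0 < e -> \forall n \near \oo, schatten_le p (fun x => A n (T (B n x))) e.
Proof.
move=> p1 lT cT0 C0 c0 bT hT hA hB hAB e e0.
have p0 : 0 < p by rewrite (lt_le_trans _ p1).
have [s [sv hs]] := schatten_le_singular_values p1 lT cT0 C0 bT hT.
have [eg [g [oe og Tx]]] := singular_values_expand lT bT sv.
pose K := (c * c) `^ (p - 1).
have K0 : 0 <= K by exact: powR_ge0.
have L0 : 0 < K * (1 + c * c) + 1 by rewrite ltr_wpDl// mulr_ge0// addr_ge0// mulr_ge0.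
(* The head of the series contributes d and the tail, whose weights are at most c^2, contributes c^2
   d; multiplied by K this must stay below e^p. *)
pose d := e `^ p / (K * (1 + c * c) + 1).
have d0 : 0 < d by rewrite divr_gt0// powR_gt0.
have [N hN] : exists N, forall n, \sum_(N <= k < n) s k `^ p <= d.
  apply: (@sum_tail_small R _ (C `^ p)) => // [k|n]; first exact: powR_ge0.
  by rewrite big_mkord.
have wb n k : rnorm (B' n (eg k)) * rnorm (A n (g k)) <= c * c.
  have [_ bA _] := hA n; have [_ _ bB'] := hB n.
  apply: ler_pM; rewrite ?rnorm_ge0//.
    by apply: le_trans (bB' _) _; rewrite ler_piMr// oe.2.
  by apply: le_trans (bA _) _; rewrite ler_piMr// og.2.
have head : \forall n \near \oo,
    \sum_(0 <= k < N) rnorm (B' n (eg k)) * rnorm (A n (g k)) * s k `^ p <= d.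
  elim: N {hN} d d0 => [|N IH] d d0; first by near=> n; rewrite big_geq// ltW.
  have d2 : 0 < d / 2 by rewrite divr_gt0.
  have r0 : 0 < s N `^ p + 1 by rewrite ltr_wpDl// powR_ge0.
  near=> n; rewrite big_nat_recr//= [leRHS]splitr; apply: lerD.
    by near: n; exact: IH.
  have : rnorm (B' n (eg N)) * rnorm (A n (g N)) <= d / 2 / (s N `^ p + 1).
    by near: n; apply: hAB; rewrite divr_gt0.
  rewrite ler_pdivlMr// => /(le_trans _); apply.
  by rewrite ler_wpM2l ?mulr_ge0 ?rnorm_ge0// lerDl.
near=> n; move=> phi psi op os m.
have [AA' bA bA'] := hA n; have [BB' bB bB'] := hB n.
apply: le_trans (@sandwich_bound R H p c c (d + c * c * d) s T _ _ _ _ eg g p1 c0 c0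
  sv.1 oe og Tx AA' BB' bA' bB _ phi psi op os m) _.
  move=> M; rewrite -(big_mkord xpredT (fun k => rnorm (B' n (eg k)) * rnorm (A n (g k)) * s k `^ p)).
  have t0 k : 0 <= rnorm (B' n (eg k)) * rnorm (A n (g k)) * s k `^ p.
    by rewrite !mulr_ge0 ?rnorm_ge0 ?powR_ge0.
  apply: (@le_trans _ _ (\sum_(0 <= k < N + M) rnorm (B' n (eg k)) * rnorm (A n (g k)) * s k `^ p)).
    rewrite (@big_cat_nat _ _ _ M 0 (N + M))//= ?leq_addl// lerDl.
    by apply: sumr_ge0 => k _.
  rewrite (@big_cat_nat _ _ _ N 0 (N + M))//= ?leq_addr//; apply: lerD.
    by near: n; exact: head.
  apply: (@le_trans _ _ (\sum_(N <= k < N + M) c * c * s k `^ p)).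
    by apply: ler_sum => k _; rewrite ler_wpM2r ?powR_ge0.
  by rewrite -mulr_sumr ler_wpM2l// mulr_ge0.
rewrite -/K -{1}(mul1r d) -mulrDl mulrA /d mulrA ler_pdivrMr//.
by rewrite mulrC ler_wpM2l ?powR_ge0// lerDl.
Unshelve. all: by end_near. Qed.

(** All weights in [sandwich_bound] are at most cA cB, which supplies the factor missing from (cA
    cB)^(p-1). *)
Lemma schatten_le_sandwich p T C cT cA cB A A' B B' :
  1 <= p -> linear T -> 0 <= cT -> 0 <= C -> 0 <= cA -> 0 <= cB ->
  (forall x, rnorm (T x) <= cT * rnorm x) -> schatten_le p T C ->
  adjointable cA A A' -> adjointable cB B B' ->
  schatten_le p (fun x => A (T (B x))) (cA * cB * C).
Proof.
move=> p1 lT cT0 C0 cA0 cB0 bT hT [AA' bA bA'] [BB' bB bB'] phi psi op os n.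
have p0 : 0 < p by rewrite (lt_le_trans _ p1).
have [s [sv hs]] := schatten_le_singular_values p1 lT cT0 C0 bT hT.
have [e [g [oe og Tx]]] := singular_values_expand lT bT sv.
apply: le_trans (@sandwich_bound R H p cA cB (cA * cB * C `^ p) s T _ _ _ _ e g p1 cA0 cB0
  sv.1 oe og Tx AA' BB' bA' bB _ phi psi op os n) _.
  move=> N; apply: (@le_trans _ _ (\sum_(k < N) cA * cB * s k `^ p)).
    apply: ler_sum => k _; rewrite ler_wpM2r ?powR_ge0// mulrC.
    apply: ler_pM; rewrite ?rnorm_ge0//.
      by apply: le_trans (bA _) _; rewrite ler_piMr// og.2.
    by apply: le_trans (bB' _) _; rewrite ler_piMr// oe.2.
  by rewrite -mulr_sumr ler_wpM2l// mulr_ge0.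
rewrite [leRHS]powRM ?mulr_ge0// mulrA ler_wpM2r ?powR_ge0//.
by rewrite mulrC mulr_powRB1// mulr_ge0.
Qed.

Lemma schatten_le_in_schatten p T C c : 1 <= p -> linear T -> 0 <= c -> 0 <= C ->
  (forall x, rnorm (T x) <= c * rnorm x) -> schatten_le p T C ->
  (schatten_norm p T <= C%:E)%E /\ in_schatten p T.
Proof.
move=> p1 lT c0 C0 bT hT.
have [s [sv hs]] := schatten_le_singular_values p1 lT c0 C0 bT hT.
have h := singular_values_schatten_norm p1 C0 sv hs; split=> //; split=> //.
  apply: (@le_lt_trans _ _ c%:E); last exact: ltry.
  apply: ub_ereal_sup => _ [x /= x1 <-]; rewrite lee_fin.
  by apply: le_trans (bT _) _; rewrite ler_piMr.
by apply: le_lt_trans h _; exact: ltry.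
Qed.

(* X_n T_n Y_n - X T Y = X_n (T_n - T) Y_n + (X_n - X) T Y_n + X T (Y_n - Y) *)
Lemma schatten_strong_cvg p C cT c (Tn : nat -> H -> H) T (Xn Xn' Yn Yn' : nat -> H -> H)
    (X X' Y Y' : H -> H) :
  1 <= p -> 0 <= cT -> 0 <= C -> 0 <= c ->
  (forall n, linear (Tn n)) -> (forall n x, rnorm (Tn n x) <= cT * rnorm x) ->
  linear T -> (forall x, rnorm (T x) <= cT * rnorm x) -> schatten_le p T C ->
  (forall e, 0 < e -> \forall n \near \oo, schatten_le p (fun x => Tn n x - T x) e) ->
  (forall n, adjointable c (Xn n) (Xn' n)) -> adjointable c X X' ->
  (forall n, adjointable c (Yn n) (Yn' n)) -> adjointable c Y Y' ->
  (forall x, Xn n x @[n --> \oo] --> X x) -> (forall x, Yn' n x @[n --> \oo] --> Y' x) ->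
  forall e, 0 < e -> \forall n \near \oo,
    schatten_le p (fun x => Xn n (Tn n (Yn n x)) - X (T (Y x))) e.
Proof.
move=> p1 cT0 C0 c0 lTn bTn lT bT hT hTn aXn aX aYn aY cX cY e e0.
have e3 : 0 < e / 3 by rewrite divr_gt0.
have cc0 : 0 <= c + c by rewrite addr_ge0.
have K0 : 0 < c * c + 1 by rewrite ltr_wpDl// mulr_ge0.
have wk (u : nat -> H) l d : u n @[n --> \oo] --> l -> 0 < d ->
    \forall n \near \oo, rnorm (u n - l) <= d.
  by move=> /cvgP_rnorm h /h[N hN]; exists N.
have weak A A' : adjointable c A A' -> adjointable (c + c) A A'.
  move=> [h h1 h2]; split=> // x.
    by apply: le_trans (h1 x) _; rewrite ler_wpM2r ?rnorm_ge0// lerDl.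
  by apply: le_trans (h2 x) _; rewrite ler_wpM2r ?rnorm_ge0// lerDl.
(* Here the left factor tends to 0 strongly while the adjoints of the right one stay bounded; in h3
   below the roles are exchanged. *)
have h2 : \forall n \near \oo,
    schatten_le p (fun x => (Xn n (T (Yn n x)) - X (T (Yn n x)))) (e / 3).
  apply: (@schatten_le_sandwich_cvg p T C cT (c + c) (fun n x => Xn n x - X x)
    (fun n x => Xn' n x - X' x) Yn Yn') => //.
  - by move=> n; exact: adjointableB.
  - by move=> n; exact: weak.
  - move=> x y d d0; have D0 : 0 < c * rnorm x + 1.
      by rewrite ltr_wpDl// mulr_ge0// rnorm_ge0.
    have := wk _ _ _ (cX y) (divr_gt0 d0 D0); apply: filterS => n.
    rewrite ler_pdivlMr// mulrC => /(le_trans _); apply.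
    have [_ _ b] := aYn n; rewrite ler_wpM2r ?rnorm_ge0//.
    by apply: le_trans (b x) _; rewrite lerDl.
have h3 : \forall n \near \oo,
    schatten_le p (fun x => X (T (Yn n x - Y x))) (e / 3).
  apply: (@schatten_le_sandwich_cvg p T C cT (c + c) (fun n => X)
    (fun n => X') (fun n x => Yn n x - Y x) (fun n x => Yn' n x - Y' x)) => //.
  - by move=> n; exact: weak.
  - by move=> n; exact: adjointableB.
  - move=> x y d d0; have D0 : 0 < c * rnorm y + 1.
      by rewrite ltr_wpDl// mulr_ge0// rnorm_ge0.
    have := wk _ _ _ (cY x) (divr_gt0 d0 D0); apply: filterS => n.
    rewrite ler_pdivlMr// => /(le_trans _); apply.
    have [_ b _] := aX; rewrite ler_wpM2l ?rnorm_ge0//.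
    by apply: le_trans (b y) _; rewrite lerDl.
near=> n.
have [aX1 _ _] := aXn n; have [aX2 _ _] := aX.
have lX := adjoint_linear aX2; have lXn := adjoint_linear aX1.
have h1 : schatten_le p (fun x => Xn n (Tn n (Yn n x) - T (Yn n x))) (e / 3).
  have dn : schatten_le p (fun x => Tn n x - T x) (e / 3 / (c * c + 1)).
    by near: n; apply: hTn; rewrite divr_gt0.
  have lD : linear (fun x => Tn n x - T x).
    by move=> a x y; rewrite lTn lT; hring.
  have bD x : rnorm (Tn n x - T x) <= (cT + cT) * rnorm x.
    by apply: le_trans (rnormB _ _) _; rewrite mulrDl lerD.
  have D0 : 0 <= e / 3 / (c * c + 1) by rewrite divr_ge0// ltW.
  have := schatten_le_sandwich p1 lD (addr_ge0 cT0 cT0) D0 c0 c0 bD dn (aXn n) (aYn n).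
  apply: schatten_le_mono => //; first by rewrite mulr_ge0// mulr_ge0.
  rewrite mulrCA ger_pMr// ler_pdivrMr// mul1r lerDl//.
have h2n : schatten_le p (fun x => (Xn n (T (Yn n x)) - X (T (Yn n x)))) (e / 3).
  by near: n; exact: h2.
have h3n : schatten_le p (fun x => X (T (Yn n x - Y x))) (e / 3).
  by near: n; exact: h3.
have := schatten_leD p1 (addr_ge0 (ltW e3) (ltW e3)) (ltW e3)
  (schatten_leD p1 (ltW e3) (ltW e3) h1 h2n) h3n.
rewrite (_ : e / 3 + e / 3 + e / 3 = e); last by field.
move=> h123; apply: schatten_le_ext h123 => x /=.
rewrite (linear_funB _ _ lXn) (linear_funB _ _ lT) (linear_funB _ _ lX); hring.
Unshelve. all: by end_near. Qed.

End ideal.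

(** * Spectral measures *)

Section spectral_integrals.
Context {R : realType} {H : hilbertType R}.
Implicit Types (x y v w : H) (E : pvm H) (A B I : set (measurableTypeR R)).

(** Polarization and the parallelogram law bound the form by d (|x|^2 + |y|^2); rescaling x and y to
    equal norms yields the factor 2. No symmetry of A is assumed, as f may be complex-valued. *)
Lemma quadratic_form_bound (V : set H) (A : H -> H) (d : R) : 0 <= d ->
  (forall a x y, V x -> V y -> V (a *: x + y)) ->
  (forall a x y, V x -> V y -> A (a *: x + y) = a *: A x + A y) ->
  V 0 -> (forall x, V x -> nc (inner (A x) x) <= d * rnorm x ^+ 2) ->
  forall x y, V x -> V y -> nc (inner (A x) y) <= 2 * d * rnorm x * rnorm y.
Proof.
move=> d0 Vlin Alin V0 hA.
have A0 : A 0 = 0 by have := Alin (-1) 0 0 V0 V0; rewrite scaler0 addr0 scaleN1r addNr.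
have VZ a x : V x -> V (a *: x) by move=> hx; rewrite -[_ *: _]addr0; exact: Vlin.
have AZ a x : V x -> A (a *: x) = a *: A x.
  by move=> hx; rewrite -[_ *: x]addr0 Alin// A0 addr0.
have key x y : V x -> V y -> nc (inner (A x) y) <= d * (rnorm x ^+ 2 + rnorm y ^+ 2).
  move=> Vx Vy.
  pose q a := inner (A (a *: y + x)) (a *: y + x).
  have qb a : nc (q a) <= d * rnorm (x + a *: y) ^+ 2.
    by rewrite addrC; apply: hA; exact: Vlin.
  have -> : inner (A x) y = 4^-1%:C * (q 1 - q (-1) + 'i * q 'i - 'i * q (- 'i)).
    rewrite /q !Alin// !(innerDl, innerDr, innerZl, innerZr).
    rewrite !rmorphN/= conjC1.
    have -> : ('i : R[i])^* = - 'i by rewrite conjCi.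
    set s := inner (A x) y; set t := inner (A y) x; set u := inner (A y) y; set r := inner (A x) x.
    have i2 : 'i * 'i = -1 :> R[i] by rewrite -expr2 sqrCi.
    have f4 : 4^-1%:C * 4 = 1 :> R[i].
      by rewrite -[4]/(4%:R) -(rmorph_nat (real_complex R)) -rmorphM/= mulVf.
    transitivity (4^-1%:C * 4 * s); first by rewrite f4 mul1r.
    rewrite -mulrA; congr (_ * _).
    have -> : 4 * s = (2 * s - 2 * ('i * 'i) * s) by rewrite i2; ring.
    ring: i2.
  rewrite ncM ncR ger0_norm ?invr_ge0//.
  have n1 : nc (q 1 - q (-1) + 'i * q 'i - 'i * q (- 'i)) <=
      nc (q 1) + nc (q (-1)) + nc (q 'i) + nc (q (- 'i)).
    apply: le_trans (ncB _ _) _; rewrite ncM nci mul1r lerD2r.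
    apply: le_trans (ncD _ _) _; rewrite ncM nci mul1r lerD2r.
    exact: ncB.
  have p1 := parallelogram x y; have p2 := parallelogram x ('i *: y).
  have := qb 1; have := qb (-1); have := qb 'i; have := qb (- 'i).
  move: p1 p2; rewrite rnormZ nci mul1r !scaleNr scale1r => p1 p2 q1 q2 q3 q4.
  have h : nc (q 1) + nc (q (-1)) + nc (q 'i) + nc (q (- 'i)) <=
    d * (rnorm (x + y) ^+ 2 + rnorm (x - y) ^+ 2 + (rnorm (x + 'i *: y) ^+ 2 + rnorm (x - 'i *: y) ^+ 2)).
    rewrite !mulrDr; lra.
  have := le_trans n1 h; rewrite p1 p2.
  set N := nc _; move=> hN; rewrite mulrC ler_pdivrMr//.
  apply: le_trans hN _; lra.
move=> x y Vx Vy.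
have [x0|x0] := eqVneq x 0.
  by rewrite x0 A0 inner0l nc0 rnorm0 mulr0 mul0r.
have [y0|y0] := eqVneq y 0.
  by rewrite y0 inner0r nc0 rnorm0 mulr0.
have px : 0 < rnorm x by rewrite rnorm_gt0.
have py : 0 < rnorm y by rewrite rnorm_gt0.
have := key ((rnorm y)%:C *: x) ((rnorm x)%:C *: y) (VZ _ _ Vx) (VZ _ _ Vy).
rewrite AZ// innerZl innerZr !ncM ncJ !rnormZ !ncR !ger0_norm ?rnorm_ge0//.
set p := rnorm x in px *; set q := rnorm y in py *; set N := nc _ => h.
rewrite -(ler_pM2l (mulr_gt0 py px)); move: h; rewrite -!mulrA !exprMn; lra.
Qed.

Lemma pv_mul E A B x : measurable A -> measurable B -> E A (E B x) = E (A `&` B) x.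
Proof. by move=> mA mB; rewrite pv_setI. Qed.

Lemma pv_comm E A B x : measurable A -> measurable B -> E A (E B x) = E B (E A x).
Proof. by move=> mA mB; rewrite !pv_mul// setIC. Qed.

Lemma pv_idem E A x : measurable A -> E A (E A x) = E A x.
Proof. by move=> mA; rewrite pv_mul// setIid. Qed.

Lemma pvD E A x y : measurable A -> E A (x + y) = E A x + E A y.
Proof. by move=> mA; rewrite linear_funD//; exact: pv_lin. Qed.

Lemma pvB E A x y : measurable A -> E A (x - y) = E A x - E A y.
Proof. by move=> mA; rewrite linear_funB//; exact: pv_lin. Qed.

Lemma bounded_integrable_spectral E x B (g : measurableTypeR R -> R) (M : R) :
  measurable B -> measurable_fun B g ->
  (forall t, B t -> `|g t| <= M) ->
  (spectral_measure E x).-integrable B (EFin \o g).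
Proof.
move=> mB mg hM; apply: measurable_bounded_integrable => //.
  by rewrite ltry.
exists M; split; first exact: num_real.
by move=> K MK t Bt /=; rewrite (le_trans (hM _ Bt))// ltW.
Qed.

Lemma spectral_Rintegral_close E x B (g : measurableTypeR R -> R) (c d : R) :
  measurable B -> measurable_fun B g ->
  (forall t, B t -> `|g t - c| <= d) ->
  `|\int[spectral_measure E x]_(t in B) g t - c * rnorm (E B x) ^+ 2| <=
  d * rnorm (E B x) ^+ 2.
Proof.
move=> mB mg hd.
have gi : (spectral_measure E x).-integrable B (EFin \o g).
  apply: (@bounded_integrable_spectral _ _ _ _ (`|c| + d)) => // t Bt.
  by have := ler_normD c (g t - c); rewrite subrKC; have := hd t Bt; lra.
have ci r : (spectral_measure E x).-integrable B (EFin \o (fun=> r)).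
  exact: (@bounded_integrable_spectral _ _ _ _ `|r|).
have gci : (spectral_measure E x).-integrable B (EFin \o (fun t => g t - c)).
  apply: (@bounded_integrable_spectral _ _ _ _ d) => //.
  exact: measurable_funB.
have cst_int r : \int[spectral_measure E x]_(t in B) r = r * rnorm (E B x) ^+ 2.
  by rewrite Rintegral_cst.
rewrite -!cst_int -(RintegralB mB gi (ci c)).
apply: le_trans (le_normr_Rintegral mB gci) _.
apply: (le_Rintegral mB _ (ci d)) => //.
apply: (@bounded_integrable_spectral _ _ _ _ d) => //.
  by apply: measurableT_comp => //; exact: measurable_funB.
by move=> t Bt; rewrite normr_id; exact: hd.
Qed.

(** E B x = x makes the complement of B a null set for the spectral measure of x. *)
Lemma spectral_integral_concentrated E x B (g : measurableTypeR R -> \bar R) :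
  measurable B -> E B x = x -> measurable_fun setT g ->
  (\int[spectral_measure E x]_t g t = \int[spectral_measure E x]_(t in B) g t)%E.
Proof.
move=> mB Bx mg; rewrite [RHS]integral_mkcond.
apply: ae_eq_integral => //.
  by apply/(measurable_restrictT _ mB); exact: measurable_funS mg.
exists (~` B); split; first exact: measurableC.
  transitivity (rnorm (E (~` B) (E B x)) ^+ 2)%:E; first by rewrite Bx.
  rewrite pv_mul//; last exact: measurableC.
  by rewrite setICl pv_set0 rnorm0 expr0n.
move=> t /= /not_implyP[_ h] Bt; apply: h.
by rewrite patchE mem_set.
Qed.

End spectral_integrals.

(** * Spectral projections onto short sets *)

Section spectral_cell.
Context {R : realType} {H : hilbertType R}.
Variables (S : linop H) (E : pvm H) (I : set (measurableTypeR R)) (l d : R).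
Hypotheses (sS : selfadjoint S) (SE : is_spectral_integral E (fun t => t%:C) S).
Hypotheses (mI : measurable I) (d0 : 0 <= d) (Id : forall t, I t -> `|t - l| <= d).
Implicit Types (x y v w : H).

Let P := E I.

Lemma cell_linear : linear P.
Proof. exact: pv_lin. Qed.

Lemma cell_dom x : dom S (P x).
Proof.
rewrite SE.1 /=; set g := (fun t : measurableTypeR R => _).
have mg : measurable_fun setT (fun t : measurableTypeR R => (complex.Re `|t%:C|) ^+ 2).
  rewrite (_ : (fun t : measurableTypeR R => _) = (fun t => `|t| ^+ 2)).
    by apply: measurable_funX; exact: normr_measurable.
  by apply/funext => t; rewrite -/(nc _) ncR.
rewrite (@spectral_integral_concentrated _ _ _ _ I)//; last 2 first.
- by rewrite /P pv_idem.
- exact/measurable_EFinP.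
have gi : (spectral_measure E (P x)).-integrable I (EFin \o (fun t => (complex.Re `|t%:C|) ^+ 2)).
  apply: (@bounded_integrable_spectral _ _ _ _ _ _ ((`|l| + d) ^+ 2)) => //.
    exact: measurable_funS mg.
  move=> t It; rewrite -/(nc _) ncR ger0_norm ?sqr_ge0// ler_sqr ?nnegrE ?addr_ge0//.
  by have := ler_normD l (t - l); rewrite subrKC; have := Id It; lra.
have := integrable_fin_num mI gi.
by rewrite fin_numE => /andP[_ h]; rewrite ltey.
Qed.

Lemma cell_quadratic v : P v = v ->
  nc (inner (S v - l%:C *: v) v) <= d * rnorm v ^+ 2.
Proof.
move=> Pv; have dv : dom S v by rewrite -Pv; exact: cell_dom.
rewrite innerBl innerZl innerxx (SE.2 _ dv).
have mid : measurable_fun setT (fun t : measurableTypeR R => t) by [].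
have im0 : \int[spectral_measure E v]_t complex.Im (t%:C) = 0 :> R.
  by rewrite /= (_ : (fun _ => 0) = cst 0)// Rintegral_cst// mul0r.
rewrite im0.
have -> : \int[spectral_measure E v]_t complex.Re (t%:C) =
    \int[spectral_measure E v]_(t in I) t :> R.
  congr fine; rewrite (@spectral_integral_concentrated _ _ _ _ I)//.
  exact/measurable_EFinP.
have := @spectral_Rintegral_close _ _ E v I id l d mI (measurable_funS _ (@subsetT _ I) mid) Id.
rewrite -/P Pv => h; set r := Rintegral _ _ _.
have -> : r +i* 0 - l%:C * (rnorm v ^+ 2)%:C = (r - l * rnorm v ^+ 2)%:C :> R[i].
  by rewrite -rmorphM/= rmorphB/=.
rewrite ncR; exact: h.
Qed.

(** The diagonal form of S sees a vector only through its spectral measure. *)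
Lemma spectral_form_eq x y : dom S x -> dom S y ->
  (forall A, measurable A -> rnorm (E A x) = rnorm (E A y)) ->
  inner (S x) x = inner (S y) y.
Proof.
move=> dx dy h; rewrite (SE.2 _ dx) (SE.2 _ dy).
have e A : measurable A -> A `<=` setT -> spectral_measure E x A = spectral_measure E y A.
  by move=> mA _; rewrite /spectral_measure h.
by congr (_ +i* _); congr fine; apply: eq_measure_integral.
Qed.

(** E A (P x) and E A w are orthogonal for every A, so P x + w and P x - w have the same spectral
    measure. Comparing their forms kills the real part of the cross term; replacing w by i w kills
    the imaginary part. *)
Lemma cell_cross x w : dom S w -> P w = 0 -> inner (S (P x)) w = 0.
Proof.
move=> dw Pw.
have re0 w' : dom S w' -> P w' = 0 -> complex.Re (inner (S (P x)) w') = 0.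
  move=> dw' Pw'; have dP := cell_dom x.
  have : inner (S (P x + w')) (P x + w') = inner (S (P x - w')) (P x - w').
    apply: spectral_form_eq; [|exact: domB|].
      by rewrite -(scale1r (P x)); exact: dom_lin.
    move=> A mA.
    have o : inner (E A (P x)) (E A w') = 0.
      rewrite /P pv_comm// -/P pv_sym//.
      by rewrite -pv_comm//= -/P Pw' linear_fun0 ?inner0r//; exact: pv_lin.
    apply/eqP; rewrite -(@eqrXn2 _ 2)// ?rnorm_ge0//.
    by rewrite pvD// pvB// rnormD_sqr rnormB_sqr o /= !mulr0 subr0 addr0.
  rewrite opB//.
  have -> : S (P x + w') = S (P x) + S w'.
    by rewrite -{1}(scale1r (P x)) op_lin// scale1r.
  rewrite !(innerDl, innerNl, innerDr, innerNr) (selfadjoint_sym sS dw' dP).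
  rewrite (inner_conj (S (P x)) w').
  case: (inner (S (P x)) w') => a b; case: (inner (S (P x)) (P x)) => a' b'.
  case: (inner (S w') w') => a'' b'' /= [] h _; lra.
have h1 := re0 _ dw Pw.
have := re0 ('i *: w) (domZ _ dw).
rewrite (linear_funZ _ _ cell_linear) Pw scaler0 => /(_ erefl).
rewrite innerZr; move: h1; case: (inner _ _) => a b /= -> h.
by apply/eqP; rewrite eq_complex /= eqxx/=; apply/eqP; move: h; rewrite !mul0r; lra.
Qed.

(** [is_spectral_integral] ties S to E only on the diagonal, so commutation comes from [cell_cross]:
    S (P x) is orthogonal to all w - P w with w in [dom S], hence lies in the range of P by density,
    and S (x - P x) is orthogonal to that range by symmetry of S. *)
Lemma cell_comm x : dom S x -> S (P x) = P (S x).
Proof.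
move=> dx; have dP := cell_dom.
have PP y : P (P y) = P y by exact: pv_idem.
have dQ : dom S (x - P x) by exact: domB.
have PQ y : P (y - P y) = 0 by rewrite (linear_funB _ _ cell_linear) PP subrr.
have h1 : P (S (P x)) = S (P x).
  apply/eqP; rewrite -subr_eq0; apply/eqP.
  suff h : forall w, dom S w -> inner (P (S (P x)) - S (P x)) w = 0.
    have [dd _] := sS.
    apply/eqP; rewrite -rnorm_eq0 eq_le rnorm_ge0 andbT; apply/ler_addgt0Pl => e e0.
    rewrite addr0; set z := P _ - _ in h *.
    have [w [dw zw]] : exists w, dom S w /\ rnorm (z - w) <= e.
      have e0' : 0 < e%:C :> R[i] by rewrite ltcR.
      have [||w [bw dw]] := dd (ball z e%:C).
      - by exists z; exact: ballxx.
      - exact: ball_open.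
      exists w; split=> //; move: bw; rewrite -ball_normE/= -rnormE ltcR => /ltW//.
    have [->|z0] := eqVneq z 0; first by rewrite rnorm0 ltW.
    have pz : 0 < rnorm z by rewrite rnorm_gt0.
    have : rnorm z ^+ 2 <= rnorm z * e.
      rewrite rnorm_sqr -[X in inner _ X](subrK w) innerDr (h _ dw) addr0.
      by apply: le_trans (Re_inner_le _ _) _; rewrite ler_wpM2l ?rnorm_ge0.
    by rewrite expr2 ler_pM2l.
  move=> w dw; rewrite innerBl /P pv_sym// -/P -innerBr.
  apply/eqP; rewrite -oppr_eq0 -innerNr opprB; apply/eqP.
  by apply: cell_cross; [exact: domB|exact: PQ].
have h2 : P (S (x - P x)) = 0.
  apply: inner_eq0 => w; rewrite /P pv_sym// -/P inner_conj.
  rewrite -(selfadjoint_sym sS (dP w) dQ) cell_cross ?conjC0//.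
have -> : S x = S (P x) + S (x - P x) by rewrite opB// subrKC.
by rewrite (linear_funD _ _ cell_linear) h1 h2 addr0.
Qed.

Lemma cell_resolvent_comm z x : complex.Im z != 0 ->
  resolvent S z (P x) = P (resolvent S z x).
Proof.
move=> z0; have [dr hr] := resolventP x sS z0.
apply: resolvent_uniq => //; first exact: cell_dom.
by rewrite cell_comm// -{3}hr (linear_funB _ _ cell_linear) (linear_funZ _ _ cell_linear).
Qed.

(** [cell_quadratic] bounds the diagonal form of S - l on the range of P, which S - l leaves
    invariant; polarization there, tested on the image vector itself, gives the norm. *)
Lemma cell_op_close v : P v = v -> rnorm (S v - l%:C *: v) <= 2 * d * rnorm v.
Proof.
move=> Pv; pose V : set H := [set y | P y = y].
have lP := cell_linear.
have VS y : V y -> V (S y - l%:C *: y).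
  move=> Vy; rewrite /V/= (linear_funB _ _ lP) (linear_funZ _ _ lP) Vy -cell_comm ?Vy//.
  by rewrite -Vy; exact: cell_dom.
have dV y : V y -> dom S y by move=> <-; exact: cell_dom.
have h := @quadratic_form_bound _ _ V (fun y => S y - l%:C *: y) d d0.
have [->|z0] := eqVneq (S v - l%:C *: v) 0.
  by rewrite rnorm0 !mulr_ge0 ?rnorm_ge0.
have pz : 0 < rnorm (S v - l%:C *: v) by rewrite rnorm_gt0.
rewrite -(ler_pM2r pz) -expr2.
have := h _ _ _ cell_quadratic v (S v - l%:C *: v) Pv (VS v Pv).
rewrite innerxx ncR ger0_norm ?sqr_ge0//; apply.
- by move=> a x y Vx Vy; rewrite /V/= lP Vx Vy.
- by move=> a x y Vx Vy /=; rewrite op_lin; [hring|exact: dV|exact: dV].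
- exact: linear_fun0.
Qed.

(** The difference is -(l - z)^-1 R(z) (S - l) v, and each of the two inverses costs a factor 1 /
    |Im z|. *)
Lemma cell_resolvent_close z v : complex.Im z != 0 -> P v = v ->
  rnorm (resolvent S z v - (l%:C - z)^-1 *: v) <=
  2 * d * `|complex.Im z|^-1 ^+ 2 * rnorm v.
Proof.
move=> z0 Pv; have dv : dom S v by rewrite -Pv; exact: cell_dom.
have lR := resolvent_linear sS z0.
have i0 : 0 < `|complex.Im z| by rewrite normr_gt0.
have lz : `|complex.Im z| <= nc (l%:C - z).
  apply: le_trans (Im_le_nc _); rewrite -normrN.
  by case: z {z0 lR i0} => a b /=; rewrite add0r.
have lz0 : l%:C - z != 0 by rewrite -nc_eq0 gt_eqF// (lt_le_trans i0).
have e : resolvent S z v - (l%:C - z)^-1 *: v =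
    - ((l%:C - z)^-1 *: resolvent S z (S v - l%:C *: v)).
  have := resolventK sS z0 dv.
  have -> : S v - z *: v = (S v - l%:C *: v) + (l%:C - z) *: v by hring.
  rewrite (linear_funD _ _ lR) (linear_funZ _ _ lR) => {2}<-.
  by rewrite scalerDr scalerA mulVf// scale1r opprD addrA addrC addrA addNr add0r.
rewrite e rnormN rnormZ ncV.
apply: le_trans (ler_wpM2l _ (rnorm_resolvent _ sS z0)) _; first by rewrite invr_ge0 nc_ge0.
have hc := cell_op_close Pv.
rewrite mulrA expr2 (mulrC (2 * d)) -!mulrA.
apply: ler_pM; rewrite ?invr_ge0 ?nc_ge0 ?mulr_ge0 ?invr_ge0 ?rnorm_ge0//.
  by rewrite lef_pV2 ?posrE// (lt_le_trans i0).
by rewrite ler_wpM2l ?invr_ge0// mulrA.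
Qed.

End spectral_cell.

(** * Cayley transforms *)

Section cayley.
Context {R : realType} {H : hilbertType R}.
Implicit Types (x y v w : H) (z : R[i]) (S : linop H) (a b : nat -> R[i]).

(* For z = +-i this is a unitary operator, -(S + z)(S - z)^-1. *)
Definition cayley S z x : H := - (2 * z) *: resolvent S z x - x.

(** This is -(t + z) / (t - z), the symbol of [cayley]; it tends to -1 at infinity. *)
Definition cayley_fun z (t : R) : R[i] := - (2 * z) * (t%:C - z)^-1 - 1.

(** Both signs are treated together, as [cayley S (- z)] is the adjoint and inverse of
    [cayley S z]. *)
Definition imag_unit z := z = 'i \/ z = - 'i.

Lemma imag_unit_neq0 z : imag_unit z -> complex.Im z != 0.
Proof.
by case=> ->; rewrite -complexiE/= ?oppr_eq0 oner_eq0.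
Qed.

Lemma imag_unit_Im z : imag_unit z -> `|complex.Im z| = 1.
Proof. by case=> ->; rewrite -complexiE/= ?normrN normr1. Qed.

Lemma imag_unit_nc z : imag_unit z -> nc z = 1.
Proof. by case=> ->; rewrite ?ncN nci. Qed.

Lemma imag_unitJ z : imag_unit z -> z^* = - z.
Proof. by case=> ->; rewrite ?rmorphN/= conjCi. Qed.

Lemma imag_unitN z : imag_unit z -> imag_unit (- z).
Proof. by case=> ->; rewrite /imag_unit ?opprK; [right|left]. Qed.

Lemma cayley_linear S z : selfadjoint S -> imag_unit z -> linear (cayley S z).
Proof.
move=> sS hz k x y; rewrite /cayley resolvent_linear ?imag_unit_neq0//; hring.
Qed.

Lemma cayley_adj S z : selfadjoint S -> imag_unit z ->
  adjoint_pair (cayley S z) (cayley S (- z)).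
Proof.
move=> sS hz x y; rewrite /cayley !(innerDl, innerNl, innerZl, innerDr, innerNr, innerZr).
rewrite resolvent_adj ?imag_unit_neq0// imag_unitJ//.
have -> : (- (2 * - z))^* = - (2 * z) :> R[i].
  rewrite (_ : - (2 * - z) = z *+ 2); last by rewrite -mulr_natl; ring.
  by rewrite rmorphMn/= imag_unitJ// -mulr_natl; ring.
ring.
Qed.

Lemma cayleyK S z x : selfadjoint S -> imag_unit z ->
  cayley S (- z) (cayley S z x) = x.
Proof.
move=> sS hz; have z0 := imag_unit_neq0 hz; have nz0 := imag_unit_neq0 (imag_unitN hz).
have lR := resolvent_linear sS nz0.
have id := resolvent_identity x sS nz0 z0.
rewrite /cayley; rewrite (linear_funB _ _ lR) (linear_funZ _ _ lR).
have : resolvent S (- z) x = resolvent S z x + (- z - z) *: resolvent S (- z) (resolvent S z x).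
  by rewrite -id subrKC.
move: (resolvent S (- z) (resolvent S z x)) => u ->.
hring.
Qed.

Lemma cayley_isometry S z x y : selfadjoint S -> imag_unit z ->
  inner (cayley S z x) (cayley S z y) = inner x y.
Proof. by move=> sS hz; rewrite cayley_adj// cayleyK. Qed.

Lemma iter_cayley_linear S z k : selfadjoint S -> imag_unit z ->
  linear (iter k (cayley S z)).
Proof.
move=> sS hz; elim: k => [//|k IH] c x y /=.
by rewrite IH cayley_linear.
Qed.

Lemma iter_cayley_adj S z k : selfadjoint S -> imag_unit z ->
  adjoint_pair (iter k (cayley S z)) (iter k (cayley S (- z))).
Proof.
move=> sS hz; elim: k => [//|k IH] x y.
by rewrite iterS iterSr cayley_adj// IH.
Qed.

Lemma iter_cayley_isometry S z k x y : selfadjoint S -> imag_unit z ->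
  inner (iter k (cayley S z) x) (iter k (cayley S z) y) = inner x y.
Proof. by move=> sS hz; elim: k => [//|k IH] /=; rewrite cayley_isometry. Qed.

Lemma isometry_rnorm (U : H -> H) x : (forall x y, inner (U x) (U y) = inner x y) ->
  rnorm (U x) = rnorm x.
Proof.
by move=> h; apply/eqP; rewrite -(@eqrXn2 _ 2)// ?rnorm_ge0// !rnorm_sqr h.
Qed.

Lemma rnorm_iter_cayley S z k x : selfadjoint S -> imag_unit z ->
  rnorm (iter k (cayley S z) x) = rnorm x.
Proof.
by move=> sS hz; apply: isometry_rnorm => u v; exact: iter_cayley_isometry.
Qed.

Lemma imag_unit_dist (t : R) z : imag_unit z -> 1 <= nc (t%:C - z).
Proof.
move=> hz; apply: le_trans (Im_le_nc _); rewrite -(imag_unit_Im hz) -normrN.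
by case: z {hz} => a b /=; rewrite sub0r.
Qed.

Lemma imag_unit_dist_neq0 (t : R) z : imag_unit z -> t%:C - z != 0.
Proof. by move=> hz; rewrite -nc_eq0 gt_eqF// (lt_le_trans ltr01)// imag_unit_dist. Qed.

Lemma nc_cayley_fun z t : imag_unit z -> nc (cayley_fun z t) = 1.
Proof.
move=> hz; have h0 := imag_unit_dist_neq0 t hz.
have -> : cayley_fun z t = - ((t%:C - z)^* / (t%:C - z)).
  have -> : (t%:C - z)^* = t%:C + z.
    by rewrite rmorphB/= (imag_unitJ hz) opprK; congr (_ + _); exact: conjc_real.
  by rewrite /cayley_fun; field.
by rewrite ncN ncM ncV ncJ mulfV// nc_eq0.
Qed.

Lemma cayley_fun_lipschitz z t s : imag_unit z ->
  nc (cayley_fun z t - cayley_fun z s) <= 2 * `|t - s|.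
Proof.
move=> hz; have h0 := imag_unit_dist_neq0 t hz; have h1 := imag_unit_dist_neq0 s hz.
have -> : cayley_fun z t - cayley_fun z s =
    2 * z * (t - s)%:C * ((t%:C - z)^-1 * (s%:C - z)^-1).
  rewrite /cayley_fun rmorphB/=; field; by rewrite h0 h1.
rewrite !ncM (imag_unit_nc hz) mulr1 ncR.
have -> : nc 2 = 2 :> R by rewrite -[2](rmorph_nat (real_complex R)) ncR ger0_norm.
rewrite ler_piMr ?mulr_ge0// !ncV mulr_ile1 ?invr_ge0 ?nc_ge0//.
  by rewrite invf_le1 ?imag_unit_dist// (lt_le_trans ltr01)// imag_unit_dist.
by rewrite invf_le1 ?imag_unit_dist// (lt_le_trans ltr01)// imag_unit_dist.
Qed.

Lemma unimodular_pow_dist (u v : R[i]) k : nc u = 1 -> nc v = 1 ->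
  nc (u ^+ k - v ^+ k) <= k%:R * nc (u - v).
Proof.
move=> u1 v1; elim: k => [|k IH]; first by rewrite !expr0 subrr nc0 mul0r.
have -> : u ^+ k.+1 - v ^+ k.+1 = u * (u ^+ k - v ^+ k) + (u - v) * v ^+ k.
  by rewrite !exprS; ring.
apply: le_trans (ncD _ _) _; rewrite !ncM ncX u1 v1 expr1n mul1r mulr1.
by rewrite -natr1 mulrDl mul1r lerD2r.
Qed.

Definition trig_op S a b K x : H :=
  \sum_(k < K) (a k *: iter k (cayley S (- 'i)) x + b k *: iter k (cayley S 'i) x).

Definition trig_fun a b K (t : R) : R[i] :=
  \sum_(k < K) (a k * cayley_fun (- 'i) t ^+ k + b k * cayley_fun 'i t ^+ k).

(** A k-th power varies k times as fast as its base, so this sum controls the slope of [trig_fun]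
    and the error of [trig_op] on a cell. *)
Definition trig_weight a b K : R := \sum_(k < K) k%:R * (nc (a k) + nc (b k)).

Lemma trig_weight_ge0 a b K : 0 <= trig_weight a b K.
Proof. by apply: sumr_ge0 => k _; rewrite mulr_ge0// addr_ge0 ?nc_ge0. Qed.

Lemma imag_unit_i : imag_unit 'i. Proof. by left. Qed.
Lemma imag_unit_Ni : imag_unit (- 'i). Proof. by right. Qed.

Lemma trig_fun_lipschitz a b K t s :
  nc (trig_fun a b K t - trig_fun a b K s) <= 2 * trig_weight a b K * `|t - s|.
Proof.
rewrite /trig_fun -sumrB; apply: le_trans (nc_sum _ _ _) _.
rewrite /trig_weight mulr_sumr mulr_suml; apply: ler_sum => k _.
have key z c : imag_unit z -> nc (c * cayley_fun z t ^+ k - c * cayley_fun z s ^+ k) <=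
    k%:R * nc c * (2 * `|t - s|).
  move=> hz; rewrite -mulrBr ncM mulrAC mulrC ler_wpM2r ?nc_ge0//.
  apply: le_trans (unimodular_pow_dist _ _ _) _; rewrite ?nc_cayley_fun//.
  by rewrite ler_wpM2l// cayley_fun_lipschitz.
rewrite opprD addrACA; apply: le_trans (ncD _ _) _.
have := key _ (a k) imag_unit_Ni; have := key _ (b k) imag_unit_i; lra.
Qed.

Lemma trig_op_linear S a b K : selfadjoint S -> linear (trig_op S a b K).
Proof.
move=> sS c x y; rewrite /trig_op scaler_sumr -big_split/=; apply: eq_bigr => k _.
rewrite (iter_cayley_linear _ sS imag_unit_i) (iter_cayley_linear _ sS imag_unit_Ni); hring.
Qed.

Lemma rnorm_trig_op S a b K x : selfadjoint S ->
  rnorm (trig_op S a b K x) <= (\sum_(k < K) (nc (a k) + nc (b k))) * rnorm x.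
Proof.
move=> sS; apply: le_trans (rnorm_sum _ _ _) _; rewrite mulr_suml.
apply: ler_sum => k _; apply: le_trans (rnormD _ _) _.
by rewrite !rnormZ !rnorm_iter_cayley// ?mulrDl//; [exact: imag_unit_i|exact: imag_unit_Ni].
Qed.

End cayley.

Section cayley_cell.
Context {R : realType} {H : hilbertType R}.
Variables (S : linop H) (E : pvm H) (I : set (measurableTypeR R)) (l d : R).
Hypotheses (sS : selfadjoint S) (SE : is_spectral_integral E (fun t => t%:C) S).
Hypotheses (mI : measurable I) (d0 : 0 <= d) (Id : forall t, I t -> `|t - l| <= d).
Implicit Types (x y v w : H) (z : R[i]).

Lemma cell_iter_cayley_comm z k x : imag_unit z ->
  iter k (cayley S z) (E I x) = E I (iter k (cayley S z) x).
Proof.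
move=> hz; elim: k => [//|k IH] /=; rewrite IH /cayley.
rewrite (cell_resolvent_comm sS SE mI d0 Id) ?imag_unit_neq0//.
by rewrite pvB// (linear_funZ _ _ (pv_lin E mI)).
Qed.

(** Telescoping through isometries and unimodular numbers, each step adds one error 4 d: |2 z| = 2
    times the 2 d of [cell_resolvent_close], where |Im z| = 1. *)
Lemma cell_iter_cayley_close z k v : imag_unit z -> E I v = v ->
  rnorm (iter k (cayley S z) v - cayley_fun z l ^+ k *: v) <= k%:R * (4 * d) * rnorm v.
Proof.
move=> hz Iv; elim: k => [|k IH].
  by rewrite /= expr0 scale1r subrr rnorm0 !mul0r.
have l1 := iter_cayley_linear k sS hz.
have h1 : rnorm (cayley S z v - cayley_fun z l *: v) <= 4 * d * rnorm v.
  have -> : cayley S z v - cayley_fun z l *: v =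
      - (2 * z) *: (resolvent S z v - (l%:C - z)^-1 *: v).
    rewrite /cayley /cayley_fun; hring.
  rewrite rnormZ ncN ncM (imag_unit_nc hz) mulr1.
  have -> : nc 2 = 2 :> R by rewrite -[2](rmorph_nat (real_complex R)) ncR ger0_norm.
  have := cell_resolvent_close sS SE mI d0 Id (imag_unit_neq0 hz) Iv.
  rewrite imag_unit_Im// invr1 expr1n mulr1; lra.
have -> : iter k.+1 (cayley S z) v - cayley_fun z l ^+ k.+1 *: v =
    iter k (cayley S z) (cayley S z v - cayley_fun z l *: v) +
    cayley_fun z l *: (iter k (cayley S z) v - cayley_fun z l ^+ k *: v).
  rewrite iterSr (linear_funB _ _ l1) (linear_funZ _ _ l1) exprS; hring.
apply: le_trans (rnormD _ _) _.
rewrite rnormZ nc_cayley_fun// mul1r rnorm_iter_cayley// -natr1; lra.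
Qed.

Lemma cell_trig_op_close a b K v : E I v = v ->
  nc (inner (trig_op S a b K v) v - trig_fun a b K l * (rnorm v ^+ 2)%:C) <=
  4 * trig_weight a b K * d * rnorm v ^+ 2.
Proof.
move=> Iv.
rewrite /trig_op /trig_fun inner_suml mulr_suml -sumrB.
apply: le_trans (nc_sum _ _ _) _.
rewrite /trig_weight mulr_sumr !mulr_suml; apply: ler_sum => k _.
have key z c : imag_unit z -> nc (inner (c *: iter k (cayley S z) v) v -
    c * cayley_fun z l ^+ k * (rnorm v ^+ 2)%:C) <= nc c * (k%:R * (4 * d) * rnorm v ^+ 2).
  move=> hz.
  have -> : inner (c *: iter k (cayley S z) v) v - c * cayley_fun z l ^+ k * (rnorm v ^+ 2)%:C =
      c * inner (iter k (cayley S z) v - cayley_fun z l ^+ k *: v) v.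
    by rewrite innerBl !innerZl innerxx; ring.
  rewrite ncM ler_wpM2l ?nc_ge0//; apply: le_trans (cauchy_schwarz _ _) _.
  by rewrite expr2 mulrA ler_wpM2r ?rnorm_ge0// cell_iter_cayley_close.
rewrite innerDl mulrDl opprD addrACA; apply: le_trans (ncD _ _) _.
have := key _ (a k) (imag_unit_Ni (R := R)); have := key _ (b k) (imag_unit_i (R := R)); lra.
Qed.

End cayley_cell.

(** * Riemann sums for functions of S *)

Section functional_calculus_approximation.
Context {R : realType} {H : hilbertType R}.
Implicit Types (x y v w : H) (E : pvm H).

Lemma pv_setU E (A B : set (measurableTypeR R)) x : measurable A -> measurable B ->
  A `&` B = set0 -> E (A `|` B) x = E A x + E B x.
Proof.
move=> mA mB AB.
have mF i : measurable (bigcup2 A B i) by case: i => [|[|i]] /=; [exact: mA|exact: mB|exact: measurable0].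
have tF : trivIset setT (bigcup2 A B) by rewrite -trivIset_bigcup2.
have := @pv_sigma _ _ E _ mF tF x; rewrite bigcup2E => h.
apply/eqP; rewrite -subr_eq0 -rnorm_eq0 eq_le rnorm_ge0 andbT.
apply/ler_addgt0Pl => e e0; rewrite addr0.
have [N hN] := (cvgP_rnorm _ _).1 h _ e0.
have := hN (N + 2)%N (leq_addr _ _); rewrite rnormBC.
rewrite addn2 !big_nat_recl//= big1; last first.
  by move=> i _; rewrite pv_set0.
by rewrite addr0.
Qed.

(** The half-open intervals [m d, (m + 1) d), m an integer, indexed by the code of m because
    [pv_sigma] takes sequences; a natural number that codes no integer gives an empty cell. *)
Definition cell (d : R) (i : nat) : set (measurableTypeR R) :=
  [set t | choice.pickle (Num.floor (t / d)) = i].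

Lemma cell_trivIset d : trivIset setT (cell d).
Proof. by apply/trivIsetP => i j _ _ ij; apply/seteqP; split=> // t [h1 h2]; move: ij; rewrite -h1 -h2 eqxx. Qed.

Lemma cell_bigcup d : \bigcup_i cell d i = setT.
Proof. by apply/seteqP; split=> // t _; exists (choice.pickle (Num.floor (t / d))). Qed.

Lemma cell_floor d i t s : cell d i t -> cell d i s -> Num.floor (t / d) = Num.floor (s / d).
Proof. by rewrite /cell /= => <- /(pcan_inj choice.pickleK). Qed.

Lemma measurable_cell d i : 0 < d -> measurable (cell d i).
Proof.
move=> d0; have [[s hs]|h] := pselect (exists s, cell d i s); last first.
  rewrite (_ : cell d i = set0)//; apply/seteqP; split=> // t ht.
  by apply: h; exists t.
pose m := Num.floor (s / d).
rewrite (_ : cell d i = `[m%:~R * d, (m + 1)%:~R * d[%classic); first exact: measurable_itv.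
apply/seteqP; split=> t /=.
  move=> ht; have fm := cell_floor ht hs.
  rewrite in_itv/= -ler_pdivlMr// -ltr_pdivrMr// -/m.
  by apply/andP; have := floor_itv (t / d); rewrite fm -/m => /andP.
rewrite in_itv/= -ler_pdivlMr// -ltr_pdivrMr// => hm.
by rewrite -hs /cell /= (floor_def hm).
Qed.

Lemma cell_diam d i t s : 0 < d -> cell d i t -> cell d i s -> `|t - s| <= d.
Proof.
move=> d0 ht hs; have fm := cell_floor ht hs.
have /andP[h1 h2] := floor_itv (t / d); have /andP[h3 h4] := floor_itv (s / d).
move: h1 h2 h3 h4; rewrite fm intrD ler_pdivlMr// ltr_pdivrMr// ler_pdivlMr// ltr_pdivrMr//.
rewrite ler_norml; move: (_%:~R) => m; rewrite mulrDl mul1r => h1 h2 h3 h4.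
by apply/andP; split; lra.
Qed.

Variables (S A : linop H) (E : pvm H) (f : R -> R[i]) (M eta : R).
Variables (a b : nat -> R[i]) (K : nat).
Hypotheses (sS : selfadjoint S) (SE : is_spectral_integral E (fun t => t%:C) S).
Hypotheses (fA : is_spectral_integral E f A).
Hypotheses (mRe : measurable_fun setT (fun t : measurableTypeR R => complex.Re (f t))).
Hypotheses (mIm : measurable_fun setT (fun t : measurableTypeR R => complex.Im (f t))).
Hypotheses (fM : forall t, nc (f t) <= M).

Lemma spectral_integral_dom x : dom A x.
Proof.
rewrite fA.1 /=.
rewrite (_ : (fun t : R => ((complex.Re `|f t|) ^+ 2)%:E) =
  EFin \o (fun t => (complex.Re (f t)) ^+ 2 + (complex.Im (f t)) ^+ 2)); last first.
  by apply/funext => t; rewrite -/(nc _) nc_sqr.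
have gi : (spectral_measure E x).-integrable setT
    (EFin \o (fun t => (complex.Re (f t)) ^+ 2 + (complex.Im (f t)) ^+ 2)).
  apply: (@bounded_integrable_spectral _ _ _ _ _ _ (M ^+ 2)) => //.
    by apply: measurable_funD; exact: measurable_funX.
  move=> t _; rewrite -nc_sqr ger0_norm ?sqr_ge0// ler_sqr ?nnegrE ?nc_ge0//.
  by rewrite (le_trans (nc_ge0 _) (fM t)).
have := integrable_fin_num measurableT gi.
by rewrite fin_numE => /andP[_ h]; rewrite ltey.
Qed.

Let U d n := \big[setU/set0]_(i < n) cell d i.

Let mU d n : 0 < d -> measurable (U d n).
Proof. by move=> d0; apply: bigsetU_measurable => i _; exact: measurable_cell. Qed.

Let U_disj d n : U d n `&` cell d n = set0.
Proof.
rewrite /U -bigcup_mkord; apply/seteqP; split=> // t [[i /= ni ti] tn].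
by move: ni; rewrite -ti -tn ltnn.
Qed.

Let U_pv d n x : 0 < d -> E (U d n) x = \sum_(0 <= i < n) E (cell d i) x.
Proof.
move=> d0; elim: n => [|n IH]; first by rewrite /U big_ord0 big_geq// pv_set0.
rewrite big_nat_recr//= -IH /U big_ord_recr/= pv_setU//.
- exact: mU.
- exact: measurable_cell.
- exact: U_disj.
Qed.

Let U_int d n x (g : measurableTypeR R -> R) : 0 < d -> measurable_fun setT g ->
  (forall t, `|g t| <= M) ->
  \int[spectral_measure E x]_(t in U d n) g t =
  \sum_(0 <= i < n) \int[spectral_measure E x]_(t in cell d i) g t.
Proof.
move=> d0 mg gM; elim: n => [|n IH]; first by rewrite /U big_ord0 big_geq// Rintegral_set0.
rewrite big_nat_recr//= -IH /U big_ord_recr/= Rintegral_setU//.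
- exact: mU.
- exact: measurable_cell.
- apply: (@bounded_integrable_spectral _ _ _ _ _ _ M) => //.
    by apply: measurableU; [exact: mU|exact: measurable_cell].
  exact: measurable_funS mg.
- by apply/disj_setPS; rewrite -/(U d n) U_disj.
Qed.

Let U_tail d n x (g : measurableTypeR R -> R) : 0 < d -> measurable_fun setT g ->
  (forall t, `|g t| <= M) ->
  `|\int[spectral_measure E x]_t g t -
    \sum_(0 <= i < n) \int[spectral_measure E x]_(t in cell d i) g t| <=
  M * rnorm (x - E (U d n) x) ^+ 2.
Proof.
move=> d0 mg gM; have mUn := mU n d0; have mC := measurableC mUn.
have -> : \int[spectral_measure E x]_t g t =
    \int[spectral_measure E x]_(t in U d n) g t +
    \int[spectral_measure E x]_(t in ~` U d n) g t.
  rewrite -Rintegral_setU ?setUv//.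
    exact: (@bounded_integrable_spectral _ _ _ _ _ _ M).
  by apply/disj_setPS; rewrite setICr.
rewrite U_int// [X in `|X|]addrC addKr.
have -> : x - E (U d n) x = E (~` U d n) x.
  have := pv_setU E x mUn mC (setICr _); rewrite setUv pv_setT => {1}->.
  by rewrite addrC addKr.
have := @spectral_Rintegral_close _ _ E x (~` U d n) g 0 M mC (measurable_funS _ (@subsetT _ _) mg).
rewrite mul0r subr0; apply=> // t _; by rewrite subr0.
Qed.

Hypothesis fh : forall t, nc (f t - trig_fun a b K t) <= eta.

(* Riemann sums over the cells of a partition of mesh d compare both forms. *)
Lemma functional_calculus_approx_sum d n x : 0 < d ->
  nc (inner (A x) x - inner (trig_op S a b K (E (U d n) x)) (E (U d n) x)) <=
  2 * M * rnorm (x - E (U d n) x) ^+ 2 + (2 * eta + 8 * trig_weight a b K * d) * rnorm x ^+ 2.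
Proof.
move=> d0; set X := E (U d n) x; set W := trig_weight a b K.
have W0 : 0 <= W by exact: trig_weight_ge0.
have d0' := ltW d0.
have gR t : `|complex.Re (f t)| <= M by apply: le_trans (fM t); exact: Re_le_nc.
have gI t : `|complex.Im (f t)| <= M by apply: le_trans (fM t); exact: Im_le_nc.
have mc i := measurable_cell i d0.
pose xi i := E (cell d i) x.
(* A sample point of the cell; the default 0 occurs only for an empty cell, where [Id] below is
   vacuous. *)
pose li i := xget 0 (cell d i).
have Id i t : cell d i t -> `|t - li i| <= d.
  move=> ht; apply: (cell_diam d0 ht).
  by rewrite /li; apply: xgetPex; exists t.
have XE : X = \sum_(0 <= i < n) xi i by rewrite /X U_pv.
have xiP i : E (cell d i) (xi i) = xi i by rewrite /xi pv_idem.
have ort i j v w : i != j -> inner (E (cell d i) v) (E (cell d j) w) = 0.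
  move=> ij; rewrite pv_sym// pv_mul//.
  have /trivIsetP/(_ i j Logic.I Logic.I ij) -> := @cell_trivIset d.
  by rewrite pv_set0 inner0r.
(* As [trig_op] respects the mutually orthogonal cells, no cross terms survive in [form]. *)
have tP i v : trig_op S a b K (E (cell d i) v) = E (cell d i) (trig_op S a b K v).
  rewrite /trig_op; have lE := pv_lin E (mc i).
  elim: K {W W0} => [|K' IH]; first by rewrite !big_ord0 linear_fun0.
  rewrite !big_ord_recr/= (linear_funD _ _ lE) (linear_funD _ _ lE) !(linear_funZ _ _ lE) IH.
  by rewrite !(cell_iter_cayley_comm sS SE (mc i) d0' (Id i))//; [exact: imag_unit_i|exact: imag_unit_Ni].
have lT := trig_op_linear a b K sS.
pose J i := \int[spectral_measure E x]_(t in cell d i) complex.Re (f t) +i*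
  \int[spectral_measure E x]_(t in cell d i) complex.Im (f t).
have form : inner (trig_op S a b K X) X = \sum_(0 <= i < n) inner (trig_op S a b K (xi i)) (xi i).
  have -> : trig_op S a b K X = \sum_(0 <= i < n) trig_op S a b K (xi i).
    rewrite XE; elim: (n) => [|m IH]; first by rewrite !big_geq// linear_fun0.
    by rewrite !big_nat_recr//= (linear_funD _ _ lT) IH.
  rewrite inner_suml !big_mkord; apply: eq_bigr => i _.
  rewrite XE inner_sumr big_mkord (bigD1 i)//= big1 ?addr0// => j ji.
  by rewrite /xi tP ort// eq_sym.
have sumx : \sum_(0 <= i < n) rnorm (xi i) ^+ 2 <= rnorm x ^+ 2.
  have e1 : \sum_(0 <= i < n) rnorm (xi i) ^+ 2 = rnorm X ^+ 2.
    apply/(@complexI R); rewrite -innerxx rmorph_sum/= XE inner_suml.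
    rewrite !big_mkord; apply: eq_bigr => i _.
    rewrite inner_sumr ?big_mkord (bigD1 i)//= big1 ?addr0; first by rewrite innerxx.
    by move=> j ji; rewrite ort// eq_sym.
  rewrite e1 ler_sqr ?nnegrE ?rnorm_ge0//.
  have [->|X0] := eqVneq X 0; first by rewrite rnorm0 rnorm_ge0.
  have pX : 0 < rnorm X by rewrite rnorm_gt0.
  rewrite -(ler_pM2l pX) -expr2 rnorm_sqr.
  have -> : inner X X = inner X x.
    by rewrite {2}/X -pv_sym; [rewrite /X pv_idem//|]; exact: mU.
  exact: Re_inner_le.
have ImB (u v : R[i]) : complex.Im (u - v) = complex.Im u - complex.Im v.
  by case: u v => [? ?] [? ?].
(* Real and imaginary parts of the integral each cost eta + 2 W d, the operator costs 4 W d. *)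
have cellb i : nc (J i - inner (trig_op S a b K (xi i)) (xi i)) <=
    (2 * eta + 8 * W * d) * rnorm (xi i) ^+ 2.
  set hl := trig_fun a b K (li i).
  have q0 := sqr_ge0 (rnorm (xi i)).
  have h1 : nc (J i - hl * (rnorm (xi i) ^+ 2)%:C) <= 2 * (eta + 2 * W * d) * rnorm (xi i) ^+ 2.
    have fl t : cell d i t -> nc (f t - hl) <= eta + 2 * W * d.
      move=> ht; apply: le_trans (nc_dist_tri _ (trig_fun a b K t) _) _.
      apply: lerD => //; apply: le_trans (trig_fun_lipschitz _ _ _ _ _) _.
      by rewrite ler_wpM2l ?mulr_ge0//; exact: Id.
    have hR : `|\int[spectral_measure E x]_(t in cell d i) complex.Re (f t) -
        complex.Re hl * rnorm (xi i) ^+ 2| <= (eta + 2 * W * d) * rnorm (xi i) ^+ 2.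
      apply: spectral_Rintegral_close => //; first exact: measurable_funS mRe.
      move=> t ht; apply: le_trans (fl t ht); rewrite -ReN -ReD; exact: Re_le_nc.
    have hI : `|\int[spectral_measure E x]_(t in cell d i) complex.Im (f t) -
        complex.Im hl * rnorm (xi i) ^+ 2| <= (eta + 2 * W * d) * rnorm (xi i) ^+ 2.
      apply: spectral_Rintegral_close => //; first exact: measurable_funS mIm.
      move=> t ht; apply: le_trans (fl t ht); apply: le_trans (Im_le_nc _).
      by rewrite ImB.
    apply: le_trans (nc_le_ReIm _) _; rewrite /J.
    rewrite -mulrA mulr_natl mulr2n; apply: le_trans (lerD hR hI).
    by case: (hl) => p q /=; rewrite !mulr0 subr0 add0r.
  have h2 := cell_trig_op_close sS SE (mc i) d0' (Id i) a b K (xiP i).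
  apply: le_trans (nc_dist_tri _ (hl * (rnorm (xi i) ^+ 2)%:C) _) _.
  rewrite (ncBC (hl * _)); move: h2; rewrite -/W -/hl; lra.
have Jsum : nc (inner (A x) x - \sum_(0 <= i < n) J i) <= 2 * M * rnorm (x - X) ^+ 2.
  rewrite (fA.2 _ (spectral_integral_dom x)).
  have -> : \sum_(0 <= i < n) J i =
      (\sum_(0 <= i < n) \int[spectral_measure E x]_(t in cell d i) complex.Re (f t)) +i*
      (\sum_(0 <= i < n) \int[spectral_measure E x]_(t in cell d i) complex.Im (f t)).
    elim: (n) => [|m IH]; first by rewrite !big_geq.
    by rewrite !big_nat_recr//= IH.
  have hR := U_tail n x d0 mRe gR; have hI := U_tail n x d0 mIm gI.
  by apply: le_trans (nc_le_ReIm _) _ => /=; rewrite -mulrA mulr_natl mulr2n; exact: (lerD hR hI).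
apply: le_trans (nc_dist_tri _ (\sum_(0 <= i < n) J i) _) _; apply: lerD => //.
rewrite form -sumrB; apply: le_trans (nc_sum _ _ _) _.
apply: (@le_trans _ _ (\sum_(0 <= i < n) (2 * eta + 8 * W * d) * rnorm (xi i) ^+ 2)).
  by apply: ler_sum => i _; exact: cellb.
rewrite -mulr_sumr ler_wpM2l// addr_ge0//; last by rewrite !mulr_ge0.
by rewrite mulr_ge0// (le_trans (nc_ge0 _) (fh 0)).
Qed.

(** The mesh d is fixed first, making its term at most e / 2; then enough cells are taken for the
    truncation error and for replacing the truncated vector by x, where L bounds the norm of
    [trig_op]. *)
Lemma functional_calculus_approx x :
  nc (inner (A x - trig_op S a b K x) x) <= 2 * eta * rnorm x ^+ 2.
Proof.
set W := trig_weight a b K; have W0 : 0 <= W by exact: trig_weight_ge0.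
have M0 : 0 <= M := le_trans (nc_ge0 _) (fM 0).
pose L := \sum_(k < K) (nc (a k) + nc (b k)).
have L0 : 0 <= L by apply: sumr_ge0 => k _; rewrite addr_ge0 ?nc_ge0.
apply/ler_addgt0Pl => e e0.
pose d := e / 2 / (8 * W * rnorm x ^+ 2 + 1).
have D0 : 0 < 8 * W * rnorm x ^+ 2 + 1 by rewrite ltr_wpDl// mulr_ge0 ?sqr_ge0// mulr_ge0.
have d0 : 0 < d by rewrite !divr_gt0.
have dle : 8 * W * d * rnorm x ^+ 2 <= e / 2.
  rewrite mulrAC /d mulrCA ger_pMr ?divr_gt0// ler_pdivrMr// mul1r lerDl//.
have Xc : \sum_(0 <= i < n) E (cell d i) x @[n --> \oo] --> x.
  have := @pv_sigma _ _ E _ (fun i => measurable_cell i d0) (@cell_trivIset d) x.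
  by rewrite cell_bigcup pv_setT.
pose C := 2 * M * (rnorm x + rnorm x) + 2 * L * (rnorm x + rnorm x) + 1.
have C0 : 0 < C by rewrite ltr_wpDl// addr_ge0// !mulr_ge0// ?addr_ge0// rnorm_ge0.
pose r := Num.min (e / 2 / C) (rnorm x + 1).
have r0 : 0 < r by rewrite lt_min !divr_gt0//= ltr_wpDl// rnorm_ge0.
have [N hN] := (cvgP_rnorm _ _).1 Xc _ r0.
have := functional_calculus_approx_sum N x d0.
have := hN N (leqnn _); rewrite -U_pv//; set X := E _ x; rewrite -/W => hX hh.
have Xx : rnorm X <= rnorm x.
  have [->|X0] := eqVneq X 0; first by rewrite rnorm0 rnorm_ge0.
  have pX : 0 < rnorm X by rewrite rnorm_gt0.
  rewrite -(ler_pM2l pX) -expr2 rnorm_sqr.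
  have -> : inner X X = inner X x.
    by rewrite {2}/X -pv_sym; [rewrite /X pv_idem//|]; exact: mU.
  exact: Re_inner_le.
have lT := trig_op_linear a b K sS.
have hT : nc (inner (trig_op S a b K X) X - inner (trig_op S a b K x) x) <=
    2 * L * rnorm x * rnorm (X - x).
  have -> : inner (trig_op S a b K X) X - inner (trig_op S a b K x) x =
      inner (trig_op S a b K (X - x)) X + inner (trig_op S a b K x) (X - x).
    by rewrite (linear_funB _ _ lT) innerBl innerBr; ring.
  apply: le_trans (ncD _ _) _.
  have h1 : nc (inner (trig_op S a b K (X - x)) X) <= L * rnorm (X - x) * rnorm x.
    apply: le_trans (cauchy_schwarz _ _) _; apply: ler_pM; rewrite ?rnorm_ge0//.
    exact: rnorm_trig_op.
  have h2 : nc (inner (trig_op S a b K x) (X - x)) <= L * rnorm x * rnorm (X - x).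
    apply: le_trans (cauchy_schwarz _ _) _; rewrite ler_wpM2r ?rnorm_ge0//.
    exact: rnorm_trig_op.
  lra.
rewrite innerBl.
apply: le_trans (nc_dist_tri _ (inner (trig_op S a b K X) X) _) _.
apply: le_trans (lerD hh hT) _; rewrite (rnormBC x X).
have n0 := rnorm_ge0 x; have m0 := rnorm_ge0 (X - x).
have h3 : rnorm (X - x) ^+ 2 <= (rnorm x + rnorm x) * rnorm (X - x).
  rewrite expr2 ler_wpM2r//; apply: le_trans (rnormB _ _) _; lra.
have h4 : 2 * M * rnorm (X - x) ^+ 2 <= 2 * M * (rnorm x + rnorm x) * rnorm (X - x).
  by rewrite -[leRHS]mulrA ler_wpM2l// mulr_ge0.
have h5 : C * rnorm (X - x) <= e / 2.
  by rewrite mulrC -ler_pdivlMr// (le_trans hX)// ge_min lexx.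
have h6 : 2 * L * rnorm x * rnorm (X - x) <= 2 * L * (rnorm x + rnorm x) * rnorm (X - x).
  by rewrite ler_wpM2r// ler_wpM2l ?mulr_ge0// lerDl.
rewrite /C !mulrDl mul1r in h5.
move: h4 h5 h6 dle; rewrite !mulrDr !mulrDl; lra.
Qed.

End functional_calculus_approximation.

(** * Trigonometric approximation on the real line *)

Section real_calculus.
Context {R : realType}.
Implicit Types (g : R -> R) (t s x y h B L : R).

Lemma is_derive_mul (f g : R -> R) x df dg :
  is_derive x 1 f df -> is_derive x 1 g dg ->
  is_derive x 1 (fun t => f t * g t) (df * g x + f x * dg).
Proof.
move=> hf hg; apply: (@is_derive_eq _ _ _ (f * g) x 1 _ _ (is_deriveM hf hg)).
by rewrite /GRing.scale/= addrC (mulrC (g x)).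
Qed.

Definition fdiff h (u : R -> R) t := u (t + h) - u t.

Lemma is_derive_fdiff (f df : R -> R) h x : (forall t, is_derive t 1 f (df t)) ->
  is_derive x 1 (fdiff h f) (fdiff h df x).
Proof.
move=> hf.
have h1 : is_derive x 1 (fun t => f (t + h)) (df (x + h)).
  have hs : is_derive x 1 (fun t : R => t + h) 1.
    by apply: (is_derive_eq (is_deriveD (is_derive_id x 1) (is_derive_cst h x 1))); rewrite addr0.
  have := @is_derive1_comp _ f (fun t => t + h) x _ _ (hf (x + h)) hs.
  by rewrite mulr1.
exact: (is_deriveB h1 (hf x)).
Qed.

Lemma is_derive_continuous (f df : R -> R) : (forall t, is_derive t 1 f (df t)) ->
  continuous f.
Proof.
by move=> hf t; apply/differentiable_continuous/derivable1_diffP; have [] := hf t.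
Qed.

Lemma is_derive_lipschitz (f df : R -> R) B x y : (forall t, is_derive t 1 f (df t)) ->
  (forall t, `|df t| <= B) -> `|f x - f y| <= B * `|x - y|.
Proof.
move=> hf hB.
wlog xy : x y / y <= x => [hw|].
  have [|/ltW] := leP y x; first exact: hw.
  by rewrite distrC (distrC x); exact: hw.
have [|c _ ->] := @MVT_segment R f df y x xy (fun t _ => hf t).
  by apply: continuous_subspaceT; exact: is_derive_continuous hf.
by rewrite normrM ler_wpM2r.
Qed.

(** The mean value theorem, used once per difference: each use trades a derivative for a factor
    h. *)
Lemma third_difference_bound (f f1 f2 f3 : R -> R) B h x : 0 <= h ->
  (forall t, is_derive t 1 f (f1 t)) -> (forall t, is_derive t 1 f1 (f2 t)) ->
  (forall t, is_derive t 1 f2 (f3 t)) -> (forall t, `|f3 t| <= B) ->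
  `|fdiff h (fdiff h (fdiff h f)) x| <= B * h ^+ 3.
Proof.
move=> h0 hf hf1 hf2 hB; pose D := fdiff h.
have D2 t : `|D f2 t| <= B * h.
  apply: le_trans (is_derive_lipschitz _ _ hf2 hB) _.
  by rewrite addrC addKr ger0_norm.
have dD1 t : is_derive t 1 (D f1) (D f2 t) by exact: is_derive_fdiff.
have DD1 t : `|D (D f1) t| <= B * h * h.
  apply: le_trans (is_derive_lipschitz _ _ dD1 D2) _.
  by rewrite addrC addKr ger0_norm.
have dD t : is_derive t 1 (D f) (D f1 t) by exact: is_derive_fdiff.
have dDD t : is_derive t 1 (D (D f)) (D (D f1) t) by exact: is_derive_fdiff.
apply: le_trans (is_derive_lipschitz _ _ dDD DD1) _.
by rewrite addrC addKr ger0_norm// !exprS expr0 mulr1 !mulrA.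
Qed.

Lemma continuous_compact_support_bounded g L : continuous g ->
  (forall t, L < `|t| -> g t = 0) -> exists2 B, 0 <= B & forall t, `|g t| <= B.
Proof.
move=> cg sg; pose L' := `|L|.
have L0 : - L' <= L' by have := normr_ge0 L; rewrite /L'; lra.
have cn : {within `[- L', L'], continuous (fun t => `|g t|)}.
  by apply: continuous_subspaceT => t; apply: continuous_comp; [exact: cg|exact: norm_continuous].
have [c _ hc] := EVT_max L0 cn.
exists `|g c|; first exact: normr_ge0.
move=> t; have [tL|Lt] := leP `|t| L'; first by apply: hc; rewrite in_itv/= -ler_norml.
by rewrite sg ?normr0// (le_lt_trans (ler_norm L)).
Qed.

(* The pullback of g to the circle R / pi Z under t = tan s, set to 0 at the
   point at infinity (where tan has the junk value 0). *)
Definition pullback g s : R := if cos s == 0 then 0 else g (tan s).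

Lemma cos_neq0_near s : cos s != 0 -> \near s, cos s != 0.
Proof.
move=> cs; have := @continuous_cos R s; move/cvgrPdist_lt => /(_ `|cos s|).
rewrite normr_gt0 => /(_ cs); apply: filterS => t.
by apply: contraTneq => ->; rewrite subr0 ltxx.
Qed.

(** The derivative is again a pullback, of (1 + t^2) g', so the lemma can be iterated. Near a zero
    of the cosine |tan| exceeds L and the pullback is identically 0, which makes the point at
    infinity harmless. *)
Lemma is_derive_pullback g g1 L s : (forall t, is_derive t 1 g (g1 t)) ->
  (forall t, L < `|t| -> g t = 0) ->
  is_derive s 1 (pullback g) (pullback (fun t => (1 + t ^+ 2) * g1 t) s).
Proof.
move=> dg sg.
have [cs|cs] := eqVneq (cos s) 0; last first.
  rewrite /pullback (negbTE cs).
  apply: (@near_eq_is_derive _ _ _ (g \o tan)).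
    by apply: filterS (cos_neq0_near cs) => t ct; rewrite (negbTE ct).
  have := @is_derive1_comp _ g tan s _ _ (dg (tan s)) (is_derive_tan cs).
  by rewrite cos2_tan2// mulrC.
have -> : pullback (fun t => (1 + t ^+ 2) * g1 t) s = 0 by rewrite /pullback cs eqxx.
apply: (@near_eq_is_derive R R R (cst 0)).
have L1 : 0 < (1 + L ^+ 2)^-1 by rewrite invr_gt0 ltr_wpDr// sqr_ge0.
(* Since 1 + tan^2 = 1 / cos^2, this says tan^2 > L^2. *)
have : \near s, cos s ^+ 2 < (1 + L ^+ 2)^-1.
  have /cvgr_lt : (fun t : R => cos t ^+ 2) x @[x --> s] --> cos s ^+ 2.
    exact: (cvgM (@continuous_cos R s) (@continuous_cos R s)).
  by apply; rewrite cs expr0n.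
apply: filterS => t ht; rewrite /pullback; case: eqVneq => // ct.
rewrite sg// -[L]/(L); apply: (le_lt_trans (ler_norm L)).
rewrite -ltr_sqr ?nnegrE// !real_normK ?num_real//.
have c2 : 0 < cos t ^+ 2 by rewrite exprn_even_gt0.
have := cos2_tan2 ct => h.
suff : 1 + L ^+ 2 < 1 + tan t ^+ 2 by rewrite ltrD2l.
by rewrite -h -(invrK (1 + L ^+ 2)) ltf_pV2// posrE.
Qed.

Lemma pullbackDpi g s : pullback g (s + pi) = pullback g s.
Proof. by rewrite /pullback tanDpi cosDpi oppr_eq0. Qed.

Lemma pullback_bounded g B : 0 <= B -> (forall t, `|g t| <= B) ->
  forall s, `|pullback g s| <= B.
Proof. by move=> B0 hB s; rewrite /pullback; case: eqP => // _; rewrite normr0. Qed.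

Lemma compact_support_derive g g1 L : (forall t, is_derive t 1 g (g1 t)) ->
  (forall t, L < `|t| -> g t = 0) -> forall t, L < `|t| -> g1 t = 0.
Proof.
move=> dg sg t tL.
have h0 : is_derive t 1 g 0.
  apply: (@near_eq_is_derive R R R (cst 0)).
  have /cvgr_gt/(_ _ tL) := @norm_continuous _ _ t.
  by apply: filterS => u /sg.
by have [_ <-] := dg t; have [_ ->] := h0.
Qed.

Lemma smooth_derive (g : R -> R) n t : smooth g ->
  is_derive t 1 (derive1n n g) (derive1n n.+1 g t).
Proof.
move=> sg; have := derivableP (sg n t); rewrite -derive1E => h.
by rewrite derive1nS.
Qed.

(** The functions g1, g2, g3 are the iterates of g under g |-> (1 + t^2) g', which keeps the
    support. The three bounds serve the constant coefficient, the error between nodes and the decay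
    of the coefficients. *)
Lemma smooth_pullback g L : smooth g -> (forall t, L < `|t| -> g t = 0) ->
  exists (f1 f2 f3 : R -> R) (B : R), [/\ 0 <= B,
    [/\ forall t, is_derive t 1 (pullback g) (f1 t), forall t, is_derive t 1 f1 (f2 t)
      & forall t, is_derive t 1 f2 (f3 t)] &
    [/\ forall t, `|pullback g t| <= B, forall t, `|f1 t| <= B & forall t, `|f3 t| <= B]].
Proof.
move=> smg sg.
pose d n := derive1n n g.
have dd n t : is_derive t 1 (d n) (d n.+1 t) by exact: smooth_derive.
pose w t : R := 1 + t ^+ 2.
have dw t : is_derive t 1 w (2 * t).
  have h := is_derive_mul (is_derive_id t 1) (is_derive_id t 1).
  have {}h : is_derive t 1 w (0 + (1 * t + t * 1)) := is_deriveD (is_derive_cst (1 : R) t 1) h.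
  by apply: (is_derive_eq h); ring.
have d2 t : is_derive t 1 (fun t => 2 * t) 2.
  have h := is_derive_mul (is_derive_cst (2 : R) t 1) (is_derive_id t 1).
  have {}h : is_derive t 1 (fun t : R => 2 * t) (0 * t + 2 * 1) := h.
  by apply: (is_derive_eq h); rewrite mul0r add0r mulr1.
pose g1 t := w t * d 1%N t.
pose g1' t := 2 * t * d 1%N t + w t * d 2%N t.
have dg1 t : is_derive t 1 g1 (g1' t) by exact: is_derive_mul.
pose g2 t := w t * g1' t.
pose g1'' t := (2 * d 1%N t + 2 * t * d 2%N t) + (2 * t * d 2%N t + w t * d 3%N t).
have dg1' t : is_derive t 1 g1' (g1'' t).
  by apply: is_deriveD; exact: is_derive_mul.
pose g2' t := 2 * t * g1' t + w t * g1'' t.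
have dg2 t : is_derive t 1 g2 (g2' t) by exact: is_derive_mul.
pose g3 t := w t * g2' t.
have d0 t : is_derive t 1 g (d 1%N t) by have := dd 0%N t.
have s1 := compact_support_derive d0 sg.
have sg1 t : L < `|t| -> g1 t = 0 by move=> /s1 e; rewrite /g1 e mulr0.
have s2 := compact_support_derive dg1 sg1.
have sg2 t : L < `|t| -> g2 t = 0 by move=> /s2 e; rewrite /g2 e mulr0.
have s3 := compact_support_derive dg2 sg2.
have sg3 t : L < `|t| -> g3 t = 0 by move=> /s3 e; rewrite /g3 e mulr0.
have cw := is_derive_continuous dw.
have c2 := is_derive_continuous d2.
have cd n := is_derive_continuous (dd n).
have cM (u v : R -> R) : continuous u -> continuous v -> continuous (fun t => u t * v t).
  by move=> cu cv t; apply: cvgM; [exact: cu|exact: cv].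
have cD (u v : R -> R) : continuous u -> continuous v -> continuous (fun t => u t + v t).
  by move=> cu cv t; apply: cvgD; [exact: cu|exact: cv].
have cc : continuous (fun _ : R => 2 : R) by move=> t; exact: cvg_cst.
have cg3 : continuous g3.
  have c1 := is_derive_continuous dg1'; have cp n := cM _ _ c2 (cd n).
  have cq n := cM _ _ cw (cd n); have cr n := cM _ _ cc (cd n).
  exact: (cM _ _ cw (cD _ _ (cM _ _ c2 c1)
    (cM _ _ cw (cD _ _ (cD _ _ (cr 1%N) (cp 2%N)) (cD _ _ (cp 2%N) (cq 3%N)))))).
have [B0 B00 hB0] := continuous_compact_support_bounded (is_derive_continuous d0) sg.
have [B1 B10 hB1] := continuous_compact_support_bounded (is_derive_continuous dg1) sg1.
have [B3 B30 hB3] := continuous_compact_support_bounded cg3 sg3.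
pose B := B0 + B1 + B3.
have Bge : 0 <= B by rewrite !addr_ge0.
exists (pullback g1), (pullback g2), (pullback g3), B; split=> //.
  by split=> t; apply: is_derive_pullback; eassumption.
split; apply: pullback_bounded => // t.
- by apply: le_trans (hB0 t) _; rewrite /B; lra.
- by apply: le_trans (hB1 t) _; rewrite /B; lra.
- by apply: le_trans (hB3 t) _; rewrite /B; lra.
Qed.

End real_calculus.

(** * Discrete Fourier interpolation on the circle *)

Section discrete_fourier.
Context {R : realType}.
Implicit Types (s t : R) (j k l : nat).

(** This is e^(2 i s); the doubled angle gives it the period pi of the tangent. *)
Definition circ s : R[i] := cos (s *+ 2) +i* sin (s *+ 2).

Lemma circD s t : circ (s + t) = circ s * circ t.
Proof.
by rewrite /circ mulrnDl (cosD (s *+ 2)) (sinD (s *+ 2)) [sin _ * _ + _]addrC.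
Qed.

Lemma circ0 : circ 0 = 1.
Proof. by rewrite /circ mul0rn cos0 sin0. Qed.

Lemma circ_pi : circ pi = 1.
Proof. by rewrite /circ cos2pi sin2pi. Qed.

Lemma circX s k : circ s ^+ k = circ (s *+ k).
Proof.
elim: k => [|k IH]; first by rewrite expr0 mulr0n circ0.
by rewrite exprS IH mulrS circD.
Qed.

Lemma circNK s : circ (- s) * circ s = 1.
Proof. by rewrite -circD addNr circ0. Qed.

Lemma nc_circ s : nc (circ s) = 1.
Proof.
by apply/eqP; rewrite -(@eqrXn2 _ 2) ?nc_ge0// nc_sqr expr1n /= cos2Dsin2.
Qed.

Lemma circ_neq0 s : circ s != 0.
Proof. by rewrite -nc_eq0 nc_circ oner_eq0. Qed.

Lemma circN s : circ (- s) = (circ s)^-1.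
Proof. by apply: (mulIf (circ_neq0 s)); rewrite circNK mulVf// circ_neq0. Qed.

Lemma nc_circ_sub1 s : nc (circ s - 1) = 2 * `|sin s|.
Proof.
apply/eqP; rewrite -(@eqrXn2 _ 2) ?nc_ge0 ?mulr_ge0//; apply/eqP.
rewrite nc_sqr /= oppr0 addr0 exprMn real_normK ?num_real//.
rewrite cos_mulr2n sin_mulr2n.
have := cos2Dsin2 s; move: (cos s) (sin s) => c d cd.
have -> : d ^+ 2 = 1 - c ^+ 2 by lra.
have -> : (c * d *+ 2) ^+ 2 = 4 * c ^+ 2 * d ^+ 2 by ring.
have -> : d ^+ 2 = 1 - c ^+ 2 by lra.
ring.
Qed.

Lemma sin_le_abs s : `|sin s| <= `|s|.
Proof.
have := @is_derive_lipschitz R sin cos 1 s 0 (@is_derive_sin R) (@cos_max R).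
by rewrite sin0 !subr0 mul1r.
Qed.

Lemma nc_circB s t : nc (circ s - circ t) <= 2 * `|s - t|.
Proof.
have -> : circ s - circ t = circ t * (circ (s - t) - 1).
  by rewrite mulrBr -circD mulr1 [t + _]addrC subrK.
by rewrite ncM nc_circ mul1r nc_circ_sub1 ler_wpM2l// sin_le_abs.
Qed.

(** With y = s / 2, sin s = 2 sin y cos y, the mean value theorem gives sin y >= y cos y, and 2
    cos^2 y >= 1 because 2 y <= pi / 2. The bound keeps the factor q - 1 of the summation by parts
    away from 0. *)
Lemma sin_ge_half s : 0 <= s <= pi / 2 -> s / 2 <= sin s.
Proof.
move=> /andP[s0 spi].
pose y := s / 2; have y0 : 0 <= y by rewrite divr_ge0.
have ypi : y *+ 2 <= pi / 2 by rewrite -mulr_natr divfK.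
have c2 t : 0 <= t <= y -> 1 <= 2 * cos t ^+ 2.
  move=> /andP[t0 ty].
  have : 0 <= cos (t *+ 2).
    apply: cos_ge0_pihalf; have h1 : 0 <= t *+ 2 by rewrite mulrn_wge0.
    have h2 : t *+ 2 <= y *+ 2 by rewrite lerMn2r ty orbT.
    have pg := pi_gt0 R; apply/andP; split; lra.
  by rewrite cos_mulr2n -mulr_natl; lra.
have cpos t : 0 <= t <= y -> 0 <= cos t.
  move=> /andP[t0 ty]; apply: cos_ge0_pihalf.
  have pg := pi_gt0 R; move: ypi; rewrite -mulr_natl => *; apply/andP; split; lra.
have [c cy hc] : exists2 c, c \in `[0, y] & sin y - sin 0 = cos c * (y - 0).
  apply: MVT_segment => //.
  by apply: continuous_subspaceT; exact: continuous_sin.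
move: cy; rewrite in_itv/= => cy.
rewrite sin0 !subr0 in hc.
have es : s = y *+ 2 by rewrite -mulr_natr divfK.
rewrite -[s / 2]/y es sin_mulr2n hc mulr2n.
have yy : 0 <= y <= y by rewrite y0 lexx.
have cle : cos y <= cos c.
  case/andP: cy => c0; rewrite le_eqVlt => /orP[/eqP->//|cly].
  apply: ltW; rewrite ltr_cos// in_itv/=.
    by have pg := pi_gt0 R; move: ypi; rewrite -mulr_natl => *; apply/andP; split; lra.
  by have pg := pi_gt0 R; move: ypi; rewrite -mulr_natl => *; apply/andP; split; lra.
have h1 := c2 y yy; have h2 := cpos y yy.
have : cos y ^+ 2 <= cos y * cos c by rewrite expr2 ler_wpM2l.
move: (cos y) (cos c) h1 => u v h1 h3.
have : y * 1 <= y * (2 * (u * v)) by rewrite ler_wpM2l//; lra.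
lra.
Qed.

(** The minus sign in [cayley_fun] makes t = 0 correspond to the angle 0, so that powers of the
    symbol are exactly the powers of [circ]. *)
Lemma cayley_fun_circ s : cos s != 0 ->
  cayley_fun (- 'i) (tan s) = circ s /\ cayley_fun 'i (tan s) = circ (- s).
Proof.
have key u : cos u != 0 -> cayley_fun (- 'i) (tan u) = circ u.
  move=> cu; have cd := cos2Dsin2 u.
  have h0 := imag_unit_dist_neq0 (tan u) (imag_unit_Ni (R := R)).
  apply: (mulIf h0); transitivity (- ((tan u)%:C + - 'i : R[i])).
    by rewrite /cayley_fun; field.
  rewrite /circ cos_mulr2n sin_mulr2n /tan -complexiE opprK.
  apply/eqP; rewrite eq_complex /=; apply/andP; split; apply/eqP;
    move: cd cu; move: (cos u) (sin u) => c d cd cu;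
    rewrite (_ : c ^+ 2 *+ 2 - 1 = c ^+ 2 - d ^+ 2); [|by rewrite -cd; ring| |by rewrite -cd; ring].
    transitivity (- d * (c ^+ 2 + d ^+ 2) / c); first by rewrite cd; field.
    by field.
  transitivity (c ^+ 2 + d ^+ 2); first by rewrite cd; ring.
  by field.
move=> cs; split; first exact: key.
have := key (- s); rewrite cosN tanN => /(_ cs) <-; rewrite /cayley_fun.
have -> : (- tan s)%:C - - 'i = - ((tan s)%:C - 'i) :> R[i] by rewrite rmorphN/=; ring.
by rewrite invrN; ring.
Qed.

(** The first hypothesis, periodicity, removes the boundary terms; each difference of u is then
    worth one factor q - 1. *)
Lemma sum_by_parts (u w : nat -> R[i]) (q : R[i]) M :
  u M * w M = u 0%N * w 0%N -> (forall j, w j = q * w j.+1) ->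
  \sum_(j < M) (u j.+1 - u j) * w j = (q - 1) * \sum_(j < M) u j * w j.
Proof.
move=> per hw.
have shift : \sum_(j < M) u j.+1 * w j.+1 = \sum_(j < M) u j * w j.
  have : \sum_(j < M.+1) u j * w j = u 0%N * w 0%N + \sum_(j < M) u j.+1 * w j.+1.
    by rewrite big_ord_recl.
  by rewrite big_ord_recr/= per addrC => /addrI ->.
rewrite mulrBl mul1r -{1}shift mulr_sumr -sumrB; apply: eq_bigr => j _.
by rewrite mulrBl {1}hw; ring.
Qed.

(** The Dirichlet kernel, shifted by q^K to have natural exponents; the term k = 0 must be counted
    once only. *)
Lemma symmetric_geometric_sum (q : R[i]) K : q != 0 ->
  (\sum_(k < K.+1) (q ^+ k + (if k == 0%N :> nat then 0 else q^-1 ^+ k))) * q ^+ K =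
  \sum_(k < (K.*2).+1) q ^+ k.
Proof.
move=> q0; elim: K => [|K IH].
  by rewrite !big_ord_recr !big_ord0 /= !expr0 !add0r addr0 mulr1.
rewrite big_ord_recr/= mulrDl.
set S := \sum_(k < K.+1) _ in IH *.
have -> : S * q ^+ K.+1 = q * \sum_(k < K.*2.+1) q ^+ k by rewrite exprS mulrCA IH.
have -> : (q ^+ K.+1 + q^-1 ^+ K.+1) * q ^+ K.+1 = q ^+ K.*2.+2 + 1.
  by rewrite mulrDl -exprD addSn addnS addnn -exprMn mulVf// expr1n.
rewrite doubleS [RHS]big_ord_recr big_ord_recl/= expr0.
have -> : \sum_(i < K.*2.+1) q ^+ bump 0 i = q * \sum_(k < K.*2.+1) q ^+ k.
  by rewrite mulr_sumr; apply: eq_bigr => i _; rewrite -exprS.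
ring.
Qed.

Lemma norm1_cases (x : R) : `|x| = 1 -> x = 1 \/ x = -1.
Proof.
have [x0|x0] := leP 0 x; first by rewrite ger0_norm// => ->; left.
by rewrite ltr0_norm// => e; right; lra.
Qed.

Section sampling.
Variables (phi : R -> R) (K : nat).
Hypothesis phi_per : forall s, phi (s + pi) = phi s.

(** There are 2 K + 1 exponents from -K to K, hence as many nodes [h *+ j]. *)
Let M := (K.*2).+1.
Let h : R := pi / M%:R.

Let M0 : M%:R != 0 :> R. Proof. by rewrite pnatr_eq0. Qed.

Let hM : h *+ M = pi. Proof. by rewrite -mulr_natr divfK. Qed.

Let h0 : 0 < h. Proof. by rewrite divr_gt0// pi_gt0. Qed.

(** sg = -1 gives the coefficient of [circ s ^+ k] and sg = 1 that of its inverse power, as k itself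
    is a natural number. *)
Definition dft (sg : R) k : R[i] :=
  (M%:R^-1)%:C * \sum_(j < M) (phi (h *+ j))%:C * circ (sg * (h *+ j)) ^+ k.

Lemma dft_bound0 sg k B : (forall s, `|phi s| <= B) -> nc (dft sg k) <= B.
Proof.
move=> hB; rewrite /dft ncM ncR ger0_norm ?invr_ge0// mulrC ler_pdivrMr ?ltr0n//.
apply: le_trans (nc_sum _ _ _) _.
rewrite mulr_natr -[M in _ *+ M]card_ord -sumr_const; apply: ler_sum => j _.
by rewrite ncM ncX nc_circ expr1n mulr1 ncR.
Qed.

(** Three summations by parts produce (q - 1)^3. For k <= K one has k h <= pi / 2, so |q - 1| = 2
    |sin (k h)| >= k h, and the powers of h cancel against the third difference. *)
Lemma dft_bound sg k B : `|sg| = 1 -> (0 < k <= K)%N ->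
  (forall s, `|fdiff h (fdiff h (fdiff h phi)) s| <= B * h ^+ 3) ->
  nc (dft sg k) <= B / k%:R ^+ 3.
Proof.
move=> sg1 /andP[k0 kK] hB.
have perD (u : R -> R) : (forall s, u (s + pi) = u s) ->
    forall s, fdiff h u (s + pi) = fdiff h u s.
  by move=> hu s; rewrite /fdiff addrAC !hu.
pose w j := circ (sg * (h *+ j)) ^+ k.
pose q := circ (- (sg * h)) ^+ k.
have wq j : w j = q * w j.+1.
  by rewrite /w /q -exprMn -circD mulrS mulrDr addrA addNr add0r.
have wM : w M = w 0%N.
  rewrite /w hM mulr0n mulr0 circ0 expr1n.
  have [->|->] := norm1_cases sg1.
    by rewrite mul1r circ_pi expr1n.
  by rewrite mulN1r circN circ_pi invr1 expr1n.
have parts (u : R -> R) : (forall s, u (s + pi) = u s) ->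
    \sum_(j < M) (fdiff h u (h *+ j))%:C * w j = (q - 1) * \sum_(j < M) (u (h *+ j))%:C * w j.
  move=> hu; rewrite -(@sum_by_parts (fun j => (u (h *+ j))%:C))//.
    by apply: eq_bigr => j _; rewrite /fdiff -mulrSr rmorphB.
  by rewrite wM hM mulr0n -[pi]add0r hu.
have p1 := perD _ phi_per; have p2 := perD _ p1.
have three : (q - 1) ^+ 3 * \sum_(j < M) (phi (h *+ j))%:C * w j =
    \sum_(j < M) (fdiff h (fdiff h (fdiff h phi)) (h *+ j))%:C * w j.
  by rewrite (parts _ p2) (parts _ p1) (parts _ phi_per) !exprS expr0 mulr1 !mulrA.
have qk : k%:R * h <= nc (q - 1).
  have -> : nc (q - 1) = 2 * `|sin (k%:R * h)|.
    rewrite /q circX nc_circ_sub1 mulNrn sinN normrN; congr (_ * _).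
    have [->|->] := norm1_cases sg1.
      by rewrite mul1r mulr_natl.
    by rewrite mulN1r mulNrn sinN normrN mulr_natl.
  have kh0 : 0 <= k%:R * h by rewrite mulr_ge0// ltW.
  have := @sin_ge_half (k%:R * h).
  rewrite kh0/= => hs; have {}hs := hs _.
  have : k%:R * h <= pi / 2.
    rewrite /h mulrA ler_pdivrMr ?ltr0n// mulrAC ler_pdivlMr//.
    rewrite mulrAC [leRHS]mulrC ler_wpM2r ?pi_ge0// -natrM ler_nat muln2 /M.
    by rewrite (leq_trans _ (leqnSn _))// leq_double.
  by move=> /hs hh; have := ler_norm (sin (k%:R * h)); lra.
have kp : 0 < k%:R :> R by rewrite ltr0n.
have h3 : (k%:R * h) ^+ 3 * nc (dft sg k) <= B * h ^+ 3.
  apply: (@le_trans _ _ (nc (q - 1) ^+ 3 * nc (dft sg k))).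
    rewrite ler_wpM2r ?nc_ge0// lerXn2r// ?nnegrE ?nc_ge0//.
    by rewrite mulr_ge0// ltW.
  rewrite -ncX -ncM /dft mulrCA three ncM ncR ger0_norm ?invr_ge0// mulrC ler_pdivrMr ?ltr0n//.
  apply: le_trans (nc_sum _ _ _) _.
  rewrite mulr_natr -[M in _ *+ M]card_ord -sumr_const; apply: ler_sum => j _.
  by rewrite ncM ncX nc_circ expr1n mulr1 ncR.
rewrite ler_pdivlMr ?exprn_gt0//.
have hp : 0 < h ^+ 3 by rewrite exprn_gt0.
rewrite -(ler_pM2r hp); apply: le_trans h3.
have -> : (k%:R * h) ^+ 3 = k%:R ^+ 3 * h ^+ 3 by apply: exprMn.
have rot (x y z : R) : x * y * z = y * z * x by rewrite -mulrA mulrC.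
by rewrite [leLHS]rot lexx.
Qed.

(** After exchanging the sums, the node j = l contributes the kernel value M. For j != l the ratio q
    j is an M-th root of unity other than 1, whose geometric sum vanishes. *)
Lemma dft_interpolation l : (l < M)%N ->
  \sum_(k < K.+1) (dft (-1) k * circ (h *+ l) ^+ k +
    (if k == 0%N :> nat then 0 else dft 1 k) * circ (- (h *+ l)) ^+ k) =
  (phi (h *+ l))%:C.
Proof.
move=> lM.
pose q j := circ (h *+ l - h *+ j).
have q0 j : q j != 0 by exact: circ_neq0.
transitivity (\sum_(k < K.+1) \sum_(j < M) (M%:R^-1)%:C * (phi (h *+ j))%:C *
    (q j ^+ k + (if k == 0%N :> nat then 0 else (q j)^-1 ^+ k))).
  apply: eq_bigr => k _; rewrite /dft.
  have e1 : (M%:R^-1)%:C * (\sum_(j < M) (phi (h *+ j))%:C * circ (-1 * (h *+ j)) ^+ k) *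
      circ (h *+ l) ^+ k = \sum_(j < M) (M%:R^-1)%:C * (phi (h *+ j))%:C * q j ^+ k.
    rewrite mulr_sumr mulr_suml; apply: eq_bigr => j _.
    by rewrite mulN1r /q circD exprMn; ring.
  rewrite e1; case: ifP => _.
    by rewrite mul0r addr0; apply: eq_bigr => j _; rewrite addr0.
  have e2 : (M%:R^-1)%:C * (\sum_(j < M) (phi (h *+ j))%:C * circ (1 * (h *+ j)) ^+ k) *
      circ (- (h *+ l)) ^+ k = \sum_(j < M) (M%:R^-1)%:C * (phi (h *+ j))%:C * (q j)^-1 ^+ k.
    rewrite mulr_sumr mulr_suml; apply: eq_bigr => j _.
    by rewrite mul1r /q -circN opprB circD exprMn; ring.
  by rewrite e2 -big_split/=; apply: eq_bigr => j _; rewrite mulrDr.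
rewrite exchange_big/= (bigD1 (Ordinal lM))//= [X in _ + X]big1 ?addr0.
  rewrite -mulr_sumr.
  have -> : \sum_(k < K.+1) (q l ^+ k + (if k == 0%N :> nat then 0 else (q l)^-1 ^+ k)) = M%:R.
    have := symmetric_geometric_sum K (q0 l).
    rewrite /q subrr circ0 expr1n mulr1 => ->.
    under eq_bigr do rewrite expr1n.
    by rewrite sumr_const card_ord.
  have -> : M%:R = M%:R%:C :> R[i] by rewrite (rmorph_nat (real_complex R)).
  by rewrite mulrAC -rmorphM/= mulVf// mul1r.
move=> j jl; rewrite -mulr_sumr.
suff -> : \sum_(k < K.+1) (q j ^+ k + (if k == 0%N :> nat then 0 else (q j)^-1 ^+ k)) = 0.
  by rewrite mulr0.
have qK : q j ^+ K != 0 by rewrite expf_neq0.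
apply: (mulIf qK); rewrite mul0r symmetric_geometric_sum// -/M.
have q1 : q j - 1 != 0.
  rewrite -nc_eq0 nc_circ_sub1 mulf_eq0 pnatr_eq0/= normr_eq0.
  have key (m : nat) : (0 < m < M)%N -> sin (h *+ m) != 0.
    move=> /andP[m0 mM]; rewrite gt_eqF// sin_gt0_pi// -hM.
    by rewrite -(mulr_natr h m) -(mulr_natr h M) ltr_pM2l// ltr_nat mM mulr_gt0// ltr0n.
  have [jl'|lj] := ltnP j l.
    rewrite -mulrnBr; last exact: ltnW.
    by apply: key; rewrite subn_gt0 jl' (leq_ltn_trans (leq_subr _ _)).
  have lj' : (l < j)%N by rewrite ltn_neqAle lj andbT eq_sym; move: jl; rewrite -val_eqE.
  rewrite -oppr_eq0 -sinN opprB -mulrnBr; last exact: ltnW.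
  by apply: key; rewrite subn_gt0 lj' (leq_ltn_trans (leq_subr _ _)).
apply: (mulfI q1); rewrite mulr0 -subrX1 /q circX mulrnBl -!mulrnA !(mulnC _ M) !mulrnA hM.
have per m : circ (pi *+ m) = 1 by rewrite -circX circ_pi expr1n.
by rewrite circD circN !per invr1 mulr1 subrr.
Qed.

End sampling.

End discrete_fourier.

(** * Uniform approximation with controlled coefficients *)

Section trigonometric_approximation.
Context {R : realType}.
Implicit Types (s t : R) (k l : nat).

(** The induction runs on the sharper bound 2 - 1 / (n + 1) for n + 1 terms. *)
Lemma sum_inv_sqr_le n : \sum_(k < n) (k.+1%:R ^+ 2)^-1 <= 2 :> R.
Proof.
suff : \sum_(k < n.+1) (k.+1%:R ^+ 2)^-1 <= 2 - n.+1%:R^-1 :> R.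
  rewrite big_ord_recr/= => h.
  have h1 : 0 <= (n.+1%:R ^+ 2)^-1 :> R by rewrite invr_ge0 exprn_ge0.
  have h2 : 0 <= n.+1%:R^-1 :> R by rewrite invr_ge0.
  move: h h1 h2; move: (\sum_(i < n) _) ((n.+1%:R ^+ 2)^-1) (n.+1%:R^-1) => x y z; lra.
elim: n => [|n IH]; first by rewrite big_ord_recr big_ord0 /= add0r expr1n invr1; lra.
rewrite big_ord_recr/=; apply: le_trans (lerD IH (lexx _)) _.
have n1 : 0 < n.+1%:R :> R by rewrite ltr0n.
have -> : n.+2%:R = n.+1%:R + 1 :> R by rewrite natr1.
move: (n.+1%:R) n1 => x x0.
rewrite -subr_ge0.
have -> : 2 - (x + 1)^-1 - (2 - x^-1 + ((x + 1) ^+ 2)^-1) = (x * (x + 1) ^+ 2)^-1.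
  by field; rewrite !gt_eqF// ltr_wpDl// ltW.
by rewrite invr_ge0 mulr_ge0 ?sqr_ge0// ltW.
Qed.

(** This is what the cubic decay is for: k times 2 C / (k + 1)^3 is at most 2 C / (k + 1)^2, whose
    sum is at most 4 C for every K. *)
Lemma trig_decay_weight (a b : nat -> R[i]) (C : R) K : 0 <= C ->
  (forall k, nc (a k) <= C / k.+1%:R ^+ 3 /\ nc (b k) <= C / k.+1%:R ^+ 3) ->
  trig_weight a b K <= 4 * C.
Proof.
move=> C0 hab; apply: (@le_trans _ _ (\sum_(k < K) 2 * C * (k.+1%:R ^+ 2)^-1)).
  apply: ler_sum => k _; have [ha hb] := hab k.
  have k1 : 0 < k.+1%:R :> R by rewrite ltr0n.
  apply: (@le_trans _ _ (k.+1%:R * (C / k.+1%:R ^+ 3 + C / k.+1%:R ^+ 3))).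
    by apply: ler_pM; rewrite ?addr_ge0 ?nc_ge0 ?ler_nat// lerD.
  rewrite le_eqVlt; apply/orP; left; apply/eqP; field.
  by rewrite gt_eqF.
rewrite -mulr_sumr; have := @sum_inv_sqr_le K; move: (\sum_(k < K) _) => x hx.
by apply: le_trans (ler_wpM2l _ hx) _; [rewrite mulr_ge0|lra].
Qed.

Lemma circ_sum_lipschitz (a b : nat -> R[i]) K u v :
  nc (\sum_(k < K) (a k * circ u ^+ k + b k * circ (- u) ^+ k) -
      \sum_(k < K) (a k * circ v ^+ k + b k * circ (- v) ^+ k)) <=
  trig_weight a b K * (2 * `|u - v|).
Proof.
rewrite -sumrB; apply: le_trans (nc_sum _ _ _) _; rewrite /trig_weight mulr_suml.
apply: ler_sum => k _.
have key (x y : R) (c : R[i]) : nc (c * circ x ^+ k - c * circ y ^+ k) <= k%:R * nc c * (2 * `|x - y|).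
  rewrite -mulrBr ncM mulrAC mulrC ler_wpM2r ?nc_ge0//.
  apply: le_trans (unimodular_pow_dist _ (nc_circ _) (nc_circ _)) _.
  by rewrite ler_wpM2l// nc_circB.
rewrite opprD addrACA; apply: le_trans (ncD _ _) _.
rewrite mulrDr mulrDl; apply: lerD; first exact: key.
have -> : `|u - v| = `|- u - - v| by rewrite -opprD normrN.
exact: key.
Qed.

(** The interpolant agrees with the pullback at the nodes, and both have slopes bounded
    independently of K; so the error is of the order of the mesh h. *)
Lemma smooth_trig_approx (g : R -> R) L : smooth g -> (forall t, L < `|t| -> g t = 0) ->
  exists2 C : R, 0 <= C & forall K, exists a b,
    (forall k, nc (a k) <= C / k.+1%:R ^+ 3 /\ nc (b k) <= C / k.+1%:R ^+ 3) /\
    forall t, nc ((g t)%:C - trig_fun a b K.+1 t) <= C / K.+1%:R.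
Proof.
move=> smg sg.
have [f1 [f2 [f3 [B [B0 [d0 d1 d2] [b0 b1 b3]]]]]] := smooth_pullback smg sg.
pose phi := pullback g.
(* The slopes give B h + 4 (8 B) (2 h) = 65 B h, and h = pi / (2 K + 1) <= 4 / (K + 1). The 8 comes
   from (k + 1)^3 <= 8 k^3 for k >= 1. *)
have [C CE] : exists C, C = 4 * (65 * B) by eexists.
have C0 : 0 <= C by rewrite CE !mulr_ge0.
exists C => //.
move=> K; pose M := (K.*2).+1.
have [h hE] : exists h : R, h = pi / M%:R by eexists.
have Mp : 0 < M%:R :> R by rewrite ltr0n.
have h0 : 0 < h by rewrite hE divr_gt0// pi_gt0.
have per s : phi (s + pi) = phi s by exact: pullbackDpi.
(* The cut at K makes the decay hold for all k, and b 0 = 0 leaves the constant term to [a], as in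
   [dft_interpolation]. *)
pose a k := if (k <= K)%N then dft phi K (-1) k else 0.
pose b k := if (k <= K)%N then (if k == 0%N then 0 else dft phi K 1 k) else 0.
have fd s : `|fdiff h (fdiff h (fdiff h phi)) s| <= B * h ^+ 3.
  exact: (third_difference_bound s (ltW h0) d0 d1 d2 b3).
have dec k sgn : `|sgn| = 1 -> (0 < k <= K)%N -> nc (dft phi K sgn k) <= 8 * B / k.+1%:R ^+ 3.
  move=> sgn1 kK; rewrite hE in fd; apply: le_trans (dft_bound per sgn1 kK fd) _.
  have kp : 0 < k%:R :> R by rewrite ltr0n; case/andP: kK.
  have kp1 : 0 < k.+1%:R :> R by rewrite ltr0n.
  rewrite ler_pdivrMr ?exprn_gt0// mulrAC ler_pdivlMr ?exprn_gt0//.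
  have : k.+1%:R ^+ 3 <= (2 * k%:R) ^+ 3 :> R.
    rewrite lerXn2r ?nnegrE ?mulr_ge0// -natrM ler_nat mul2n -addnn -addn1 leq_add2l.
    by case/andP: kK.
  rewrite exprMn => hk; apply: le_trans (ler_wpM2l B0 hk) _.
  by rewrite le_eqVlt; apply/orP; left; apply/eqP; ring.
have dec8 k : 0 <= 8 * B / k.+1%:R ^+ 3 by rewrite divr_ge0 ?mulr_ge0// exprn_ge0.
have hab k : nc (a k) <= 8 * B / k.+1%:R ^+ 3 /\ nc (b k) <= 8 * B / k.+1%:R ^+ 3.
  rewrite /a /b; case: ifPn => kK; last by rewrite nc0.
  case: eqVneq => [->|k0].
    rewrite nc0 expr1n divr1; split; last by rewrite mulr_ge0.
    by apply: le_trans (dft_bound0 _ _ _ b0) _; lra.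
  by split; apply: dec; rewrite ?normrN ?normr1// lt0n k0.
exists a, b; split.
  have le8 k : 8 * B / k.+1%:R ^+ 3 <= C / k.+1%:R ^+ 3.
    by rewrite ler_wpM2r ?invr_ge0 ?exprn_ge0// CE; lra.
  by move=> k; have [h1 h2] := hab k; split; apply: le_trans (le8 k).
move=> t.
(* The arctangent is shifted by pi if negative, to lie in the period [0, pi) covered by the
   nodes. *)
have [s [/andP[s0 spi] cs ts]] : exists s, [/\ 0 <= s < pi, cos s != 0 & tan s = t].
  have c0 : cos (atan t) != 0.
    by rewrite gt_eqF// cos_gt0_pihalf// atan_gtNpi2 atan_ltpi2.
  have := pi_gt0 R; have := atan_gtNpi2 t; have := atan_ltpi2 t => q1 q2 q3.
  have [p0|p0] := leP 0 (atan t).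
    by exists (atan t); split=> //; [apply/andP; split=> //; lra|exact: atanK].
  exists (atan t + pi); split.
  - by apply/andP; split; lra.
  - by rewrite cosDpi oppr_eq0.
  - by rewrite tanDpi atanK.
pose l := Num.truncn (s / h).
have sh0 : 0 <= s / h by rewrite divr_ge0// ltW.
have [l1 l2] : l%:R <= s / h /\ s / h < l.+1%:R.
  by have /andP := truncn_itv sh0.
have lM : (l < M)%N.
  rewrite -(ltr_nat R); apply: le_lt_trans l1 _.
  by rewrite ltr_pdivrMr// hE mulrCA mulfV ?mulr1// gt_eqF.
have dist : `|s - h *+ l| <= h.
  rewrite ler_pdivlMr// in l1; rewrite ltr_pdivrMr// in l2.
  move: l2; rewrite -natr1 mulrDl mul1r => l2; rewrite -mulr_natl.
  by rewrite ler_norml; apply/andP; split; lra.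
pose T u := \sum_(k < K.+1) (a k * circ u ^+ k + b k * circ (- u) ^+ k).
have Ts : trig_fun a b K.+1 t = T s.
  have [e1 e2] := cayley_fun_circ cs.
  by apply: eq_bigr => k _; rewrite -ts e1 e2.
have Tl : T (h *+ l) = (phi (h *+ l))%:C.
  rewrite hE -(@dft_interpolation R phi K l lM); apply: eq_bigr => k _.
  by rewrite /a /b -ltnS ltn_ord.
have gt : g t = phi s by rewrite /phi /pullback (negbTE cs) ts.
rewrite gt Ts; apply: le_trans (nc_dist_tri _ (phi (h *+ l))%:C _) _.
have e1 : nc ((phi s)%:C - (phi (h *+ l))%:C) <= B * h.
  rewrite -rmorphB/= ncR; apply: le_trans (is_derive_lipschitz _ _ d0 b1) _.
  by rewrite ler_wpM2l.
have e2 : nc (T (h *+ l) - T s) <= trig_weight a b K.+1 * (2 * h).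
  apply: le_trans (circ_sum_lipschitz _ _ _ _ _) _.
  by rewrite ler_wpM2l ?trig_weight_ge0// ler_wpM2l// distrC.
rewrite Tl in e2; apply: le_trans (lerD e1 e2) _.
have e3 := trig_decay_weight K.+1 (mulr_ge0 (ler0n _ 8) B0) hab.
have hK : h <= 4 / K.+1%:R.
  have K1 : 0 < K.+1%:R :> R by rewrite ltr0n.
  rewrite hE ler_pdivrMr// mulrAC ler_pdivlMr//.
  apply: ler_pM; rewrite ?pi_ge0 ?ler0n//.
    by have := pihalf_lt2 R; lra.
  by rewrite ler_nat ltnS -addnn leq_addr.
have e4 : trig_weight a b K.+1 * (2 * h) <= 4 * (8 * B) * (2 * h).
  by rewrite ler_wpM2r// mulr_ge0// ltW.
have e5 : B * h + 4 * (8 * B) * (2 * h) = 65 * B * h by ring.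
apply: le_trans (lerD (lexx _) e4) _; rewrite e5.
have -> : C / K.+1%:R = 65 * B * (4 / K.+1%:R) by rewrite CE; ring.
by rewrite ler_wpM2l// mulr_ge0.
Qed.

End trigonometric_approximation.

(** * Test functions and norms *)

Section preliminaries.
Context {R : realType} {H : hilbertType R}.
Implicit Types (x y : H) (T : H -> H) (p C c : R).

Lemma ereal_cvg0P (u : nat -> \bar R) : (forall n, (0 <= u n)%E) ->
  (u n @[n --> \oo] --> 0%E) <->
  (forall e : R, 0 < e -> \forall n \near \oo, (u n <= e%:E)%E).
Proof.
move=> u0; split=> [/fine_cvgP[fin /cvgrPdist_le uc] e e0|h].
  near=> n; rewrite -(@fineK _ (u n)); last by near: n.
  have : `|0 - fine (u n)| <= e by near: n; exact: uc.
  by rewrite sub0r normrN lee_fin => /(le_trans (ler_norm _)).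
have fin : \forall n \near \oo, u n \is a fin_num.
  apply: filterS (h 1 ltr01) => n un.
  by rewrite ge0_fin_numE// (le_lt_trans un)// ltry.
apply/fine_cvgP; split=> //; apply/cvgrPdist_le => e e0.
near=> n; rewrite sub0r normrN ger0_norm ?fine_ge0//= -lee_fin fineK.
  by near: n; exact: h.
by near: n.
Unshelve. all: by end_near. Qed.

Lemma op_norm_ge0 T : (0 <= op_norm T)%E.
Proof.
apply: le_trans (ereal_sup_ubound _); last first.
  by exists 0; [rewrite /= rnorm0|reflexivity].
by rewrite lee_fin rnorm_ge0.
Qed.

Lemma schatten_norm_ge0 p T : (0 <= schatten_norm p T)%E.
Proof. by apply: le_ereal_inf_tmp => _ [s _ <-]; exact: poweR_ge0. Qed.

Lemma op_norm_le T c : 0 <= c -> (forall x, rnorm (T x) <= c * rnorm x) ->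
  (op_norm T <= c%:E)%E.
Proof.
move=> c0 bT; apply: ub_ereal_sup => _ [x /= x1 <-]; rewrite lee_fin.
by apply: le_trans (bT _) _; rewrite ler_piMr.
Qed.

Lemma op_norm_bound T c : linear T -> (op_norm T <= c%:E)%E ->
  forall x, rnorm (T x) <= c * rnorm x.
Proof.
move=> lT hT x; have [->|x0] := eqVneq x 0; first by rewrite linear_fun0// rnorm0 mulr0.
have px : 0 < rnorm x by rewrite rnorm_gt0.
have h : ((rnorm (T ((rnorm x)^-1%:C *: x)))%:E <= c%:E)%E.
  apply: le_trans hT; apply: ereal_sup_ubound; exists ((rnorm x)^-1%:C *: x) => //=.
  by rewrite rnormZ ncR ger0_norm ?invr_ge0 ?rnorm_ge0// mulVf ?gt_eqF.
move: h; rewrite lee_fin linear_funZ// rnormZ ncR ger0_norm ?invr_ge0 ?rnorm_ge0//.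
by rewrite mulrC ler_pdivrMr.
Qed.

(** Adding 1 to the norm makes the inequality strict, which yields an actual sequence of singular
    values below the infimum bound. *)
Lemma schatten_norm_fin_le p T c : 1 <= p -> linear T ->
  (forall x, rnorm (T x) <= c * rnorm x) -> (schatten_norm p T < +oo)%E ->
  exists2 C, 0 <= C & schatten_le p T C.
Proof.
move=> p1 lT bT hT.
have fin : schatten_norm p T \is a fin_num by rewrite ge0_fin_numE// schatten_norm_ge0.
have C0 : 0 <= fine (schatten_norm p T) + 1 by rewrite addr_ge0// fine_ge0// schatten_norm_ge0.
exists (fine (schatten_norm p T) + 1) => //.
have [|s [sv hs]] := @schatten_norm_lt_singular_values R H p T _ p1 C0.
  by rewrite -{1}(fineK fin) lte_fin ltrDl.
exact: singular_values_schatten_le p1 lT bT sv hs.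
Qed.

Lemma schatten_norm_lt_le p T c C : 1 <= p -> 0 <= C -> linear T ->
  (forall x, rnorm (T x) <= c * rnorm x) -> (schatten_norm p T < C%:E)%E ->
  schatten_le p T C.
Proof.
move=> p1 C0 lT bT /(schatten_norm_lt_singular_values p1 C0)[s [sv hs]].
exact: singular_values_schatten_le p1 lT bT sv hs.
Qed.

Lemma test_function_support (f : R -> R[i]) : test_function f ->
  exists L : R, forall t, L < `|t| -> f t = 0.
Proof.
move=> [_ _ /compact_bounded[M [_ hM]]]; exists (M + 1) => t tM.
apply: contrapT => /eqP ft; have hM1 : M < M + 1 by rewrite ltrDl.
have hcl : closure [set t | f t != 0] t by apply: subset_closure.
by have /= := hM _ hM1 t hcl; rewrite leNgt tM.
Qed.

Lemma test_function_bounded (f : R -> R[i]) : test_function f ->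
  [/\ measurable_fun setT (fun t : measurableTypeR R => complex.Re (f t)),
      measurable_fun setT (fun t : measurableTypeR R => complex.Im (f t)) &
      exists M, forall t, nc (f t) <= M].
Proof.
move=> tf; have [L hL] := test_function_support tf; have [s1 s2 _] := tf.
have hRe t : L < `|t| -> complex.Re (f t) = 0 by move=> /hL ->.
have hIm t : L < `|t| -> complex.Im (f t) = 0 by move=> /hL ->.
have c1 : continuous (fun t => complex.Re (f t)).
  exact: (is_derive_continuous (fun t => smooth_derive 0 t s1)).
have c2 : continuous (fun t => complex.Im (f t)).
  exact: (is_derive_continuous (fun t => smooth_derive 0 t s2)).
split.
- exact: (continuous_measurable_fun c1).
- exact: (continuous_measurable_fun c2).
have [B1 _ h1] := continuous_compact_support_bounded c1 hRe.
have [B2 _ h2] := continuous_compact_support_bounded c2 hIm.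
by exists (B1 + B2) => t; apply: le_trans (nc_le_ReIm _) _; apply: lerD; [exact: h1|exact: h2].
Qed.

Lemma test_function_trig_approx (f : R -> R[i]) : test_function f ->
  exists2 C : R, 0 <= C & forall K, exists a b,
    (forall k, nc (a k) <= C / k.+1%:R ^+ 3 /\ nc (b k) <= C / k.+1%:R ^+ 3) /\
    forall t, nc (f t - trig_fun a b K.+1 t) <= C / K.+1%:R.
Proof.
move=> tf; have [L hL] := test_function_support tf; have [s1 s2 _] := tf.
have hRe t : L < `|t| -> complex.Re (f t) = 0 by move=> /hL ->.
have hIm t : L < `|t| -> complex.Im (f t) = 0 by move=> /hL ->.
have [C1 C10 h1] := smooth_trig_approx s1 hRe.
have [C2 C20 h2] := smooth_trig_approx s2 hIm.
exists (C1 + C2); first exact: addr_ge0.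
move=> K; have [a1 [b1 [d1 e1]]] := h1 K; have [a2 [b2 [d2 e2]]] := h2 K.
exists (fun k => a1 k + 'i * a2 k), (fun k => b1 k + 'i * b2 k); split.
  move=> k; rewrite mulrDl; have [u1 v1] := d1 k; have [u2 v2] := d2 k.
  by split; (apply: le_trans (ncD _ _) _; rewrite ncM nci mul1r; apply: lerD).
move=> t; rewrite mulrDl.
have -> : f t - trig_fun (fun k => a1 k + 'i * a2 k) (fun k => b1 k + 'i * b2 k) K.+1 t =
    ((complex.Re (f t))%:C - trig_fun a1 b1 K.+1 t) +
    'i * ((complex.Im (f t))%:C - trig_fun a2 b2 K.+1 t).
  have -> : trig_fun (fun k => a1 k + 'i * a2 k) (fun k => b1 k + 'i * b2 k) K.+1 t =
      trig_fun a1 b1 K.+1 t + 'i * trig_fun a2 b2 K.+1 t.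
    rewrite /trig_fun mulr_sumr -big_split/=; apply: eq_bigr => k _.
    move: (cayley_fun _ _ ^+ _) (cayley_fun 'i _ ^+ _) => u v; ring.
  rewrite {1}[f t]complexE -complexiE; ring.
apply: le_trans (ncD _ _) _; rewrite ncM nci mul1r; apply: lerD; [exact: e1|exact: e2].
Qed.

End preliminaries.

(** * Convergence of functions of self-adjoint operators *)

Section operator_norm_convergence.
Context {R : realType} {H : hilbertType R}.
Implicit Types (x y : H) (z : R[i]) (S : linop H) (G : linop H -> H -> H).

(* Uniformly in S, the operator G S is a norm limit of linear combinations of
   resolvents of S. By the resolvent identity these G are stable under
   composition with resolvents. *)
Definition resolvent_limit G : Prop := forall e : R, 0 < e ->
  exists s : seq (R[i] * R[i]), (forall q, q \in s -> complex.Im q.2 != 0) /\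
  forall S x, selfadjoint S ->
    rnorm (G S x - \sum_(q <- s) q.1 *: resolvent S q.2 x) <= e * rnorm x.

Lemma resolvent_limit_ext G G' : (forall S, selfadjoint S -> G S =1 G' S) ->
  resolvent_limit G -> resolvent_limit G'.
Proof.
move=> GG' h e e0; have [s [hs bs]] := h e e0; exists s; split=> // S x sS.
by rewrite -GG'//; exact: bs.
Qed.

Lemma resolvent_limit_resolvent z : complex.Im z != 0 ->
  resolvent_limit (fun S => resolvent S z).
Proof.
move=> z0 e e0; exists [:: (1, z)]; split; first by move=> q; rewrite inE => /eqP ->.
by move=> S x _; rewrite big_seq1 scale1r subrr rnorm0 mulr_ge0 ?rnorm_ge0// ltW.
Qed.

Lemma resolvent_limit0 : resolvent_limit (fun _ _ => 0).
Proof.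
move=> e e0; exists [::]; split=> // S x _.
by rewrite big_nil subr0 rnorm0 mulr_ge0 ?rnorm_ge0// ltW.
Qed.

Lemma resolvent_limit_lin (c : R[i]) G G' : resolvent_limit G -> resolvent_limit G' ->
  resolvent_limit (fun S x => c *: G S x + G' S x).
Proof.
move=> hG hG' e e0.
have c0 : 0 < nc c + 1 by rewrite ltr_wpDl// nc_ge0.
have e1 : 0 < e / 2 / (nc c + 1) by rewrite !divr_gt0.
have e2 : 0 < e / 2 by rewrite divr_gt0.
have [s [hs bs]] := hG _ e1; have [s' [hs' bs']] := hG' _ e2.
exists ([seq (c * q.1, q.2) | q <- s] ++ s'); split.
  by move=> q; rewrite mem_cat => /orP[/mapP[q' /hs ? ->]//|/hs'].
move=> S x sS; rewrite big_cat big_map/=.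
have -> : \sum_(q <- s) (c * q.1) *: resolvent S q.2 x = c *: \sum_(q <- s) q.1 *: resolvent S q.2 x.
  by rewrite scaler_sumr; apply: eq_bigr => q _; rewrite scalerA.
have := bs S x sS; have := bs' S x sS.
move: (\sum_(q <- s) _) (\sum_(q <- s') _) => u u' h' h.
have -> : c *: G S x + G' S x - (c *: u + u') = c *: (G S x - u) + (G' S x - u') by hring.
apply: le_trans (rnormD _ _) _; rewrite rnormZ.
have : nc c * rnorm (G S x - u) <= e / 2 * rnorm x.
  apply: le_trans (ler_wpM2l (nc_ge0 _) h) _.
  rewrite mulrA ler_wpM2r ?rnorm_ge0// mulrCA ger_pMr// ler_pdivrMr// mul1r lerDl//.
move: h'; lra.
Qed.

Lemma resolvent_limitZ (c : R[i]) G : resolvent_limit G ->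
  resolvent_limit (fun S x => c *: G S x).
Proof.
move=> hG; apply: resolvent_limit_ext (resolvent_limit_lin c hG resolvent_limit0).
by move=> S _ x; rewrite addr0.
Qed.

Lemma resolvent_limit_lim G : (forall e, 0 < e -> exists G', resolvent_limit G' /\
    forall S x, selfadjoint S -> rnorm (G S x - G' S x) <= e * rnorm x) ->
  resolvent_limit G.
Proof.
move=> h e e0; have e2 : 0 < e / 2 by rewrite divr_gt0.
have [G' [hG' b]] := h _ e2; have [s [hs bs]] := hG' _ e2.
exists s; split=> // S x sS; apply: le_trans (rnorm_dist_tri _ (G' S x) _) _.
have := b S x sS; have := bs S x sS; lra.
Qed.

(** For distinct points, divide the resolvent identity by w - z. For w = z, one factor is moved to
    (1 + d) z, farther from the real axis, so the resolvent bounds do not deteriorate. *)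
Lemma resolvent_limit_mul (w z : R[i]) : complex.Im w != 0 -> complex.Im z != 0 ->
  resolvent_limit (fun S x => resolvent S w (resolvent S z x)).
Proof.
move=> w0 z0.
have neq (w' : R[i]) : complex.Im w' != 0 -> w' != z ->
    resolvent_limit (fun S x => resolvent S w' (resolvent S z x)).
  move=> w'0 wz.
  apply: resolvent_limit_ext (resolvent_limit_lin (w' - z)^-1
    (resolvent_limit_resolvent w'0)
    (resolvent_limitZ (- (w' - z)^-1) (resolvent_limit_resolvent z0))) => S sS x.
  rewrite scaleNr -scalerBr resolvent_identity// scalerA mulVf ?scale1r//.
  by rewrite subr_eq0.
have [wz|wz] := eqVneq w z; last exact: neq.
apply: resolvent_limit_lim => e e0.
have i0 : 0 < `|complex.Im z| by rewrite normr_gt0.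
(* The error is |w' - z| = d |z| times a product of three resolvents, each bounded by 1 / |Im z|. *)
pose k := nc z * `|complex.Im z|^-1 ^+ 3 + 1.
have k0 : 0 < k by rewrite ltr_wpDl// mulr_ge0 ?nc_ge0// exprn_ge0// invr_ge0.
pose d := e / k; have d0 : 0 < d by rewrite divr_gt0.
pose w' := (1 + d)%:C * z.
have iw : complex.Im w' = (1 + d) * complex.Im z.
  by rewrite /w'; case: (z) => a b /=; rewrite mul0r addr0.
have w'0 : complex.Im w' != 0 by rewrite iw mulf_neq0// gt_eqF// addr_gt0.
have zn0 : z != 0 by apply: contraNneq z0 => ->.
have w'z : w' != z.
  rewrite -subr_eq0 /w' rmorphD/= mulrDl mul1r addrC addKr mulf_neq0//.
  by rewrite -nc_eq0 ncR normr_eq0 gt_eqF.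
exists (fun S x => resolvent S w' (resolvent S z x)); split; first exact: neq.
move=> S x sS; rewrite wz rnormBC resolvent_identity// rnormZ.
have -> : w' - z = d%:C * z.
  by rewrite /w' rmorphD/= mulrDl mul1r addrC addKr.
rewrite ncM ncR ger0_norm ?(ltW d0)//.
have iz1 : `|complex.Im w'|^-1 <= `|complex.Im z|^-1.
  rewrite lef_pV2 ?posrE ?normr_gt0// iw normrM ger0_norm ?addr_ge0 ?(ltW d0)//.
  by rewrite ler_peMl// lerDl ltW.
have I0 : 0 <= `|complex.Im z|^-1 by rewrite invr_ge0.
have b1 := rnorm_resolvent x sS z0.
have b2 := rnorm_resolvent (resolvent S z x) sS z0.
have b3 := rnorm_resolvent (resolvent S z (resolvent S z x)) sS w'0.
have n0 := rnorm_ge0 x.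
have n2 := rnorm_ge0 (resolvent S z (resolvent S z x)).
have c3 : rnorm (resolvent S w' (resolvent S z (resolvent S z x))) <=
    `|complex.Im z|^-1 ^+ 3 * rnorm x.
  apply: le_trans b3 _; apply: le_trans (ler_wpM2r n2 iz1) _.
  rewrite exprS -mulrA ler_wpM2l//; apply: le_trans b2 _.
  by rewrite expr2 -mulrA ler_wpM2l.
apply: le_trans (ler_wpM2l _ c3) _; first by rewrite mulr_ge0 ?nc_ge0 ?(ltW d0).
rewrite mulrA ler_wpM2r// -mulrA /d mulrAC ler_pdivrMr// ler_pM2l// /k lerDl//.
Qed.

(** A resolvent at w has norm at most 1 / |Im w| for every S, so accuracy |Im w| e for G gives
    accuracy e after composition. *)
Lemma resolvent_limit_comp (w : R[i]) G : complex.Im w != 0 -> resolvent_limit G ->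
  resolvent_limit (fun S x => resolvent S w (G S x)).
Proof.
move=> w0 hG; apply: resolvent_limit_lim => e e0.
have i0 : 0 < `|complex.Im w| by rewrite normr_gt0.
have [s [hs bs]] := hG _ (mulr_gt0 i0 e0).
exists (fun S x => \sum_(q <- s) q.1 *: resolvent S w (resolvent S q.2 x)); split.
  elim: s hs {bs} => [|q s IH] hs.
    by apply: resolvent_limit_ext resolvent_limit0 => S _ x; rewrite big_nil.
  have q0 : complex.Im q.2 != 0 by apply: hs; rewrite inE eqxx.
  have hs' q' : q' \in s -> complex.Im q'.2 != 0.
    by move=> q's; apply: hs; rewrite inE q's orbT.
  apply: resolvent_limit_ext (resolvent_limit_lin q.1 (resolvent_limit_mul w0 q0) (IH hs')).
  by move=> S _ x; rewrite big_cons.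
move=> S x sS; have lw := resolvent_linear sS w0.
have -> : \sum_(q <- s) q.1 *: resolvent S w (resolvent S q.2 x) =
    resolvent S w (\sum_(q <- s) q.1 *: resolvent S q.2 x).
  elim: (s) => [|q l IH]; first by rewrite !big_nil linear_fun0.
  by rewrite !big_cons lw IH.
rewrite -(linear_funB _ _ lw); apply: le_trans (rnorm_resolvent _ sS w0) _.
rewrite mulrC ler_pdivrMr//.
have -> : e * rnorm x * `|complex.Im w| = `|complex.Im w| * e * rnorm x by ring.
exact: bs.
Qed.

(** The multiple (-1)^k of the identity, the value of the symbol at infinity, is split off because
    combinations of resolvents vanish there. *)
Lemma resolvent_limit_iter_cayley z k : imag_unit z ->
  resolvent_limit (fun S x => iter k (cayley S z) x - (-1) ^+ k *: x).
Proof.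
move=> hz; have z0 := imag_unit_neq0 hz; elim: k => [|k IH].
  by apply: resolvent_limit_ext resolvent_limit0 => S _ x; rewrite /= expr0 scale1r subrr.
have h1 := resolvent_limitZ (- (2 * z)) (resolvent_limit_comp z0 IH).
have h2 := resolvent_limitZ (- (2 * z) * (-1) ^+ k) (resolvent_limit_resolvent z0).
apply: resolvent_limit_ext (resolvent_limit_lin (-1) IH (resolvent_limit_lin 1 h1 h2)).
move=> S sS x /=; have lw := resolvent_linear sS z0.
rewrite /cayley (linear_funB _ _ lw) (linear_funZ _ _ lw) exprS; hring.
Qed.

Context (S1n S2n : nat -> linop H) (S1 S2 : linop H).
Hypotheses (s1n : forall n, selfadjoint (S1n n)) (s2n : forall n, selfadjoint (S2n n))
  (s1 : selfadjoint S1) (s2 : selfadjoint S2).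

(** Linear in G but not multiplicative, which is why products of resolvents are first turned into
    limits of linear combinations. *)
Let D G n x := (G (S2n n) x - G S2 x) - (G (S1n n) x - G S1 x).

Hypothesis hD : forall z, complex.Im z != 0 -> forall e : R, 0 < e ->
  \forall n \near \oo, forall x, rnorm (D (fun S => resolvent S z) n x) <= e * rnorm x.

Let cvgD0 G := forall e : R, 0 < e ->
  \forall n \near \oo, forall x, rnorm (D G n x) <= e * rnorm x.

Lemma cvgD0_lin c G G' : cvgD0 G -> cvgD0 G' -> cvgD0 (fun S x => c *: G S x + G' S x).
Proof.
move=> hG hG' e e0.
have c0 : 0 < nc c + 1 by rewrite ltr_wpDl// nc_ge0.
have e1 : 0 < e / 2 / (nc c + 1) by rewrite !divr_gt0.
have e2 : 0 < e / 2 by rewrite divr_gt0.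
apply: filterS2 (hG _ e1) (hG' _ e2) => n h h' x.
have -> : D (fun S x => c *: G S x + G' S x) n x = c *: D G n x + D G' n x.
  by rewrite /D; hring.
apply: le_trans (rnormD _ _) _; rewrite rnormZ.
have : nc c * rnorm (D G n x) <= e / 2 * rnorm x.
  apply: le_trans (ler_wpM2l (nc_ge0 _) (h x)) _.
  rewrite mulrA ler_wpM2r ?rnorm_ge0// mulrCA ger_pMr// ler_pdivrMr// mul1r lerDl//.
have := h' x; lra.
Qed.

Lemma cvgD0_lim G : (forall e, 0 < e -> exists2 G', cvgD0 G' &
    forall S x, selfadjoint S -> rnorm (G S x - G' S x) <= e * rnorm x) -> cvgD0 G.
Proof.
(* Four values of G - G', each at most e / 8, leave e / 2 for G'. *)
move=> h e e0; have e8 : 0 < e / 8 by rewrite divr_gt0.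
have e2 : 0 < e / 2 by rewrite divr_gt0.
have [G' hG' b] := h _ e8.
apply: filterS (hG' _ e2) => n hn x.
have -> : D G n x = D G' n x + (((G (S2n n) x - G' (S2n n) x) - (G S2 x - G' S2 x)) -
    ((G (S1n n) x - G' (S1n n) x) - (G S1 x - G' S1 x))) by rewrite /D; hring.
apply: le_trans (rnormD _ _) _; apply: le_trans (lerD (hn x) (rnormB _ _)) _.
apply: le_trans (lerD (lexx _) (lerD (rnormB _ _) (rnormB _ _))) _.
have := b _ x (s1n n); have := b _ x (s2n n); have := b _ x s1; have := b _ x s2.
lra.
Qed.

Lemma cvgD0_id : cvgD0 (fun _ x => x).
Proof.
by move=> e e0; near=> n => x; rewrite /D !subrr rnorm0 mulr_ge0 ?rnorm_ge0// ltW.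
Unshelve. all: by end_near. Qed.

Lemma cvgD00 : cvgD0 (fun _ _ => 0).
Proof.
by move=> e e0; near=> n => x; rewrite /D !subrr rnorm0 mulr_ge0 ?rnorm_ge0// ltW.
Unshelve. all: by end_near. Qed.

Lemma cvgD0_resolvent_limit G : resolvent_limit G -> cvgD0 G.
Proof.
move=> hG; apply: cvgD0_lim => e e0; have [s [hs bs]] := hG e e0.
exists (fun S x => \sum_(q <- s) q.1 *: resolvent S q.2 x); last by [].
elim: s hs {bs} => [|q s IH] hs.
  by rewrite (_ : (fun _ _ => _) = (fun _ _ => 0)); [exact: cvgD00|
    apply/funext => S; apply/funext => x; rewrite big_nil].
rewrite (_ : (fun _ _ => _) = (fun S x => q.1 *: resolvent S q.2 x +
    \sum_(q <- s) q.1 *: resolvent S q.2 x)); last first.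
  by apply/funext => S; apply/funext => x; rewrite big_cons.
apply: (@cvgD0_lin q.1 (fun S => resolvent S q.2)).
  by apply: hD; apply: hs; rewrite inE eqxx.
by apply: IH => q' q's; apply: hs; rewrite inE q's orbT.
Qed.

Lemma cvgD0_trig_op a b K : cvgD0 (fun S => trig_op S a b K).
Proof.
have it z k : imag_unit z -> cvgD0 (fun S => iter k (cayley S z)).
  move=> hz.
  rewrite (_ : (fun S => _) = (fun S x => (-1) ^+ k *: x +
    (iter k (cayley S z) x - (-1) ^+ k *: x))); last first.
    by apply/funext => S; apply/funext => x; rewrite addrC subrK.
  apply: (@cvgD0_lin _ (fun _ x => x)); first exact: cvgD0_id.
  by apply: cvgD0_resolvent_limit; exact: resolvent_limit_iter_cayley.
elim: K => [|K IH].
  rewrite (_ : (fun S => _) = (fun _ _ => 0)); first exact: cvgD00.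
  by apply/funext => S; apply/funext => x; rewrite /trig_op big_ord0.
rewrite (_ : (fun S => _) = (fun S x => a K *: iter K (cayley S (- 'i)) x +
    (b K *: iter K (cayley S 'i) x + trig_op S a b K x))); last first.
  by apply/funext => S; apply/funext => x; rewrite /trig_op big_ord_recr/= addrC addrA.
apply: (@cvgD0_lin _ (fun S => iter K (cayley S (- 'i)))); first exact: it imag_unit_Ni.
by apply: (@cvgD0_lin _ (fun S => iter K (cayley S 'i))) => //; exact: it imag_unit_i.
Qed.

End operator_norm_convergence.

Section functional_calculus_operator.
Context {R : realType} {H : hilbertType R}.
Implicit Types (x y : H).

(** [functional_calculus_approx] controls only the diagonal with 2 eta; polarization doubles this
    constant. *)
Lemma functional_calculus_trig (S A : linop H) (f : R -> R[i]) a b K (eta : R) :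
  selfadjoint S -> test_function f -> is_functional_calculus S f A ->
  (forall t, nc (f t - trig_fun a b K t) <= eta) ->
  [/\ linear A & forall x y, nc (inner (A x - trig_op S a b K x) y) <= 4 * eta * rnorm x * rnorm y].
Proof.
move=> sS tf [E [SE fA]] hf.
have [mRe mIm [M hM]] := test_function_bounded tf.
have dA := spectral_integral_dom fA mRe mIm hM.
have lA : linear A by move=> c x y; rewrite op_lin.
have lT := trig_op_linear a b K sS.
have e0 : 0 <= eta := le_trans (nc_ge0 _) (hf 0).
split=> // x y.
have := @quadratic_form_bound _ _ setT (fun x => A x - trig_op S a b K x) (2 * eta) _ _ _ _ _ x y.
rewrite mulrA (_ : 2 * 2 = 4 :> R); last by ring.
apply=> //; first by rewrite mulr_ge0.
  by move=> c u v _ _; rewrite lA lT; hring.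
by move=> u _; exact: (functional_calculus_approx sS SE fA mRe mIm hM hf).
Qed.

Lemma bounded_of_form (T : H -> H) (d : R) :
  (forall x y, nc (inner (T x) y) <= d * rnorm x * rnorm y) ->
  forall x, rnorm (T x) <= d * rnorm x.
Proof.
move=> h x; have [T0|T0] := eqVneq (T x) 0.
  rewrite T0 rnorm0; have [->|x0] := eqVneq x 0; first by rewrite rnorm0 mulr0.
  have px : 0 < rnorm x by rewrite rnorm_gt0.
  have := le_trans (nc_ge0 _) (h x x); by rewrite pmulr_lge0.
have pT : 0 < rnorm (T x) by rewrite rnorm_gt0.
rewrite -(ler_pM2r pT); apply: le_trans (h x (T x)).
by rewrite innerxx ncR ger0_norm ?sqr_ge0// expr2.
Qed.

End functional_calculus_operator.

Section resolvent_differences.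
Context {R : realType} {H : hilbertType R}.
Implicit Types (x y : H) (z w : R[i]) (S : linop H) (p C c : R).

Lemma resolvent_adjointable S z : selfadjoint S -> complex.Im z != 0 ->
  adjointable `|complex.Im z|^-1 (resolvent S z) (resolvent S z^*).
Proof.
move=> sS z0; split=> x.
- by move=> y; exact: resolvent_adj.
- exact: rnorm_resolvent.
- apply: le_trans (rnorm_resolvent _ sS _) _; first by rewrite ImJ oppr_eq0.
  by rewrite ImJ normrN.
Qed.

Lemma affine_adjointable c (A A' : H -> H) w : 0 <= c -> adjointable c A A' ->
  adjointable (1 + nc w * c) (fun x => x + w *: A x) (fun x => x + w^* *: A' x).
Proof.
move=> c0 [h bA bA']; split=> x.
- by move=> y; rewrite innerDl innerDr innerZl innerZr conjCK h.
- apply: le_trans (rnormD _ _) _; rewrite rnormZ mulrDl mul1r lerD2l -mulrA.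
  by rewrite ler_wpM2l ?nc_ge0.
- apply: le_trans (rnormD _ _) _; rewrite rnormZ ncJ mulrDl mul1r lerD2l -mulrA.
  by rewrite ler_wpM2l ?nc_ge0.
Qed.

(** [K A] is (A - z0)(A - z)^-1, a bounded operator that carries the resolvent at z0 to the one at
    z, whether composed on the left or on the right. *)
Lemma resolvent_difference_transfer (S T : linop H) z0 z x : selfadjoint S -> selfadjoint T ->
  complex.Im z0 != 0 -> complex.Im z != 0 ->
  let K A y := y + (z - z0) *: resolvent A z y in
  resolvent T z x - resolvent S z x =
  K T (resolvent T z0 (K S x) - resolvent S z0 (K S x)).
Proof.
move=> sS sT h0 hz K.
have lT := resolvent_linear sT hz; have lT0 := resolvent_linear sT h0.
have lS0 := resolvent_linear sS h0.
have kS y : resolvent S z0 (K S y) = resolvent S z y.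
  rewrite /K (linear_funD _ _ lS0) (linear_funZ _ _ lS0).
  have := resolvent_identity y sS h0 hz => /(congr1 (fun u => u + resolvent S z y)).
  rewrite subrK => ->; hring.
have kT y : K T (resolvent T z0 y) = resolvent T z y.
  by rewrite /K -resolvent_identity// addrC subrK.
have lK : linear (K T) by move=> a u v; rewrite /K lT; hring.
rewrite kS (linear_funB _ _ lK) kT /K (linear_funD _ _ lT) (linear_funZ _ _ lT); hring.
Qed.

End resolvent_differences.

(** * Schatten convergence of differences of trigonometric operators *)

Section schatten_convergence.
Context {R : realType} {H : hilbertType R}.
Implicit Types (x y : H) (z w : R[i]) (C c e : R).
Variables (p : R) (S1n S2n : nat -> linop H) (S1 S2 : linop H).
Hypotheses (p1 : 1 <= p) (s1n : forall n, selfadjoint (S1n n))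
  (s2n : forall n, selfadjoint (S2n n)) (s1 : selfadjoint S1) (s2 : selfadjoint S2)
  (c1 : strong_resolvent_cvg S1n S1) (c2 : strong_resolvent_cvg S2n S2).

Definition schatten_cvg (Tn : nat -> H -> H) (T : H -> H) : Prop :=
  [/\ forall n, exists2 C : R, 0 <= C & schatten_le p (Tn n) C,
      exists2 C : R, 0 <= C & schatten_le p T C &
      forall e : R, 0 < e -> \forall n \near \oo, schatten_le p (fun x => Tn n x - T x) e].

Lemma resolvent_diff_linear (S T : linop H) z : selfadjoint S -> selfadjoint T ->
  complex.Im z != 0 -> linear (fun x => resolvent T z x - resolvent S z x).
Proof. by move=> sS sT z0 a x y; rewrite !resolvent_linear//; hring. Qed.

Lemma resolvent_diff_bound (S T : linop H) z x : selfadjoint S -> selfadjoint T ->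
  complex.Im z != 0 ->
  rnorm (resolvent T z x - resolvent S z x) <= 2 * `|complex.Im z|^-1 * rnorm x.
Proof.
move=> sS sT z0; apply: le_trans (rnormB _ _) _.
have := rnorm_resolvent x sS z0; have := rnorm_resolvent x sT z0; lra.
Qed.

(** By [resolvent_difference_transfer] the difference at z is the one at z0 between bounded factors.
    Strong resolvent convergence at z handles the left factors, and at the conjugate of z the
    adjoints of the right ones. *)
Lemma schatten_cvg_resolvent z0 z : complex.Im z0 != 0 -> complex.Im z != 0 ->
  schatten_cvg (fun n x => resolvent (S2n n) z0 x - resolvent (S1n n) z0 x)
    (fun x => resolvent S2 z0 x - resolvent S1 z0 x) ->
  schatten_cvg (fun n x => resolvent (S2n n) z x - resolvent (S1n n) z x)
    (fun x => resolvent S2 z x - resolvent S1 z x).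
Proof.
move=> h0 hz [hn [C C0 hC] hcv].
have hzJ : complex.Im z^* != 0 by rewrite ImJ oppr_eq0.
pose K A y := y + (z - z0) *: resolvent A z y.
pose K' A y := y + (z - z0)^* *: resolvent A z^* y.
have I0 : 0 <= `|complex.Im z|^-1 by rewrite invr_ge0.
have J0 : 0 <= 2 * `|complex.Im z0|^-1 by rewrite mulr_ge0 ?invr_ge0.
pose c := 1 + nc (z - z0) * `|complex.Im z|^-1.
have cc0 : 0 <= c by rewrite addr_ge0// mulr_ge0 ?nc_ge0.
have aK A : selfadjoint A -> adjointable c (K A) (K' A).
  by move=> sA; apply: affine_adjointable => //; exact: resolvent_adjointable.
have tr A B : selfadjoint A -> selfadjoint B -> forall x,
    K B (resolvent B z0 (K A x) - resolvent A z0 (K A x)) = resolvent B z x - resolvent A z x.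
  by move=> sA sB x; rewrite (resolvent_difference_transfer x sA sB h0 hz).
have lin A B (sA : selfadjoint A) (sB : selfadjoint B) := resolvent_diff_linear sA sB h0.
have bnd A B (sA : selfadjoint A) (sB : selfadjoint B) x := resolvent_diff_bound x sA sB h0.
have sand A B C' : selfadjoint A -> selfadjoint B -> 0 <= C' ->
    schatten_le p (fun x => resolvent B z0 x - resolvent A z0 x) C' ->
    schatten_le p (fun x => resolvent B z x - resolvent A z x) (c * c * C').
  move=> sA sB C'0 h.
  apply: schatten_le_ext (tr _ _ sA sB) _.
  exact: (schatten_le_sandwich p1 (lin _ _ sA sB) J0 C'0 cc0 cc0
    (bnd _ _ sA sB) h (aK _ sB) (aK _ sA)).
split.
- move=> n; have [C' C'0 h] := hn n; exists (c * c * C'); first by rewrite !mulr_ge0.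
  exact: sand.
- by exists (c * c * C); [rewrite !mulr_ge0|exact: sand].
move=> e e0.
have Kc (An : nat -> linop H) A : strong_resolvent_cvg An A ->
    forall x, K (An n) x @[n --> \oo] --> K A x.
  by move=> hA x; apply: cvgD; [exact: cvg_cst|apply: cvgZr; exact: hA].
have K'c (An : nat -> linop H) A : strong_resolvent_cvg An A ->
    forall x, K' (An n) x @[n --> \oo] --> K' A x.
  by move=> hA x; apply: cvgD; [exact: cvg_cst|apply: cvgZr; exact: hA].
have := schatten_strong_cvg p1 J0 C0 cc0 (fun n => lin _ _ (s1n n) (s2n n))
  (fun n => bnd _ _ (s1n n) (s2n n)) (lin _ _ s1 s2) (bnd _ _ s1 s2) hC hcv
  (fun n => aK _ (s2n n)) (aK _ s2) (fun n => aK _ (s1n n)) (aK _ s1)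
  (Kc _ _ c2) (K'c _ _ c1) e0.
apply: filterS => n; apply: schatten_le_ext => x.
by rewrite tr// tr.
Qed.

Lemma strong_cvg_iter_cayley (An : nat -> linop H) A z k x :
  (forall n, selfadjoint (An n)) -> selfadjoint A -> strong_resolvent_cvg An A ->
  imag_unit z -> iter k (cayley (An n) z) x @[n --> \oo] --> iter k (cayley A z) x.
Proof.
move=> sAn sA hA hz; elim: k x => [|k IH] x; first exact: cvg_cst.
have one y : cayley (An n) z y @[n --> \oo] --> cayley A z y.
  by apply: cvgB; [apply: cvgZr; apply: hA; exact: imag_unit_neq0|exact: cvg_cst].
apply/cvgP_rnorm => e e0; have e2 : 0 < e / 2 by rewrite divr_gt0.
have [N1 h1] := (cvgP_rnorm _ _).1 (IH x) _ e2.
have [N2 h2] := (cvgP_rnorm _ _).1 (one (iter k (cayley A z) x)) _ e2.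
exists (maxn N1 N2) => n; rewrite geq_max => /andP[n1 n2] /=.
apply: le_trans (rnorm_dist_tri _ (cayley (An n) z (iter k (cayley A z) x)) _) _.
rewrite -(linear_funB _ _ (cayley_linear (sAn n) hz)).
have -> : forall v, rnorm (cayley (An n) z v) = rnorm v.
  by move=> v; exact: (rnorm_iter_cayley 1 v (sAn n) hz).
by have := h1 n n1; have := h2 n n2; lra.
Qed.

Definition cayley_diff (S T : linop H) z k x := iter k (cayley T z) x - iter k (cayley S z) x.

Lemma cayley_diff_linear (S T : linop H) z k : selfadjoint S -> selfadjoint T ->
  imag_unit z -> linear (cayley_diff S T z k).
Proof.
move=> sS sT hz a x y; rewrite /cayley_diff !(iter_cayley_linear k _ hz)//; hring.
Qed.

Lemma cayley_diff_bound (S T : linop H) z k x : selfadjoint S -> selfadjoint T ->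
  imag_unit z -> rnorm (cayley_diff S T z k x) <= 2 * rnorm x.
Proof.
move=> sS sT hz; apply: le_trans (rnormB _ _) _.
rewrite !rnorm_iter_cayley//; lra.
Qed.

Lemma cayley_diffS (S T : linop H) z k x : selfadjoint S -> selfadjoint T ->
  imag_unit z -> cayley_diff S T z k.+1 x =
  cayley T z (cayley_diff S T z k x) + cayley_diff S T z 1 (iter k (cayley S z) x).
Proof.
move=> sS sT hz; rewrite /cayley_diff /= (linear_funB _ _ (cayley_linear sT hz)).
by rewrite addrA subrK.
Qed.

Lemma cayley_diff_schatten (S T : linop H) z k C : selfadjoint S -> selfadjoint T ->
  imag_unit z -> 0 <= C -> schatten_le p (cayley_diff S T z 1) C ->
  schatten_le p (cayley_diff S T z k) (k%:R * C).
Proof.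
move=> sS sT hz C0 h; elim: k => [|k IH].
  rewrite mul0r => phi psi _ _ n; rewrite big1 ?powR_ge0// => i _.
  by rewrite /cayley_diff/= subrr inner0l nc0 powR0// gt_eqF// (lt_le_trans ltr01).
have h1 := schatten_le_isometryl (cayley_adj sT hz)
  (fun x y => cayley_isometry x y sT (imag_unitN hz)) IH.
have h2 := schatten_le_isometryr (fun x y => iter_cayley_isometry k x y sS hz) h.
have := schatten_leD p1 (mulr_ge0 (ler0n _ k) C0) C0 h1 h2.
rewrite -{2}(mul1r C) -mulrDl natr1; apply: schatten_le_ext => x.
by rewrite cayley_diffS.
Qed.

Hypothesis hyp : forall z, complex.Im z != 0 ->
  schatten_cvg (fun n x => resolvent (S2n n) z x - resolvent (S1n n) z x)
    (fun x => resolvent S2 z x - resolvent S1 z x).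

Lemma cayley_diff1E (S T : linop H) z x :
  cayley_diff S T z 1 x = - (2 * z) *: (resolvent T z x - resolvent S z x).
Proof. by rewrite /cayley_diff/= /cayley; hring. Qed.

Lemma imag_unit_nc2 z : imag_unit z -> nc (- (2 * z)) = 2 :> R.
Proof.
move=> hz; rewrite ncN ncM (imag_unit_nc hz) mulr1.
by rewrite -[2](rmorph_nat (real_complex R)) ncR ger0_norm.
Qed.

(** Both terms of [cayley_diffS] have the form X_n T_n Y_n with one outer factor the identity. The
    right factor is a power of a Cayley transform whose adjoint lives at - z, so strong convergence
    is needed for both signs. *)
Lemma cayley_diff_cvg z k : imag_unit z ->
  schatten_cvg (fun n => cayley_diff (S1n n) (S2n n) z k) (cayley_diff S1 S2 z k).
Proof.
move=> hz; have [hn [C C0 hC] hcv] := hyp (imag_unit_neq0 hz).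
have one (S T : linop H) C' : 0 <= C' ->
    schatten_le p (fun x => resolvent T z x - resolvent S z x) C' ->
    schatten_le p (cayley_diff S T z 1) (2 * C').
  move=> C'0 h; have := schatten_leZ (- (2 * z)) p1 C'0 h.
  by rewrite imag_unit_nc2//; apply: schatten_le_ext => x; rewrite cayley_diff1E.
have hC1 := one _ _ _ C0 hC; have C10 : 0 <= 2 * C by rewrite mulr_ge0.
split.
- move=> n; have [C' C'0 h] := hn n; exists (k%:R * (2 * C')); first by rewrite !mulr_ge0.
  apply: cayley_diff_schatten => //; first by rewrite mulr_ge0.
  exact: one.
- exists (k%:R * (2 * C)); first by rewrite mulr_ge0.
  exact: cayley_diff_schatten.
have cv1 e : 0 < e -> \forall n \near \oo, schatten_le p
    (fun x => cayley_diff (S1n n) (S2n n) z 1 x - cayley_diff S1 S2 z 1 x) e.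
  move=> e0; have e2 : 0 < e / 2 by rewrite divr_gt0.
  apply: filterS (hcv _ e2) => n h.
  have := schatten_leZ (- (2 * z)) p1 (ltW e2) h.
  rewrite imag_unit_nc2// [2 * (e / 2)]mulrC divfK//; apply: schatten_le_ext => x.
  by rewrite !cayley_diff1E -scalerBr.
elim: k => [|k IH] e e0.
  near=> n; move=> phi psi _ _ m; rewrite big1 ?powR_ge0// => i _.
  by rewrite /cayley_diff/= !subrr inner0l nc0 powR0// gt_eqF// (lt_le_trans ltr01).
have e2 : 0 < e / 2 by rewrite divr_gt0.
have hNz := imag_unitN hz.
have aI : adjointable 1 id (@id H) := adjointable_id.
have aC (S : linop H) j : selfadjoint S -> adjointable 1 (iter j (cayley S z)) (iter j (cayley S (- z))).
  move=> sS; split; first exact: iter_cayley_adj.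
    by move=> x; rewrite rnorm_iter_cayley// mul1r.
  by move=> x; rewrite rnorm_iter_cayley// mul1r.
have aC1 (S : linop H) : selfadjoint S -> adjointable 1 (cayley S z) (cayley S (- z)).
  by move=> sS; have := aC S 1%N sS.
have cI (x : H) : (fun _ : nat => id x) n @[n --> \oo] --> id x by exact: cvg_cst.
have Ck := cayley_diff_schatten k s1 s2 hz C10 hC1.
have kC0 : 0 <= k%:R * (2 * C) by rewrite mulr_ge0.
have l2 : 0 <= 2 :> R by [].
have h1 := schatten_strong_cvg p1 l2 kC0 ler01
  (fun n => cayley_diff_linear k (s1n n) (s2n n) hz)
  (fun n x => cayley_diff_bound k x (s1n n) (s2n n) hz)
  (cayley_diff_linear k s1 s2 hz) (fun x => cayley_diff_bound k x s1 s2 hz) Ck IH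
  (fun n => aC1 _ (s2n n)) (aC1 _ s2) (fun n => aI) aI
  (fun x => strong_cvg_iter_cayley (k := 1) (x := x) s2n s2 c2 hz) cI e2.
have h2 := schatten_strong_cvg p1 l2 C10 ler01
  (fun n => cayley_diff_linear 1 (s1n n) (s2n n) hz)
  (fun n x => cayley_diff_bound 1 x (s1n n) (s2n n) hz)
  (cayley_diff_linear 1 s1 s2 hz) (fun x => cayley_diff_bound 1 x s1 s2 hz) hC1 cv1
  (fun n => aI) aI (fun n => aC _ k (s1n n)) (aC _ k s1) cI
  (fun x => strong_cvg_iter_cayley (k := k) (x := x) s1n s1 c1 hNz) e2.
apply: filterS2 h1 h2 => n h1 h2.
have := schatten_leD p1 (ltW e2) (ltW e2) h1 h2.
rewrite -splitr; apply: schatten_le_ext => x /=.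
rewrite (cayley_diffS k x (s1n n) (s2n n) hz) (cayley_diffS k x s1 s2 hz); hring.
Unshelve. all: by end_near. Qed.

Definition trig_diff n a b K x :=
  (trig_op (S2n n) a b K x - trig_op (S1n n) a b K x) -
  (trig_op S2 a b K x - trig_op S1 a b K x).

Let Dn z n k x := cayley_diff (S1n n) (S2n n) z k x - cayley_diff S1 S2 z k x.

Lemma trig_diff_schatten n a b K (d : nat -> R) : (forall k, 0 <= d k) ->
  (forall k, schatten_le p (Dn (- 'i) n k) (d k)) -> (forall k, schatten_le p (Dn 'i n k) (d k)) ->
  schatten_le p (trig_diff n a b K) (\sum_(k < K) (nc (a k) + nc (b k)) * d k).
Proof.
move=> d0 h1 h2.
pose T k x := a k *: Dn (- 'i) n k x + b k *: Dn 'i n k x.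
apply: (@schatten_le_ext _ _ _ (fun x => \sum_(k < K) T k x)).
  move=> x; rewrite /trig_diff /trig_op -!sumrB; apply: eq_bigr => k _.
  by rewrite /T /Dn /cayley_diff; hring.
apply: (@schatten_le_sum _ _ p T (fun k => (nc (a k) + nc (b k)) * d k)) => // k.
  by rewrite mulr_ge0 ?addr_ge0 ?nc_ge0.
move=> _; rewrite mulrDl; apply: schatten_leD; rewrite ?mulr_ge0 ?nc_ge0//.
  exact: schatten_leZ.
exact: schatten_leZ.
Qed.

Lemma Dn_linear_bound n z : imag_unit z -> exists2 c, 0 <= c &
  forall k, schatten_le p (Dn z n k) (k%:R * c).
Proof.
move=> hz; have [hn [C C0 hC] _] := @cayley_diff_cvg z 1 hz.
have [C' C'0 hC'] := hn n; exists (C' + C); first exact: addr_ge0.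
move=> k; rewrite mulrDr; apply: schatten_leB; rewrite ?mulr_ge0//.
  exact: cayley_diff_schatten.
exact: cayley_diff_schatten.
Qed.

(** Once the first difference is within 1 of its limit, its bound 1 + C no longer depends on n; this
    is the domination needed for the limit. *)
Lemma Dn_linear_bound_near z : imag_unit z -> exists2 c, 0 <= c &
  \forall n \near \oo, forall k, schatten_le p (Dn z n k) (k%:R * c).
Proof.
move=> hz; have [hn [C C0 hC] hcv] := @cayley_diff_cvg z 1 hz.
exists ((1 + C) + C); first by rewrite !addr_ge0.
apply: filterS (hcv 1 ltr01) => n h k; rewrite mulrDr.
have hC' : schatten_le p (cayley_diff (S1n n) (S2n n) z 1) (1 + C).
  have := schatten_leD p1 ler01 C0 h hC; apply: schatten_le_ext => x.
  by rewrite subrK.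
apply: schatten_leB; rewrite ?mulr_ge0 ?addr_ge0//.
  by apply: cayley_diff_schatten => //; rewrite addr_ge0.
exact: cayley_diff_schatten.
Qed.

Definition decay (C : R) (a b : nat -> R[i]) :=
  forall k, nc (a k) <= C / k.+1%:R ^+ 3 /\ nc (b k) <= C / k.+1%:R ^+ 3.

(** This gives membership in the ideal for each fixed n: the bound may depend on n but not on the
    coefficients. *)
Lemma trig_diff_bounded n C : 0 <= C -> exists2 B, 0 <= B &
  forall a b K, decay C a b -> schatten_le p (trig_diff n a b K) B.
Proof.
move=> C0; have [u u0 hu] := Dn_linear_bound n (imag_unit_i (R := R)).
have [v v0 hv] := Dn_linear_bound n (imag_unit_Ni (R := R)).
have uv0 : 0 <= u + v by rewrite addr_ge0.
exists (4 * C * (u + v)); first by rewrite !mulr_ge0.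
move=> a b K hab.
have := @trig_diff_schatten n a b K (fun k => k%:R * (u + v)) _ _ _.
move=> /(_ (fun k => mulr_ge0 (ler0n _ k) uv0)) h.
have {}h : schatten_le p (trig_diff n a b K) (\sum_(k < K) (nc (a k) + nc (b k)) * (k%:R * (u + v))).
  apply: h => k.
    apply: schatten_le_mono (hv k) => //; rewrite ?mulr_ge0//.
    by rewrite ler_wpM2l// lerDr.
  apply: schatten_le_mono (hu k) => //; rewrite ?mulr_ge0//.
  by rewrite ler_wpM2l// lerDl.
apply: schatten_le_mono h => //.
  by apply: sumr_ge0 => k _; rewrite !mulr_ge0 ?addr_ge0 ?nc_ge0.
apply: le_trans (ler_wpM2r uv0 (trig_decay_weight K C0 hab)).
by rewrite /trig_weight mulr_suml; apply: ler_sum => k _; rewrite mulrCA mulrA.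
Qed.

Lemma sum_lt_le (N K : nat) : \sum_(k < K) (k < N)%N%:R <= N%:R :> R.
Proof.
suff -> : \sum_(k < K) (k < N)%N%:R = (minn K N)%:R :> R by rewrite ler_nat geq_minr.
elim: K => [|K IH]; first by rewrite big_ord0 min0n.
rewrite big_ord_recr/= IH -natrD; congr (_%:R).
by case: ltnP => KN /=; lia.
Qed.

Lemma sum_ge_le (N K : nat) (u : nat -> R) : (forall k, 0 <= u k) ->
  \sum_(k < K) (N <= k)%N%:R * u k <= \sum_(N <= k < N + K) u k.
Proof.
move=> u0; rewrite -(big_mkord xpredT (fun k => (N <= k)%N%:R * u k)).
apply: (@le_trans _ _ (\sum_(0 <= k < N + K) (N <= k)%N%:R * u k)).
  rewrite (@big_cat_nat _ _ _ K 0 (N + K))//= ?leq_addl// lerDl.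
  by apply: sumr_ge0 => k _; rewrite mulr_ge0.
rewrite (@big_cat_nat _ _ _ N 0 (N + K))//= ?leq_addr// big_nat big1; last first.
  by move=> k /andP[_ kN]; rewrite leqNgt kN mul0r.
rewrite add0r big_nat [leRHS]big_nat; apply: ler_sum => k /andP[Nk _].
by rewrite Nk mul1r.
Qed.

(** Dominated convergence over k: finitely many k are handled by [cayley_diff_cvg], the others by
    the linear bound against the cubic decay. The threshold for n must precede a, b and K, because
    these change with the accuracy of the approximation of f. *)
Lemma trig_diff_cvg C e : 0 <= C -> 0 < e -> \forall n \near \oo,
  forall a b K, decay C a b -> schatten_le p (trig_diff n a b K) e.
Proof.
move=> C0 e0.
have [u u0 hu] := Dn_linear_bound_near (imag_unit_i (R := R)).
have [v v0 hv] := Dn_linear_bound_near (imag_unit_Ni (R := R)).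
have uv0 : 0 <= u + v by rewrite addr_ge0.
have A0 : 0 < 2 * C * (u + v) + 1 by rewrite ltr_wpDl// !mulr_ge0.
have e1 : 0 < e / 2 / (2 * C * (u + v) + 1) by rewrite !divr_gt0.
have [N hN] := @sum_tail_small R (fun k => (k.+1%:R ^+ 2)^-1) 2
  (fun k => ltac:(by rewrite invr_ge0 exprn_ge0))
  (fun n => ltac:(by rewrite big_mkord; exact: sum_inv_sqr_le)) _ e1.
have B0 : 0 < 2 * C * N%:R + 1 by rewrite ltr_wpDl// !mulr_ge0.
pose d := e / 2 / (2 * C * N%:R + 1).
have d0 : 0 < d by rewrite !divr_gt0.
have low z : imag_unit z -> \forall n \near \oo, forall k, (k < N)%N -> schatten_le p (Dn z n k) d.
  move=> hz; elim: (N) => [|m IH]; first by near=> n.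
  have [_ _ hcv] := cayley_diff_cvg m hz.
  apply: filterS2 IH (hcv _ d0) => n h h' k.
  by rewrite ltnS leq_eqVlt => /orP[/eqP->//|]; exact: h.
have := low _ (imag_unit_i (R := R)); have := low _ (imag_unit_Ni (R := R)) => l1 l2.
near=> n; move=> a b K hab.
have l1n : forall k, (k < N)%N -> schatten_le p (Dn (- 'i) n k) d by near: n; exact: l1.
have l2n : forall k, (k < N)%N -> schatten_le p (Dn 'i n k) d by near: n; exact: l2.
have hun : forall k, schatten_le p (Dn 'i n k) (k%:R * u) by near: n; exact: hu.
have hvn : forall k, schatten_le p (Dn (- 'i) n k) (k%:R * v) by near: n; exact: hv.
pose dk k := if (k < N)%N then d else k%:R * (u + v).
have dk0 k : 0 <= dk k by rewrite /dk; case: ifP => _; [exact: ltW|rewrite mulr_ge0].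
have h := @trig_diff_schatten n a b K dk dk0.
have {}h : schatten_le p (trig_diff n a b K) (\sum_(k < K) (nc (a k) + nc (b k)) * dk k).
  apply: h => k; rewrite /dk; case: ifP => kN.
  - exact: l1n.
  - apply: schatten_le_mono (hvn k) => //; rewrite ?mulr_ge0//.
    by rewrite ler_wpM2l// lerDr.
  - exact: l2n.
  - apply: schatten_le_mono (hun k) => //; rewrite ?mulr_ge0//.
    by rewrite ler_wpM2l// lerDl.
apply: schatten_le_mono h => //.
  by apply: sumr_ge0 => k _; rewrite mulr_ge0 ?addr_ge0 ?nc_ge0.
have ab k : nc (a k) + nc (b k) <= 2 * C / k.+1%:R ^+ 3.
  by have [ha hb] := hab k; apply: le_trans (lerD ha hb) _; rewrite -mulrA mulr_natl mulr2n.
have k1 k : 1 <= k.+1%:R :> R by rewrite ler1n.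
(* The indicators split the sum at N: the head is at most 2 C d N, and the tail uses k / (k + 1)^3
   <= 1 / (k + 1)^2. *)
apply: (@le_trans _ _ (\sum_(k < K) (2 * C * d * (k < N)%N%:R +
    2 * C * (u + v) * ((N <= k)%N%:R * (k.+1%:R ^+ 2)^-1)))).
  apply: ler_sum => k _; rewrite /dk (leqNgt N k); case: ifP => kN /=.
    rewrite mul0r mulr0 addr0 mulr1 ler_wpM2r ?(ltW d0)//; apply: le_trans (ab k) _.
    by rewrite ler_piMr ?mulr_ge0// invf_le1 ?exprn_gt0 ?ltr0n// exprn_ege1.
  rewrite mulr0 add0r mul1r.
  apply: (@le_trans _ _ (2 * C / k.+1%:R ^+ 3 * (k.+1%:R * (u + v)))).
    apply: ler_pM; rewrite ?addr_ge0 ?nc_ge0 ?mulr_ge0//.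
    by rewrite ler_wpM2r// ler_nat.
  rewrite le_eqVlt; apply/orP; left; apply/eqP; field.
  by rewrite gt_eqF// ltr0n.
rewrite big_split/= -!mulr_sumr [leRHS]splitr; apply: lerD.
  apply: (@le_trans _ _ (2 * C * d * N%:R)).
    apply: ler_wpM2l (sum_lt_le _ _); apply: mulr_ge0 (ltW d0); exact: mulr_ge0.
  rewrite mulrAC /d mulrCA ger_pMr ?divr_gt0// ler_pdivrMr// mul1r lerDl//.
apply: (@le_trans _ _ (2 * C * (u + v) * (e / 2 / (2 * C * (u + v) + 1)))).
  rewrite ler_wpM2l ?mulr_ge0//; apply: le_trans (hN (N + K)%N).
  by apply: sum_ge_le => k; rewrite invr_ge0 exprn_ge0.
rewrite mulrCA ger_pMr ?divr_gt0// ler_pdivrMr// mul1r lerDl//.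
Unshelve. all: by end_near. Qed.

End schatten_convergence.

Section functional_calculus_convergence.
Context {R : realType} {H : hilbertType R}.
Implicit Types (x y : H) (e : R).

(** C is chosen before e, so the decay constant does not deteriorate with the accuracy; the uniform
    Schatten bounds rest on this. *)
Lemma functional_calculus_approximation (f : R -> R[i]) : test_function f ->
  exists2 C : R, 0 <= C & forall e, 0 < e -> exists a b K, decay C a b /\
  forall S A : linop H, selfadjoint S -> is_functional_calculus S f A -> linear A /\
    forall x y, nc (inner (A x - trig_op S a b K x) y) <= e * rnorm x * rnorm y.
Proof.
move=> tf; have [C C0 hC] := test_function_trig_approx tf.
exists C => // e e0; have := archi_boundP (mulr_ge0 C0 (ltW (divr_gt0 (ltr0n R 4) e0))).
set K := Num.bound _ => hK; have [a [b [hab hf]]] := hC K.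
exists a, b, K.+1; split=> // S A sS fA.
have [lA h] := functional_calculus_trig sS tf fA hf; split=> // x y.
apply: le_trans (h x y) _; rewrite -[leLHS]mulrA -[leRHS]mulrA ler_wpM2r ?mulr_ge0 ?rnorm_ge0//.
have K0 : 0 < K.+1%:R :> R by rewrite ltr0n.
have KK : K%:R <= K.+1%:R :> R by rewrite ler_nat.
rewrite mulrA ler_pdivrMr// -ler_pdivrMl//.
by apply: le_trans KK; rewrite ltW// (_ : e^-1 * (4 * C) = C * (4 / e))//; ring.
Qed.

Lemma functional_calculus_bounded (f : R -> R[i]) : test_function f ->
  exists2 M : R, 0 <= M & forall S A : linop H, selfadjoint S ->
    is_functional_calculus S f A -> linear A /\ forall x, rnorm (A x) <= M * rnorm x.
Proof.
move=> /functional_calculus_approximation[C _ /(_ 1 ltr01)[a [b [K [_ h]]]]].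
exists (1 + \sum_(k < K) (nc (a k) + nc (b k))).
  by rewrite addr_ge0// sumr_ge0// => k _; rewrite addr_ge0 ?nc_ge0.
move=> S A sS fA; have [lA bA] := h S A sS fA; split=> // x.
rewrite -(subrK (trig_op S a b K x) (A x)); apply: le_trans (rnormD _ _) _.
rewrite mulrDl lerD ?rnorm_trig_op//.
exact: (bounded_of_form (T := fun x => A x - trig_op S a b K x)).
Qed.

Context (f : R -> R[i]) (S1n S2n A1n A2n : nat -> linop H) (S1 S2 A1 A2 : linop H).
Hypotheses (tf : test_function f)
  (s1n : forall n, selfadjoint (S1n n)) (s2n : forall n, selfadjoint (S2n n))
  (s1 : selfadjoint S1) (s2 : selfadjoint S2)
  (f1n : forall n, is_functional_calculus (S1n n) f (A1n n))
  (f2n : forall n, is_functional_calculus (S2n n) f (A2n n))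
  (f1 : is_functional_calculus S1 f A1) (f2 : is_functional_calculus S2 f A2).

Let F n x := (A2n n x - A1n n x) - (A2 x - A1 x).

Lemma functional_calculus_diff_bounded : exists2 M : R, 0 <= M &
  forall n, linear (F n) /\ forall x, rnorm (F n x) <= M * rnorm x.
Proof.
have [M M0 h] := functional_calculus_bounded tf.
exists (4 * M); first exact: mulr_ge0.
move=> n; have [l1n b1n] := h _ _ (s1n n) (f1n n); have [l2n b2n] := h _ _ (s2n n) (f2n n).
have [l1 b1] := h _ _ s1 f1; have [l2 b2] := h _ _ s2 f2; split=> [a x y|x].
  by rewrite /F l1n l2n l1 l2; hring.
apply: le_trans (rnormB _ _) _; apply: le_trans (lerD (rnormB _ _) (rnormB _ _)) _.
by have := b1n x; have := b2n x; have := b1 x; have := b2 x; lra.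
Qed.

Lemma functional_calculus_diff_approximation : exists2 C : R, 0 <= C &
  forall e, 0 < e -> exists a b K, decay C a b /\ forall n x y,
    nc (inner (F n x - trig_diff S1n S2n S1 S2 n a b K x) y) <= e * rnorm x * rnorm y.
Proof.
have [C C0 hC] := functional_calculus_approximation tf; exists C => // e e0.
have e4 : 0 < e / 4 by rewrite divr_gt0.
have [a [b [K [hab h]]]] := hC _ e4; exists a, b, K; split=> // n x y.
have [_ /(_ x y) h1n] := h _ _ (s1n n) (f1n n); have [_ /(_ x y) h2n] := h _ _ (s2n n) (f2n n).
have [_ /(_ x y) h1] := h _ _ s1 f1; have [_ /(_ x y) h2] := h _ _ s2 f2.
pose d (S A : linop H) := inner (A x - trig_op S a b K x) y.
have -> : inner (F n x - trig_diff S1n S2n S1 S2 n a b K x) y =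
    (d (S2n n) (A2n n) - d (S1n n) (A1n n)) - (d S2 A2 - d S1 A1).
  rewrite /d -!innerBl; congr (inner _ y); rewrite /F /trig_diff; hring.
apply: le_trans (ncB _ _) _; apply: le_trans (lerD (ncB _ _) (ncB _ _)) _.
have -> : e * rnorm x * rnorm y = 4 * (e / 4 * rnorm x * rnorm y) by field.
move: h1n h2n h1 h2; rewrite -/(d _ _) -/(d _ _) -/(d _ _) -/(d _ _); lra.
Qed.

Lemma op_norm_functional_calculus_cvg :
  (forall z : R[i], complex.Im z != 0 -> forall e : R, 0 < e ->
    \forall n \near \oo, forall x, rnorm ((resolvent (S2n n) z x - resolvent S2 z x)
      - (resolvent (S1n n) z x - resolvent S1 z x)) <= e * rnorm x) ->
  op_norm (F n) @[n --> \oo] --> 0%E.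
Proof.
move=> hD; apply/ereal_cvg0P => [n|e e0]; first exact: op_norm_ge0.
have [C _ hC] := functional_calculus_diff_approximation.
have e2 : 0 < e / 2 by rewrite divr_gt0.
have [a [b [K [_ h]]]] := hC _ e2.
apply: filterS (cvgD0_trig_op s1n s2n s1 s2 hD a b K e2) => n hn.
apply: op_norm_le; first exact: ltW.
move=> x; rewrite -(subrK (trig_diff S1n S2n S1 S2 n a b K x) (F n x)).
apply: le_trans (rnormD _ _) _; rewrite [e]splitr mulrDl; apply: lerD.
  exact: (bounded_of_form (T := fun x => F n x - trig_diff S1n S2n S1 S2 n a b K x)).
apply: le_trans (hn x); rewrite le_eqVlt; apply/orP; left; apply/eqP.
by congr rnorm; rewrite /trig_diff; hring.
Qed.

Lemma schatten_norm_functional_calculus_cvg (p : R) : 1 <= p ->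
  strong_resolvent_cvg S1n S1 -> strong_resolvent_cvg S2n S2 ->
  (forall z : R[i], complex.Im z != 0 ->
    schatten_cvg p (fun n x => resolvent (S2n n) z x - resolvent (S1n n) z x)
      (fun x => resolvent S2 z x - resolvent S1 z x)) ->
  (forall n, in_schatten p (F n)) /\ schatten_norm p (F n) @[n --> \oo] --> 0%E.
Proof.
move=> p1 c1 c2 hyp; have [M M0 hM] := functional_calculus_diff_bounded.
have [C C0 hC] := functional_calculus_diff_approximation.
(* The approximants converge to F n in operator norm only, but share the Schatten bound B, which
   therefore passes to F n. *)
have lim n B : (forall a b K, decay C a b ->
    schatten_le p (trig_diff S1n S2n S1 S2 n a b K) B) -> schatten_le p (F n) B.
  move=> h; apply: schatten_le_lim => // e e0; have [a [b [K [hab hF]]]] := hC e e0.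
  exists (trig_diff S1n S2n S1 S2 n a b K); split; first exact: h.
  move=> x y x1 y1; apply: le_trans (hF n x y) _.
  rewrite -mulrA ler_piMr ?(ltW e0)//.
  by rewrite mulr_ile1 ?rnorm_ge0.
split=> [n|].
  have [B B0 hB] := trig_diff_bounded p1 s1n s2n s1 s2 c1 c2 hyp n C0.
  have [lF bF] := hM n.
  by have [] := schatten_le_in_schatten p1 lF M0 B0 bF (lim n B hB).
apply/ereal_cvg0P => [n|e e0]; first exact: schatten_norm_ge0.
apply: filterS (trig_diff_cvg p1 s1n s2n s1 s2 c1 c2 hyp C0 e0) => n hn.
have [lF bF] := hM n.
by have [] := schatten_le_in_schatten p1 lF M0 (ltW e0) bF (lim n e hn).
Qed.

End functional_calculus_convergence.

Section resolvent_schatten.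
Context {R : realType} {H : hilbertType R}.
Implicit Types (x : H) (e : R) (z : R[i]).
Context (S1n S2n : nat -> linop H) (S1 S2 : linop H).
Hypotheses (s1n : forall n, selfadjoint (S1n n)) (s2n : forall n, selfadjoint (S2n n))
  (s1 : selfadjoint S1) (s2 : selfadjoint S2).

Lemma double_difference_linear z : complex.Im z != 0 -> forall n, linear (fun x =>
  (resolvent (S2n n) z x - resolvent S2 z x) - (resolvent (S1n n) z x - resolvent S1 z x)).
Proof. by move=> z0 n a x y; rewrite !resolvent_linear//; hring. Qed.

Lemma double_difference_bound z : complex.Im z != 0 -> forall n x,
  rnorm ((resolvent (S2n n) z x - resolvent S2 z x) - (resolvent (S1n n) z x - resolvent S1 z x))
  <= 4 * `|complex.Im z|^-1 * rnorm x.
Proof.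
move=> z0 n x; apply: le_trans (rnormB _ _) _.
have := resolvent_diff_bound x s2 (s2n n) z0; have := resolvent_diff_bound x s1 (s1n n) z0; lra.
Qed.

(** The bridge between norms defined by singular values and the bounds [schatten_le]; the four
    resolvents are regrouped on the way. *)
Lemma schatten_norm_resolvent_cvgP (p : R) z : 1 <= p -> complex.Im z != 0 ->
  [/\ forall n, in_schatten p (fun x => resolvent (S2n n) z x - resolvent (S1n n) z x),
      in_schatten p (fun x => resolvent S2 z x - resolvent S1 z x)
    & schatten_norm p (fun x => (resolvent (S2n n) z x - resolvent S2 z x)
        - (resolvent (S1n n) z x - resolvent S1 z x)) @[n --> \oo] --> 0%E] <->
  schatten_cvg p (fun n x => resolvent (S2n n) z x - resolvent (S1n n) z x)
    (fun x => resolvent S2 z x - resolvent S1 z x).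
Proof.
move=> p1 z0; have I2 : 0 <= 2 * `|complex.Im z|^-1 by rewrite mulr_ge0 ?invr_ge0.
have I4 : 0 <= 4 * `|complex.Im z|^-1 by rewrite mulr_ge0 ?invr_ge0.
have lD := double_difference_linear z0; have bD := double_difference_bound z0.
have n0 n : (0 <= schatten_norm p (fun x => (resolvent (S2n n) z x - resolvent S2 z x)
    - (resolvent (S1n n) z x - resolvent S1 z x))%R)%E by exact: schatten_norm_ge0.
split=> [[hn h hcv]|[hn [C C0 hC] hcv]]; split.
- move=> n; have [lT _ fT] := hn n.
  exact: schatten_norm_fin_le p1 lT (fun x => resolvent_diff_bound x (s1n n) (s2n n) z0) fT.
- have [lT _ fT] := h.
  exact: schatten_norm_fin_le p1 lT (fun x => resolvent_diff_bound x s1 s2 z0) fT.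
- move=> e e0; have e2 : 0 < e / 2 by rewrite divr_gt0.
  apply: filterS ((ereal_cvg0P n0).1 hcv _ e2) => n hne.
  have lt_e : (schatten_norm p (fun x => (resolvent (S2n n) z x - resolvent S2 z x)
      - (resolvent (S1n n) z x - resolvent S1 z x))%R < e%:E)%E.
    by apply: le_lt_trans hne _; rewrite lte_fin; lra.
  apply: schatten_le_ext (schatten_norm_lt_le p1 (ltW e0) (lD n) (bD n) lt_e).
  by move=> x /=; hring.
- move=> n; have [C' C'0 hC'] := hn n.
  by have [] := schatten_le_in_schatten p1 (resolvent_diff_linear (s1n n) (s2n n) z0) I2 C'0
    (fun x => resolvent_diff_bound x (s1n n) (s2n n) z0) hC'.
- by have [] := schatten_le_in_schatten p1 (resolvent_diff_linear s1 s2 z0) I2 C0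
    (fun x => resolvent_diff_bound x s1 s2 z0) hC.
- apply/ereal_cvg0P => // e e0; apply: filterS (hcv e e0) => n hne.
  suff hle : schatten_le p (fun x => (resolvent (S2n n) z x - resolvent S2 z x)
      - (resolvent (S1n n) z x - resolvent S1 z x)) e.
    by have [] := schatten_le_in_schatten p1 (lD n) I4 (ltW e0) (bD n) hle.
  by apply: schatten_le_ext hne => x /=; hring.
Qed.

End resolvent_schatten.

(* In (i) the convergence is required for all z0 (in (ii), for some z0): with
   B(H)-norms, convergence at one z0 does not imply convergence at all z0. With
   P_n the projection on the n-th vector of an orthonormal sequence, z0 = i,
   S1 = 1, S2 = 2, S1n n = 1 - (3/2) P_n and S2n n = 2 - 3 P_n, the expression
   at z0 vanishes for all n, but the conclusion fails when f 1 = 1 and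
   f 2 = f (-1) = f (-1/2) = 0. *)
Theorem theorem3p5 (R : realType) (H : hilbertType R)
    (S1n S2n : nat -> linop H) (S1 S2 : linop H) :
  separable H ->
  (forall n, selfadjoint (S1n n)) -> (forall n, selfadjoint (S2n n)) ->
  selfadjoint S1 -> selfadjoint S2 ->
  strong_resolvent_cvg S1n S1 -> strong_resolvent_cvg S2n S2 ->
  (* (i) *)
  ((forall z0 : R[i], complex.Im z0 != 0 ->
      op_norm (fun x =>
        (resolvent (S2n n) z0 x - resolvent S2 z0 x)
        - (resolvent (S1n n) z0 x - resolvent S1 z0 x))
      @[n --> \oo] --> 0%E) ->
   forall f : R -> R[i], test_function f ->
   forall (f_S1n f_S2n : nat -> linop H) (f_S1 f_S2 : linop H),
     (forall n, is_functional_calculus (S1n n) f (f_S1n n)) ->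
     (forall n, is_functional_calculus (S2n n) f (f_S2n n)) ->
     is_functional_calculus S1 f f_S1 ->
     is_functional_calculus S2 f f_S2 ->
     op_norm (fun x => (f_S2n n x - f_S1n n x) - (f_S2 x - f_S1 x))
     @[n --> \oo] --> 0%E)
  /\
  (* (ii) *)
  (forall p : R, 1 <= p ->
   let hyp (z0 : R[i]) :=
     [/\ forall n, in_schatten p (fun x =>
           resolvent (S2n n) z0 x - resolvent (S1n n) z0 x),
         in_schatten p (fun x => resolvent S2 z0 x - resolvent S1 z0 x)
       & schatten_norm p (fun x =>
           (resolvent (S2n n) z0 x - resolvent S2 z0 x)
           - (resolvent (S1n n) z0 x - resolvent S1 z0 x))
         @[n --> \oo] --> 0%E] in
   (exists z0 : R[i], complex.Im z0 != 0 /\ hyp z0) ->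
   (forall z0 : R[i], complex.Im z0 != 0 -> hyp z0) /\
   forall f : R -> R[i], test_function f ->
   forall (f_S1n f_S2n : nat -> linop H) (f_S1 f_S2 : linop H),
     (forall n, is_functional_calculus (S1n n) f (f_S1n n)) ->
     (forall n, is_functional_calculus (S2n n) f (f_S2n n)) ->
     is_functional_calculus S1 f f_S1 ->
     is_functional_calculus S2 f f_S2 ->
     (forall n, in_schatten p (fun x =>
        (f_S2n n x - f_S1n n x) - (f_S2 x - f_S1 x))) /\
     schatten_norm p (fun x => (f_S2n n x - f_S1n n x) - (f_S2 x - f_S1 x))
     @[n --> \oo] --> 0%E).
Proof.
move=> _ s1n s2n s1 s2 c1 c2; split.
  move=> hop f tf f1n f2n f1 f2 h1n h2n h1 h2.
  apply: (op_norm_functional_calculus_cvg tf s1n s2n s1 s2) => // z z0 e e0.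
  have n0 n : (0 <= op_norm (fun x => (resolvent (S2n n) z x - resolvent S2 z x)
      - (resolvent (S1n n) z x - resolvent S1 z x))%R)%E by exact: op_norm_ge0.
  apply: filterS ((ereal_cvg0P n0).1 (hop z z0) e e0) => n.
  exact: op_norm_bound (double_difference_linear s1n s2n s1 s2 z0 n).
move=> p p1 hyp [z0 [iz0 /(schatten_norm_resolvent_cvgP s1n s2n s1 s2 p1 iz0) hz0]].
have hz z : complex.Im z != 0 -> schatten_cvg p
    (fun n x => resolvent (S2n n) z x - resolvent (S1n n) z x)
    (fun x => resolvent S2 z x - resolvent S1 z x).
  by move=> iz; exact: schatten_cvg_resolvent iz0 iz hz0.
split; first by move=> z iz; exact/(schatten_norm_resolvent_cvgP s1n s2n s1 s2 p1 iz)/hz.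
move=> f tf f1n f2n f1 f2 h1n h2n h1 h2.
exact: (schatten_norm_functional_calculus_cvg tf s1n s2n s1 s2).
Qed.
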